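(* Let $a\in\mathbb{C}$. For all $t_0>0$ and all $\epsilon_0\in H^1(\mathbb{R})$ there exists a unique solution $v$ of the initial value problem $$-iv_t+v_{xx}-\frac1t\left(|v|^2-|a|^2\right)v=0,\quad 1/t_0<t<\infty,\ x\in\mathbb{R},\qquad v(1/t_0,x)=a+\epsilon_0(x),$$ with $$v-a\in\mathcal{C}\left([1/t_0,\infty),H^1(\mathbb{R})\right).$$ Moreover, for all $t\ge 1/t_0$, $$\int|v_x(t,x)|^2\,dx\le 2E(1/t_0),$$ and $$\int_{1/t_0}^{\infty}\int\left(|v(t,x)|^2-|a|^2\right)^2dx\,\frac{dt}{t^2}\le 4E(1/t_0),$$ and in particular $$\liminf_{t\to\infty}\frac1t\int\left(|v(t,x)|^2-|a|^2\right)^2dx=0.$$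
   Context: Here the energy of $v$ at time $t$ is $$E(t)=\frac12\int_{\mathbb{R}}|v_x(t,x)|^2dx+\frac1{4t}\int_{\mathbb{R}}\left(|v(t,x)|^2-|a|^2\right)^2dx,$$ and all space integrals are over $\mathbb{R}$. *)

(* Defs.v *)
From HB Require Import structures.
From mathcomp Require Import all_boot all_order all_algebra.
From mathcomp Require Import complex.
From mathcomp Require Import all_classical all_reals all_analysis.

Set Implicit Arguments.
Unset Strict Implicit.
Unset Printing Implicit Defensive.

Import Order.TTheory GRing.Theory Num.Theory.
Import numFieldNormedType.Exports.

Local Open Scope classical_set_scope.
Local Open Scope ring_scope.

Section Defs.
Context {R : realType}.
Local Notation mu := (@lebesgue_measure R).
Implicit Types (f g : R -> R[i]) (phi : R -> R) (u v : R -> R -> R[i]).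

(* |z|^2 as an element of R (the norm `|z| of mathcomp lives in R[i]). *)
Definition sqmod (z : R[i]) : R := complex.Re z ^+ 2 + complex.Im z ^+ 2.

Definition cmeasurable f : Prop :=
  measurable_fun [set: R] (fun x => complex.Re (f x)) /\
  measurable_fun [set: R] (fun x => complex.Im (f x)).

Definition cloc_integrable f : Prop :=
  locally_integrable [set: R] (fun x => complex.Re (f x)) /\
  locally_integrable [set: R] (fun x => complex.Im (f x)).

Definition cintegral f : R[i] :=
  Complex (\int[mu]_x complex.Re (f x)) (\int[mu]_x complex.Im (f x)).

(* \int |f|^2, in [0, +oo] *)
Definition sqL2 f : \bar R := (\int[mu]_x (sqmod (f x))%:E)%E.

Definition inL2 f : Prop := cmeasurable f /\ (sqL2 f < +oo)%E.

(* Real-valued elements of C_c^oo(R). By linearity of the pairing below they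
   detect the same distributions as complex-valued ones. *)
Definition test_function phi : Prop :=
  (forall n x, derivable (derive1n n phi) x 1) /\
  compact (closure [set x | phi x != 0]).

(* <f, phi> = \int f phi, without conjugation *)
Definition pairing f phi : R[i] := cintegral (fun x => f x * (phi x)%:C%C).

Definition is_weak_derivative f g : Prop :=
  [/\ cloc_integrable f, cloc_integrable g &
   forall phi, test_function phi -> pairing f (derive1 phi) = - pairing g phi].

(* f_x; a weak derivative is unique up to a null set, so that the integrals
   below do not depend on the one which is chosen. *)
Definition wderiv f : R -> R[i] := xget (fun=> 0) [set g | is_weak_derivative f g].

(* Elements of H^1(R) are represented by functions, identified when they are
   equal almost everywhere. *)
Definition inH1 f : Prop :=
  inL2 f /\ exists2 g, is_weak_derivative f g & inL2 g.

Definition H1norm f : \bar R := ((sqL2 f + sqL2 (wderiv f)) `^ 2^-1)%E.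

(* u \in C(I, H^1(R)) *)
Definition continuous_H1 (I : set R) u : Prop :=
  (forall t, I t -> inH1 (u t)) /\
  (forall t, I t ->
     H1norm (fun x => u s x - u t x) @[s --> within I (nbhs t)] --> 0%E).

Definition is_cderive (F : R -> R[i]) (t : R) (d : R[i]) : Prop :=
  is_derive t 1 (fun s => complex.Re (F s)) (complex.Re d) /\
  is_derive t 1 (fun s => complex.Im (F s)) (complex.Im d).

Definition nonlinearity (a : R[i]) f : R -> R[i] :=
  fun x => (sqmod (f x) - sqmod a)%:C%C * f x.

(* -i v_t + v_xx - (1/t) (|v|^2 - |a|^2) v = 0 at time t, as an equality of
   distributions in x: [d] is <v_t(t), phi> and <v_xx, phi> = <v, phi''>. *)
Definition equation_at (a : R[i]) v (t : R) : Prop :=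
  forall phi, test_function phi ->
  exists2 d : R[i], is_cderive (fun s => pairing (v s) phi) t d &
    - ('i%C * d) + pairing (v t) (derive1n 2 phi)
      - (t^-1)%:C%C * pairing (nonlinearity a (v t)) phi = 0.

(* Solutions with v - a in C([1/t0, oo), H^1) and v(1/t0) = a + eps0; the
   values v t for t < 1/t0 are irrelevant. *)
Definition is_solution (a : R[i]) (t0 : R) (eps0 : R -> R[i]) v : Prop :=
  [/\ continuous_H1 `[t0^-1, +oo[ (fun t x => v t x - a),
      forall t, t0^-1 < t -> equation_at a v t &
      {ae mu, forall x, v t0^-1 x = a + eps0 x}].

(* \int (|f|^2 - |a|^2)^2 *)
Definition potential (a : R[i]) f : \bar R :=
  (\int[mu]_x ((sqmod (f x) - sqmod a) ^+ 2)%:E)%E.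

Definition energy (a : R[i]) v (t : R) : \bar R :=
  ((2^-1)%:E * sqL2 (wderiv (v t)) + ((4 * t)^-1)%:E * potential a (v t))%E.

End Defs.

(* Main.v *)
(* Write v = a + u with u in H^1, regarded as a pair of real functions. Put
   J = (1 - l \partial_x^2)^{-1} and E'(u) = - u_xx + (|v|^2 - |a|^2) v / t. The
   regularized equation u' = i J E'(u) is an ordinary differential equation in
   H^1, because - J \partial_x^2 = (1 - J) / l is bounded. As J is symmetric and
   commutes with i, the pairing of E'(u) with u' vanishes, so that only the
   explicit dependence on time changes the energy: its derivative is
   - (1 / 4t^2) \int (|v|^2 - |a|^2)^2. Together with a Gronwall bound for the
   L^2 norm of u this makes the solutions global with bounds that do not depend
   on l. For data u0 with u0_xx in L^2 the time derivative is bounded in L^2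
   uniformly in l, hence the curves J u are Cauchy in H^1 as l -> 0; general
   data are reached by density and by Lipschitz dependence on the data. The
   energy balance becomes an inequality in the limit, which contains both bounds
   of the theorem, and a positive lower limit would contradict the divergence
   of \int dt / t. Uniqueness follows by testing the equation for the difference
   of two solutions with test functions close to it in H^1, and Gronwall. *)
Require Import Defs.
From HB Require Import structures.
From mathcomp Require Import all_boot all_order all_algebra.
From mathcomp Require Import complex.
From mathcomp Require Import all_classical all_reals all_analysis.
From mathcomp Require Import measurable_realfun.
From mathcomp Require Import ring lra.

Set Implicit Arguments.
Unset Strict Implicit.
Unset Printing Implicit Defensive.

Import Order.TTheory GRing.Theory Num.Theory.
Import numFieldNormedType.Exports.

Local Open Scope classical_set_scope.
Local Open Scope ring_scope.

(** * Inner products and the Riesz representation theorem *)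

(** Two regularized flows with parameters [l] and [m] cannot be compared directly in H^1: their
    fields, tested in L^2, differ by terms such as [l * d F z], which are small only once the speed
    [F] is bounded in the norm of [h + l d]. That bound comes from comparing a flow with its time
    translates, and this is what requires u0_xx in L^2. The comparison then gives closeness in L^2
    only. Closeness in H^1 is interpolated between L^2 and a bound of the second derivative; such a
    bound, uniform in the parameter, is obtained for [J u], so the limit is taken along [J u] and
    not along [u]. These arguments use only the identities collected in [energy_space]. The Riesz
    theorem serves three times: it integrates curves, it inverts 1 - l \partial_x^2, and it reduces
    density to a statement about orthogonal vectors. Elements of H^1 are continuous representatives:
    equality is equality at every point and products are pointwise, while equality almost everywhere
    is kept for derivatives and for the functions of the statement. *)

Section InnerProducts.
Context {R : realType} {V : lmodType R}.

(** Semi-inner products are terms and not a structure on [V], because several of them ([h], [d],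
    [g], [gl]) are compared on one space. Definiteness, where it is wanted, is a separate
    hypothesis. *)
Record sip := Sip {
  sip_fun :> V -> V -> R;
  sip_linl : forall (a : R) u v w,
    sip_fun (a *: u + v) w = a * sip_fun u w + sip_fun v w;
  sipC : forall u v, sip_fun u v = sip_fun v u;
  sip_ge0 : forall u, 0 <= sip_fun u u }.

Definition sipn (b : sip) u := Num.sqrt (b u u).

Section Theory.
Variable b : sip.
Implicit Types u v w : V.

Lemma sipDl u v w : b (u + v) w = b u w + b v w.
Proof. by rewrite -[u in LHS]scale1r sip_linl mul1r. Qed.

Lemma sip0l w : b 0 w = 0.
Proof. by apply: (addrI (b 0 w)); rewrite -sipDl !addr0. Qed.

Lemma sipZl a u w : b (a *: u) w = a * b u w.
Proof. by rewrite -[a *: u]addr0 sip_linl sip0l addr0. Qed.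

Lemma sipNl u w : b (- u) w = - b u w.
Proof. by rewrite -scaleN1r sipZl mulN1r. Qed.

Lemma sipBl u v w : b (u - v) w = b u w - b v w.
Proof. by rewrite sipDl sipNl. Qed.

Lemma sipDr u v w : b w (u + v) = b w u + b w v.
Proof. by rewrite sipC sipDl !(sipC _ w). Qed.

Lemma sip0r w : b w 0 = 0.
Proof. by rewrite sipC sip0l. Qed.

Lemma sipZr a u w : b w (a *: u) = a * b w u.
Proof. by rewrite sipC sipZl sipC. Qed.

Lemma sipNr u w : b w (- u) = - b w u.
Proof. by rewrite sipC sipNl sipC. Qed.

Lemma sipBr u v w : b w (u - v) = b w u - b w v.
Proof. by rewrite sipDr sipNr. Qed.

Definition sipE := (sipDl, sipDr, sipNl, sipNr, sipZl, sipZr, sip0l, sip0r).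

Lemma sipn_ge0 u : 0 <= sipn b u.
Proof. exact: sqrtr_ge0. Qed.

Lemma sqr_sipn u : sipn b u ^+ 2 = b u u.
Proof. by rewrite sqr_sqrtr// sip_ge0. Qed.

Lemma sipn0 : sipn b 0 = 0.
Proof. by rewrite /sipn sip0l sqrtr0. Qed.

Lemma sipn_le u (x : R) : 0 <= x -> b u u <= x ^+ 2 -> sipn b u <= x.
Proof.
by move=> x0; rewrite -sqr_sipn ler_sqr// nnegrE sipn_ge0.
Qed.

Lemma le_sipn u (x : R) : 0 <= x -> sipn b u <= x -> b u u <= x ^+ 2.
Proof. by move=> x0; rewrite -sqr_sipn ler_sqr// nnegrE sipn_ge0. Qed.

(** Discriminant of the nonnegative polynomial [s |-> b (u + s *: v) (u + s *: v)]. If [b v v = 0]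
    it is affine, and the [s] chosen below would give it the value -1. *)
Lemma sip_sqr_CS u v : b u v ^+ 2 <= b u u * b v v.
Proof.
have H (s : R) : 0 <= b u u + 2 * s * b u v + s ^+ 2 * b v v.
  have -> : b u u + 2 * s * b u v + s ^+ 2 * b v v = b (u + s *: v) (u + s *: v).
    by rewrite !sipE (sipC b v u); ring.
  exact: sip_ge0.
have [v0|v0] := eqVneq (b v v) 0.
  have [->|uv0] := eqVneq (b u v) 0.
    by rewrite expr0n/= mulr_ge0// sip_ge0.
  have := H (- (b u u + 1) / (2 * b u v)); rewrite v0 mulr0 addr0.
  have -> : 2 * (- (b u u + 1) / (2 * b u v)) * b u v = - (b u u + 1).
    by field; rewrite uv0.
  lra.
have vp : 0 < b v v by rewrite lt_neqAle eq_sym v0 sip_ge0.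
have := H (- b u v / b v v).
have -> : b u u + 2 * (- b u v / b v v) * b u v + (- b u v / b v v) ^+ 2 * b v v
   = (b u u * b v v - b u v ^+ 2) / b v v by field.
by rewrite pmulr_lge0 ?invr_gt0// subr_ge0.
Qed.

Lemma sip_CS u v : `|b u v| <= sipn b u * sipn b v.
Proof.
rewrite -ler_sqr ?nnegrE ?mulr_ge0 ?sipn_ge0//.
by rewrite real_normK ?num_real// exprMn !sqr_sipn sip_sqr_CS.
Qed.

Lemma sip_le u v : b u v <= sipn b u * sipn b v.
Proof. exact: le_trans (ler_norm _) (sip_CS u v). Qed.

Lemma sipn_triangle u v : sipn b (u + v) <= sipn b u + sipn b v.
Proof.
apply: sipn_le; first by rewrite addr_ge0 ?sipn_ge0.
have := sip_le u v; have := sqr_sipn u; have := sqr_sipn v.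
rewrite !sipE (sipC b v u); nra.
Qed.

Lemma sipnN u : sipn b (- u) = sipn b u.
Proof. by rewrite /sipn sipNl sipNr opprK. Qed.

Lemma sipnB u v : sipn b (u - v) = sipn b (v - u).
Proof. by rewrite -sipnN opprB. Qed.

Lemma sipnZ a u : sipn b (a *: u) = `|a| * sipn b u.
Proof.
by rewrite /sipn sipZl sipZr mulrA -expr2 sqrtrM ?sqr_ge0// sqrtr_sqr.
Qed.

Lemma sipn_sub u v : sipn b (u - v) <= sipn b u + sipn b v.
Proof. by rewrite -(sipnN v) sipn_triangle. Qed.

Lemma sipn_split v u w : sipn b (u - w) <= sipn b (u - v) + sipn b (v - w).
Proof. by apply: le_trans (sipn_triangle _ _); rewrite addrA subrK. Qed.

Lemma sipn_dist u v : `|sipn b u - sipn b v| <= sipn b (u - v).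
Proof.
rewrite ler_norml; have := sipn_triangle (u - v) v; rewrite subrK.
by have := sipn_triangle (v - u) u; rewrite subrK sipnB; lra.
Qed.

End Theory.

Lemma sip_add_linl (h d : sip) (c : R) (a : R) u v w :
  h (a *: u + v) w + c * d (a *: u + v) w =
  a * (h u w + c * d u w) + (h v w + c * d v w).
Proof. by rewrite !sip_linl; ring. Qed.

Lemma sip_add_sym (h d : sip) (c : R) u v :
  h u v + c * d u v = h v u + c * d v u.
Proof. by rewrite (sipC h) (sipC d). Qed.

Lemma sip_add_ge0 (h d : sip) (c : R) u : 0 <= c -> 0 <= h u u + c * d u u.
Proof. by move=> c0; rewrite addr_ge0 ?mulr_ge0 ?sip_ge0. Qed.

(** With [c = 1] this is the H^1 product, with [c = l] the form of the operator 1 - l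
    \partial_x^2. *)
Definition sip_add (h d : sip) (c : R) (c0 : 0 <= c) : sip :=
  Sip (sip_add_linl h d c) (sip_add_sym h d c)
      (fun u => sip_add_ge0 h d u c0).

Definition vcvg (b : sip) (x : nat -> V) (l : V) := forall e : R, 0 < e ->
  exists N, forall n, (N <= n)%N -> sipn b (x n - l) < e.

Definition complete (b : sip) := forall x : nat -> V,
  (forall e : R, 0 < e -> exists N, forall m n, (N <= m)%N -> (N <= n)%N ->
      sipn b (x m - x n) < e) ->
  exists l, vcvg b x l.

Definition functional (l : V -> R) :=
  forall (a : R) u v, l (a *: u + v) = a * l u + l v.

Definition subspace (D : V -> Prop) :=
  D 0 /\ forall (a : R) u v, D u -> D v -> D (a *: u + v).

Lemma invn_lt (e : R) : 0 < e -> exists N, forall n, (N <= n)%N -> n.+1%:R^-1 < e.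
Proof.
move=> e0; exists (Num.trunc e^-1) => n Nn.
rewrite invf_plt ?posrE//; apply: lt_le_trans (truncnS_gt _) _.
by rewrite ler_nat ltnS.
Qed.

(* The representative minimises [b w w - 2 * l w] over the closure of [D]; the
   parallelogram law makes minimising sequences Cauchy. *)
Lemma riesz_closure (b : sip) (D : V -> Prop) (l : V -> R) (K : R) :
  complete b -> subspace D -> functional l ->
  (forall u, `|l u| <= K * sipn b u) ->
  exists u, (forall e : R, 0 < e -> exists2 w, D w & sipn b (w - u) < e) /\
    forall phi, D phi -> b u phi = l phi.
Proof.
move=> cb [D0 DD] ll lK.
pose q w := b w w - 2 * l w.
have l0 : l 0 = 0.
  by have := ll 1 0 0; rewrite scale1r addr0 mul1r => /eqP; rewrite -subr_eq0 opprD addNKr oppr_eq0 => /eqP.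
have qlb w : - K ^+ 2 <= q w.
  have := lK w; rewrite ler_norml => /andP[_ lw].
  rewrite /q -sqr_sipn; have := sqr_ge0 (sipn b w - K); nra.
pose A := [set x | exists2 w, D w & x = q w].
have Ainf : has_inf A.
  split; first by exists (q 0), 0.
  by exists (- K ^+ 2) => _ [w _ ->].
pose m := inf A.
have mq w : D w -> m <= q w by move=> Dw; apply: ge_inf; [exact: Ainf.2|exists w].
have /choice[x xP] : forall n : nat,
    exists w, D w /\ q w < m + n.+1%:R^-1.
  move=> n.
  have n0 : 0 < n.+1%:R^-1 :> R by rewrite invr_gt0.
  have [_ [w Dw ->] qw] := inf_adherent n0 Ainf.
  by exists w.
(* Parallelogram law: the midpoint of [w] and [w'] lies in [D], hence [q] is at least [m] there. *)
have par w w' : D w -> D w' ->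
    b (w - w') (w - w') <= 2 * (q w - m) + 2 * (q w' - m).
  move=> Dw Dw'.
  have Dh : D (2^-1 *: w + (2^-1 *: w' + 0)) by apply: (DD) => //; apply: (DD).
  have := mq _ Dh; rewrite /q !ll l0 !sipE (sipC b w' w) => H.
  have : q w = b w w - 2 * l w by [].
  have : q w' = b w' w' - 2 * l w' by [].
  lra.
have [u uP] : exists u, vcvg b x u.
  apply: cb => e e0.
  have [N NP] := invn_lt (e := e ^+ 2 / 4) ltac:(by rewrite divr_gt0// exprn_gt0).
  exists N => i j Ni Nj.
  rewrite -ltr_sqr ?nnegrE ?sipn_ge0 ?ltW// sqr_sipn.
  apply: le_lt_trans (par _ _ (xP i).1 (xP j).1) _.
  move: (NP _ Ni) (NP _ Nj) (xP i).2 (xP j).2.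
  move: (q (x i)) (q (x j)) (i.+1%:R^-1) (j.+1%:R^-1) => a1 a2 a3 a4.
  lra.
exists u; split.
  move=> e e0; have [N NP] := uP e e0; exists (x N); first exact: (xP N).1.
  exact: NP.
move=> phi Dphi.
(* Approximate Euler-Lagrange equation: [q (x n + s phi)] is at least [m] while [q (x n)] exceeds
   [m] by less than 1/(n+1), and the discriminant in [s] bounds the defect. *)
have key n : (b (x n) phi - l phi) ^+ 2 <= n.+1%:R^-1 * b phi phi.
  have H (s : R) : 0 <= n.+1%:R^-1 + 2 * s * (b (x n) phi - l phi) + s ^+ 2 * b phi phi.
    have := mq _ (DD s _ _ Dphi (xP n).1); have := (xP n).2.
    rewrite /q ll !sipE (sipC b phi (x n)); move: (n.+1%:R^-1) => a1; lra.
  have [v0|v0] := eqVneq (b phi phi) 0.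
    have -> : b (x n) phi = 0.
      apply/eqP; rewrite -normr_le0; apply: le_trans (sip_CS _ _ _) _.
      by rewrite /(sipn _ phi) v0 sqrtr0 mulr0.
    have -> : l phi = 0.
      apply/eqP; rewrite -normr_le0; apply: le_trans (lK _) _.
      by rewrite /sipn v0 sqrtr0 mulr0.
    by rewrite v0 mulr0 subrr expr0n.
  have vp : 0 < b phi phi by rewrite lt_neqAle eq_sym v0 sip_ge0.
  have := H (- (b (x n) phi - l phi) / b phi phi).
  set y := b (x n) phi - l phi.
  have -> : n.+1%:R^-1 + 2 * (- y / b phi phi) * y + (- y / b phi phi) ^+ 2 * b phi phi
     = (n.+1%:R^-1 * b phi phi - y ^+ 2) / b phi phi.
    by move: (n.+1%:R^-1) => a1; field.
  by rewrite pmulr_lge0 ?invr_gt0// subr_ge0.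
apply/eqP; rewrite -subr_eq0 -normr_le0; apply/ler_addgt0Pr => e e0; rewrite add0r.
pose c := sipn b phi + 1.
have c0 : 0 < c by have := sipn_ge0 b phi; rewrite /c; lra.
have [N NP] := uP (e / (2 * c)) ltac:(by rewrite divr_gt0// mulr_gt0).
have [M MP] := invn_lt (e := (e / (2 * c)) ^+ 2) ltac:(by rewrite exprn_gt0// divr_gt0// mulr_gt0).
pose n := maxn N M.
have -> : b u phi - l phi = - b (x n - u) phi + (b (x n) phi - l phi).
  by rewrite sipBl; ring.
have h1 : `|b (x n - u) phi| <= e / (2 * c) * c.
  apply: le_trans (sip_CS _ _ _) _; apply: ler_pM; rewrite ?sipn_ge0//.
    by apply/ltW/NP; rewrite leq_maxl.
  by rewrite /c lerDl.
have h2 : `|b (x n) phi - l phi| <= e / (2 * c) * c.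
  have r0 : 0 <= e / (2 * c) * c.
    by rewrite mulr_ge0 ?divr_ge0 ?mulr_ge0 ?ler0n ?(ltW e0) ?(ltW c0).
  rewrite -ler_sqr ?nnegrE//.
  rewrite real_normK ?num_real// exprMn; apply: le_trans (key n) _.
  apply: ler_pM; rewrite ?invr_ge0 ?sip_ge0//.
    by apply/ltW/MP; rewrite leq_maxr.
  by apply: le_sipn; rewrite ?(ltW c0)// /c lerDl.
apply: le_trans (ler_normD _ _) _; rewrite normrN.
have : e / (2 * c) * c = e / 2 by field; rewrite gt_eqF.
lra.
Qed.

Lemma riesz (b : sip) (l : V -> R) (K : R) :
  complete b -> functional l -> (forall u, `|l u| <= K * sipn b u) ->
  exists u, forall phi, b u phi = l phi.
Proof.
move=> cb ll lK; have [] := @riesz_closure b (fun=> True) l K cb _ ll lK => //.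
by move=> u [_ uP]; exists u => phi; exact: uP.
Qed.

(** Representing [b u] on [D] yields a projection [v] in the closure of [D]; then [v - u] is
    orthogonal to [D] and therefore null. *)
Lemma dense_of_orthogonal (b : sip) (D : V -> Prop) : complete b -> subspace D ->
  (forall k, (forall phi, D phi -> b k phi = 0) -> b k k = 0) ->
  forall u (e : R), 0 < e -> exists2 w, D w & sipn b (w - u) < e.
Proof.
move=> cb sD D0 u e e0.
have [||v [vD vP]] := @riesz_closure b D (b u) (sipn b u) cb sD.
- by move=> a x y; rewrite !sipE.
- by move=> x; exact: sip_CS.
have [w Dw we] := vD e e0; exists w => //.
have -> : w - u = (w - v) + (v - u) by rewrite addrA subrK.
apply: le_lt_trans (sipn_triangle _ _ _) _.
suff -> : sipn b (v - u) = 0 by rewrite addr0.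
by rewrite /sipn D0 ?sqrtr0// => phi Dphi; rewrite sipBl vP// subrr.
Qed.

(** The crude constant [C] provides continuity, by which the bound with [k] passes from [D] to all
    vectors. In the uniqueness proof it carries an estimate from test functions to H^1. *)
Lemma functional_dense_bound (b : sip) (D : V -> Prop) (l : V -> R) (C k : R) :
  functional l -> (forall u, `|l u| <= C * sipn b u) ->
  (forall u e, 0 < e -> exists2 w, D w & sipn b (w - u) < e) ->
  (forall w, D w -> `|l w| <= k * sipn b w) -> 0 <= k ->
  forall u, `|l u| <= k * sipn b u.
Proof.
move=> ll lC dD lD k0 u; apply/ler_addgt0Pr => e e0.
have c0 : 0 < k + `|C| + 1 by rewrite ltr_wpDl// addr_ge0.
have [w Dw we] := dD u (e / (k + `|C| + 1)) ltac:(by rewrite divr_gt0).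
have -> : l u = l w - l (w - u).
  by rewrite -[w - u]addrC -scaleN1r ll; ring.
apply: le_trans (ler_normB _ _) _.
have h1 := lD w Dw.
have h2 : sipn b w <= sipn b u + sipn b (w - u).
  by rewrite -[w in leLHS](subrK u) addrC sipn_triangle.
have h3 : k * sipn b w <= k * (sipn b u + sipn b (w - u)) by rewrite ler_wpM2l.
have h4 : `|l (w - u)| <= `|C| * sipn b (w - u).
  by apply: le_trans (lC _) _; rewrite ler_wpM2r ?sipn_ge0// ler_norm.
have h5 : (k + `|C| + 1) * sipn b (w - u) <= e.
  by rewrite mulrC -ler_pdivlMr// ltW.
have := sipn_ge0 b (w - u); lra.
Qed.

End InnerProducts.
Arguments sip {R} V.

(** * Calculus of real functions and of curves *)

Section RealCalculus.
Context {R : realType}.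
Implicit Types (f : R -> R) (t s l e a b c d r x M : R).

(** A form without quotients, of the same shape as [vderiv], so that derivatives of curves transfer
    to real functions estimate by estimate. *)
Lemma is_deriveP f t l : is_derive t 1 f l <->
  forall e, 0 < e -> exists2 d, 0 < d &
    forall s, `|s - t| < d -> `|f s - f t - (s - t) * l| <= e * `|s - t|.
Proof.
split.
- move=> [df dl] e e0; move: dl; rewrite /derive => dl.
  have : h^-1 *: ((f \o shift t) (h *: 1) - f t) @[h --> 0^'] --> l by rewrite -dl; exact: df.
  move=> /cvgrPdist_le /(_ e e0); rewrite near_withinE => /nbhs_ballP[d /= d0 H].
  exists d => // s sd.
  have [->|st] := eqVneq s t; first by rewrite !subrr mul0r subrr normr0 mulr0.
  have := H (s - t); rewrite /ball/= sub0r normrN => /(_ sd).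
  rewrite subr_eq0 => /(_ st).
  rewrite /= /GRing.scale/= mulr1 subrK => H'.
  have st' : s - t != 0 by rewrite subr_eq0.
  have -> : f s - f t - (s - t) * l = - ((l - (s - t)^-1 * (f s - f t)) * (s - t)).
    by field.
  by rewrite normrN normrM ler_wpM2r.
- move=> H.
  have cv : h^-1 *: ((f \o shift t) (h *: 1) - f t) @[h --> 0^'] --> l.
    apply/cvgrPdist_le => e e0; rewrite near_withinE; apply/nbhs_ballP.
    have [d d0 Hd] := H e e0; exists d => //= h.
    rewrite /ball/= sub0r normrN => hd h0.
    have := Hd (h + t); rewrite addrK => /(_ hd) H'.
    rewrite /GRing.scale/= mulr1.
    rewrite -(ler_pM2r (_ : 0 < `|h|)) ?normr_gt0//.
    apply: le_trans H'; rewrite -normrM -normrN.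
    by rewrite le_eqVlt; apply/orP; left; apply/eqP; congr `|_|; field.
  split; first by apply/cvg_ex; exists l.
  by apply: cvg_lim.
Qed.

Lemma is_derive_near_eq f1 f2 t l (r : R) : 0 < r ->
  (forall s, `|s - t| < r -> f1 s = f2 s) -> is_derive t 1 f1 l -> is_derive t 1 f2 l.
Proof.
move=> r0 ff /is_deriveP H; apply/is_deriveP => e e0.
have [d d0 Hd] := H e e0; exists (Num.min d r) => [|s].
  by rewrite lt_min d0.
rewrite lt_min => /andP[sd sr].
by rewrite -!ff ?subrr ?normr0//; exact: Hd.
Qed.

Lemma is_derive_continuous f t l : is_derive t 1 f l -> {for t, continuous f}.
Proof. by move=> [df _]; apply/differentiable_continuous/derivable1_diffP. Qed.

Lemma within_continuousT f (A : set R) : (forall t, A t -> {for t, continuous f}) ->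
  {within A, continuous f}.
Proof. by move=> H; apply: continuous_in_subspaceT => x; rewrite inE; exact: H. Qed.

Lemma continuous_epsP f t : {for t, continuous f} <->
  forall e, 0 < e -> exists2 d, 0 < d & forall s, `|s - t| < d -> `|f s - f t| < e.
Proof.
split.
- move=> /cvgrPdist_lt H e e0; have /nbhs_ballP[d /= d0 Hd] := H e e0.
  by exists d => // s sd; rewrite distrC; apply: Hd; rewrite /ball/= distrC.
- move=> H; apply/cvgrPdist_lt => e e0; have [d d0 Hd] := H e e0.
  by apply/nbhs_ballP; exists d => //= s; rewrite /ball/= distrC => /Hd; rewrite distrC.
Qed.

Lemma le_derive_nincr f f' a b : a <= b ->
  (forall t, a <= t <= b -> is_derive t 1 f (f' t)) ->
  (forall t, a <= t <= b -> f' t <= 0) -> f b <= f a.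
Proof.
move=> ab df f'0; apply: (@ler0_derive1_nincr _ f a b) => //.
- move=> x; rewrite in_itv/= => /andP[xa xb].
  by have [] : is_derive x 1 f (f' x) by apply: df; rewrite !ltW.
- move=> x; rewrite in_itv/= => /andP[xa xb].
  have [_] : is_derive x 1 f (f' x) by apply: df; rewrite !ltW.
  by rewrite derive1E => ->; apply: f'0; rewrite !ltW.
- by apply: within_continuousT => t; rewrite /= in_itv/= => /df/is_derive_continuous.
Qed.

Lemma MVT_bound f f' M t s :
  (forall x, `|x - t| <= `|s - t| -> is_derive x 1 f (f' x)) ->
  (forall x, `|x - t| <= `|s - t| -> `|f' x| <= M) ->
  `|f s - f t| <= M * `|s - t|.
Proof.
move=> df Hf.
have hx (a b x : R) : a <= b -> x \in `[a, b] -> `|x - a| <= `|b - a| /\ `|x - b| <= `|a - b|.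
  rewrite in_itv/= => ab /andP[ax xb].
  rewrite !(@ger0_norm _ (_ - a)) ?subr_ge0// !(@ler0_norm _ (_ - b)) ?subr_le0//.
  by split; lra.
have [st|/ltW ts] := leP s t.
- have [x||x /(hx _ _ _ st)[_ xi]] := @MVT_segment _ f f' s t st.
  + move=> /subset_itv_oo_cc/(hx _ _ _ st)[_]; exact: df.
  + by apply: within_continuousT => x /= /(hx _ _ _ st)[_ /df/is_derive_continuous].
  + by rewrite -normrN opprB (distrC s) => ->; rewrite normrM ler_wpM2r// Hf.
- have [x||x /(hx _ _ _ ts)[xi _]] := @MVT_segment _ f f' t s ts.
  + move=> /subset_itv_oo_cc/(hx _ _ _ ts)[+ _]; exact: df.
  + by apply: within_continuousT => x /= /(hx _ _ _ ts)[/df/is_derive_continuous].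
  + by move=> ->; rewrite normrM ler_wpM2r// Hf.
Qed.

Lemma is_derive_gronwall_exp (C a t : R) :
  is_derive t 1 (fun t => expR (C * (t - a))) (C * expR (C * (t - a))).
Proof.
have h : is_derive t 1 (fun t => C * (t - a)) C.
  apply/is_deriveP => e e0; exists 1 => // s _.
  rewrite (_ : _ - _ - _ = 0) ?normr0 ?mulr_ge0// ?ltW//; ring.
have := @is_derive1_comp _ expR _ t _ _ (is_derive_expR _) h.
by rewrite mulrC.
Qed.

(** The shift by [K / C] makes the inequality homogeneous; multiplied by the decreasing exponential,
    [f + K / C] is then nonincreasing. *)
Lemma gronwall f f' (C K : R) a b : 0 < C -> a <= b ->
  (forall t, a <= t <= b -> is_derive t 1 f (f' t)) ->
  (forall t, a <= t <= b -> f' t <= C * f t + K) ->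
  f b + K / C <= (f a + K / C) * expR (C * (b - a)).
Proof.
move=> C0 ab df Hf.
pose y t := (f t + K / C) * expR (- C * (t - a)).
have : y b <= y a.
  apply: (@le_derive_nincr _
    (fun t => f' t * expR (- C * (t - a)) - C * (f t + K / C) * expR (- C * (t - a)))) => //.
    move=> t /df dt.
    have d1 : is_derive t 1 (fun t => f t + K / C) (f' t).
      by have := is_deriveD dt (is_derive_cst (K / C) t 1); rewrite addr0.
    have d2 := is_deriveM d1 (is_derive_gronwall_exp (- C) a t).
    apply: (is_derive_eq d2); rewrite /GRing.scale/=; ring.
  move=> t /Hf ft; rewrite -mulrBl mulr_le0_ge0 ?expR_ge0//.
  rewrite (_ : C * _ = C * f t + K); first by rewrite subr_le0.
  by field; rewrite gt_eqF.
rewrite /y subrr mulr0 expR0 mulr1 mulNr expRN => H.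
by rewrite -ler_pdivrMr ?expR_gt0.
Qed.

Lemma compact_bound f a b : a <= b -> (forall t, a <= t <= b -> {for t, continuous f}) ->
  exists M, forall t, a <= t <= b -> f t <= M.
Proof.
move=> ab cf; have [|c _ H] := @EVT_max _ f a b ab.
  by apply: within_continuousT => t /=; rewrite in_itv/=; exact: cf.
by exists (f c) => t tab; apply: H; rewrite in_itv.
Qed.

Lemma continuous_integrable_itv f a b : (forall t, a <= t <= b -> {for t, continuous f}) ->
  (@lebesgue_measure R).-integrable `[a, b] (EFin \o f).
Proof.
move=> cf; apply: continuous_compact_integrable; first exact: segment_compact.
by apply: within_continuousT => t /=; rewrite in_itv/=; exact: cf.
Qed.

Lemma is_derive_primitive f a : (forall t, a <= t -> {for t, continuous f}) ->
  forall t, a < t ->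
  is_derive t 1 (fun t => \int[@lebesgue_measure R]_(x in `[a, t]) f x) (f t).
Proof.
move=> cf t at_.
have [] := @continuous_FTC1_closed _ f a t (t + 1) _ _ at_.
- by rewrite ltrDl.
- by apply: continuous_integrable_itv => x /andP[ax _]; exact: cf.
- exact/cf/ltW.
- by move=> d1 d2; split; [exact: d1|rewrite -derive1E; exact: d2].
Qed.

End RealCalculus.

(** * Differential calculus of curves in a space with a semi-inner product *)

Section VectorCalculus.
Context {R : realType} {V : lmodType R}.
Variable g : sip V.
Local Notation nrm := (sipn g).
Implicit Types (u f : R -> V) (t s : R).

Definition vcont u t := forall e, 0 < e -> exists2 d, 0 < d &
  forall s, `|s - t| < d -> nrm (u s - u t) < e.

Definition vderiv u t w := forall e, 0 < e -> exists2 d, 0 < d &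
  forall s, `|s - t| < d -> nrm (u s - u t - (s - t) *: w) <= e * `|s - t|.

Lemma vderiv_lip u t w : vderiv u t w -> exists2 d, 0 < d &
  forall s, `|s - t| < d -> nrm (u s - u t) <= (nrm w + 1) * `|s - t|.
Proof.
move=> /(_ 1 ltr01)[d d0 H]; exists d => // s /H; rewrite mul1r => {}H.
have -> : u s - u t = (u s - u t - (s - t) *: w) + (s - t) *: w by rewrite subrK.
apply: le_trans (sipn_triangle _ _ _) _; rewrite sipnZ; lra.
Qed.

Lemma vderiv_cont u t w : vderiv u t w -> vcont u t.
Proof.
move=> /vderiv_lip[d d0 H] e e0.
have n0 : 0 < nrm w + 1 by have := sipn_ge0 g w; lra.
exists (Num.min d (e / (nrm w + 1))); first by rewrite lt_min d0 divr_gt0.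
move=> s; rewrite lt_min => /andP[/H sd]; rewrite ltr_pdivlMr// mulrC.
exact: le_lt_trans.
Qed.

Lemma vderiv_cst w t : vderiv (fun=> w) t 0.
Proof.
move=> e e0; exists 1 => // s _.
by rewrite subrr scaler0 subrr sipn0 mulr_ge0// ltW.
Qed.

Lemma vderivD (a : R) u1 u2 t w1 w2 : vderiv u1 t w1 -> vderiv u2 t w2 ->
  vderiv (fun s => u1 s + a *: u2 s) t (w1 + a *: w2).
Proof.
move=> H1 H2 e e0.
have a0 : 0 < `|a| + 1 by rewrite ltr_wpDl.
have [d1 d10 H1'] := H1 (e / 2) ltac:(by rewrite divr_gt0).
have [d2 d20 H2'] := H2 (e / 2 / (`|a| + 1)) ltac:(by rewrite !divr_gt0).
exists (Num.min d1 d2); first by rewrite lt_min d10.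
move=> s; rewrite lt_min => /andP[/H1' {}H1 /H2' {}H2].
have -> : u1 s + a *: u2 s - (u1 t + a *: u2 t) - (s - t) *: (w1 + a *: w2) =
  (u1 s - u1 t - (s - t) *: w1) + a *: (u2 s - u2 t - (s - t) *: w2).
  rewrite !scalerBr scalerDr !scalerA (mulrC a) !opprD -!addrA; congr (_ + _).
  rewrite addrC -!addrA; congr (_ + _).
  by rewrite addrC -!addrA; congr (_ + _); rewrite addrC -!addrA addrCA.
apply: le_trans (sipn_triangle _ _ _) _; rewrite sipnZ.
have : `|a| * nrm (u2 s - u2 t - (s - t) *: w2) <=
   (`|a| + 1) * (e / 2 / (`|a| + 1) * `|s - t|).
  by apply: ler_pM; rewrite ?sipn_ge0// lerDl.
have -> : (`|a| + 1) * (e / 2 / (`|a| + 1) * `|s - t|) = e / 2 * `|s - t|.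
  by field; rewrite gt_eqF.
lra.
Qed.

Lemma vderivB u1 u2 t w1 w2 : vderiv u1 t w1 -> vderiv u2 t w2 ->
  vderiv (fun s => u1 s - u2 s) t (w1 - w2).
Proof.
move=> H1 H2 e e0; have [d d0 H] := vderivD (-1) H1 H2 e0; exists d => // s /H.
by rewrite !scaleN1r.
Qed.

Lemma vderiv_shift u t (r : R) w : vderiv u (t + r) w -> vderiv (fun s => u (s + r)) t w.
Proof.
move=> H e e0; have [d d0 Hd] := H e e0; exists d => // s sd.
by have := Hd (s + r); rewrite opprD addrACA subrr addr0; exact.
Qed.

(* A second order remainder bound for [Q] at [u t] is all that the chain rule
   along a differentiable curve needs. *)
Lemma is_derive_chain (Q : V -> R) (l : V -> R) (C K : R) u t w : functional l ->
  (forall x, `|l x| <= K * nrm x) ->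
  (forall x, nrm x <= 1 -> `|Q (u t + x) - Q (u t) - l x| <= C * nrm x ^+ 2) ->
  vderiv u t w -> is_derive t 1 (fun s => Q (u s)) (l w).
Proof.
move=> ll lK HQ du; apply/is_deriveP => e e0.
have [d1 d10 H1] := vderiv_lip du.
have [d2 d20 H2] : exists2 d2, 0 < d2 & forall s, `|s - t| < d2 ->
    nrm (u s - u t - (s - t) *: w) <= e / 2 / (`|K| + 1) * `|s - t|.
  by apply: du; rewrite !divr_gt0// ltr_wpDl.
pose m := nrm w + 1.
have m0 : 0 < m by have := sipn_ge0 g w; rewrite /m; lra.
(* Makes the quadratic remainder [C * (m * |s - t|) ^+ 2] at most half of [e * |s - t|]. Below,
   [m^-1] keeps the increment in the unit ball, where the expansion of [Q] is available. *)
pose d3 := e / 2 / (`|C| + 1) / m ^+ 2.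
have d30 : 0 < d3 by rewrite /d3 !divr_gt0// ?ltr_wpDl// exprn_gt0.
exists (Num.min (Num.min d1 d2) (Num.min d3 m^-1)).
  by rewrite !lt_min d10 d20 d30 invr_gt0.
move=> s; rewrite !lt_min => /andP[/andP[/H1 {}H1 /H2 {}H2] /andP[sd3 sm]].
pose x := u s - u t.
have xm : nrm x <= m * `|s - t| by [].
have x1 : nrm x <= 1.
  apply: le_trans xm _; rewrite mulrC -ler_pdivlMr// div1r; exact: ltW.
have := HQ x x1; rewrite (_ : u t + x = u s); last by rewrite /x addrC subrK.
move=> {}HQ.
have -> : Q (u s) - Q (u t) - (s - t) * l w =
   (Q (u s) - Q (u t) - l x) + l (x - (s - t) *: w).
  have -> : x - (s - t) *: w = (- (s - t)) *: w + x by rewrite scaleNr addrC.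
  by rewrite ll; ring.
apply: le_trans (ler_normD _ _) _.
have h1 : `|Q (u s) - Q (u t) - l x| <= e / 2 * `|s - t|.
  apply: le_trans HQ _.
  apply: (@le_trans _ _ ((`|C| + 1) * (m * `|s - t|) ^+ 2)).
    apply: (@le_trans _ _ ((`|C| + 1) * nrm x ^+ 2)).
      by rewrite ler_wpM2r ?sqr_ge0//; have := ler_norm C; lra.
    rewrite ler_wpM2l ?addr_ge0// ler_sqr// nnegrE ?sipn_ge0//.
    by rewrite mulr_ge0// ltW.
  have -> : (`|C| + 1) * (m * `|s - t|) ^+ 2 = ((`|C| + 1) * m ^+ 2 * `|s - t|) * `|s - t|.
    ring.
  rewrite ler_wpM2r// mulrC -ler_pdivlMr; last first.
    by rewrite mulr_gt0 ?exprn_gt0// ltr_wpDl.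
  apply: le_trans (ltW sd3) _; rewrite /d3 le_eqVlt; apply/orP; left; apply/eqP.
  by field; rewrite (gt_eqF m0) gt_eqF// ltr_wpDl.
have h2 : `|l (x - (s - t) *: w)| <= e / 2 * `|s - t|.
  apply: le_trans (lK _) _.
  apply: (@le_trans _ _ ((`|K| + 1) * (e / 2 / (`|K| + 1) * `|s - t|))).
    apply: (@le_trans _ _ ((`|K| + 1) * nrm (x - (s - t) *: w))).
      by rewrite ler_wpM2r ?sipn_ge0//; have := ler_norm K; lra.
    by rewrite ler_wpM2l ?addr_ge0.
  rewrite le_eqVlt; apply/orP; left; apply/eqP.
  by field; rewrite gt_eqF// ltr_wpDl.
lra.
Qed.

Lemma is_derive_sip_cst (b : sip V) (C : R) phi u t w :
  (forall x, sipn b x <= C * nrm x) -> vderiv u t w ->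
  is_derive t 1 (fun s => b (u s) phi) (b w phi).
Proof.
move=> bC; apply: (@is_derive_chain (b^~ phi) (b^~ phi) 0 (C * sipn b phi)).
- by move=> a x y; rewrite !sipE.
- move=> x; apply: le_trans (sip_CS _ _ _) _.
  by rewrite mulrAC ler_wpM2r ?sipn_ge0.
- move=> x _; rewrite !sipE (_ : _ - _ - _ = 0) ?normr0 ?mul0r//; ring.
Qed.

Lemma is_derive_sip_sqr (b : sip V) (C : R) u t w :
  (forall x, sipn b x <= C * nrm x) -> vderiv u t w ->
  is_derive t 1 (fun s => b (u s) (u s)) (2 * b w (u t)).
Proof.
move=> bC; apply: (@is_derive_chain (fun x => b x x) (fun x => 2 * b x (u t))
  (C ^+ 2) (2 * (C * sipn b (u t)))).
- by move=> a x y; rewrite !sipE; ring.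
- move=> x; rewrite normrM ger0_norm// -mulrA ler_wpM2l//.
  apply: le_trans (sip_CS _ _ _) _.
  by rewrite mulrAC ler_wpM2r ?sipn_ge0.
- move=> x _; rewrite !sipE (sipC b (u t) x).
  have -> : b (u t) (u t) + b x (u t) + (b x (u t) + b x x) - b (u t) (u t) -
    2 * b x (u t) = b x x by ring.
  rewrite ger0_norm ?sip_ge0// -exprMn; apply: le_sipn; last exact: bC.
  exact: le_trans (sipn_ge0 b x) (bC x).
Qed.

Lemma self_bound x : nrm x <= 1 * nrm x. Proof. by rewrite mul1r. Qed.

(** Mean value inequality by duality: paired with the fixed vector [phi = u b - u a], it becomes the
    monotonicity of the real function [g (u t) phi - nrm phi * G t]. *)
Lemma vderiv_mean u u' (G G' : R -> R) a b : a <= b ->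
  (forall t, a <= t <= b -> vderiv u t (u' t)) ->
  (forall t, a <= t <= b -> is_derive t 1 G (G' t)) ->
  (forall t, a <= t <= b -> nrm (u' t) <= G' t) ->
  nrm (u b - u a) <= G b - G a.
Proof.
move=> ab du dG uG.
have Gab : G a <= G b.
  rewrite -lerN2; apply: (@le_derive_nincr _ (fun t => - G t) (fun t => - G' t)) => //.
    by move=> t /dG H; exact: is_deriveN.
  by move=> t /uG H; rewrite oppr_le0; exact: le_trans (sipn_ge0 _ _) H.
pose phi := u b - u a.
have H : g (u b) phi - nrm phi * G b <= g (u a) phi - nrm phi * G a.
  apply: (@le_derive_nincr _ (fun t => g (u t) phi - nrm phi * G t)
     (fun t => g (u' t) phi - nrm phi * G' t)) => //.
    move=> t tab; apply: is_deriveB.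
      exact: is_derive_sip_cst self_bound (du t tab).
    exact: (is_deriveZ _ (dG t tab)).
  move=> t /uG H; rewrite subr_le0 mulrC; apply: le_trans (sip_le _ _ _) _.
  by rewrite ler_wpM2r ?sipn_ge0.
have [->|p0] := eqVneq (nrm phi) 0; first by rewrite subr_ge0.
have pp : 0 < nrm phi by rewrite lt_neqAle eq_sym p0 sipn_ge0.
rewrite -(ler_pM2l pp) -expr2 sqr_sipn {1}/phi sipBl; lra.
Qed.

Lemma vcont_sip_dom (b : sip V) u t phi : (forall x, sipn b x <= nrm x) ->
  vcont u t -> {for t, continuous (fun s => b (u s) phi)}.
Proof.
move=> bg cu; apply/continuous_epsP => e e0.
have p0 : 0 < sipn b phi + 1 by have := sipn_ge0 b phi; lra.
have [d d0 H] := cu (e / (sipn b phi + 1)) ltac:(by rewrite divr_gt0).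
exists d => // s /H us; rewrite -sipBl; apply: le_lt_trans (sip_CS _ _ _) _.
apply: (@le_lt_trans _ _ (nrm (u s - u t) * (sipn b phi + 1))).
  by apply: ler_pM; rewrite ?sipn_ge0// lerDl.
by rewrite -ltr_pdivlMr.
Qed.

Lemma vcont_sip u t phi : vcont u t -> {for t, continuous (fun s => g (u s) phi)}.
Proof. exact: vcont_sip_dom. Qed.

Lemma vcontB u1 u2 t : vcont u1 t -> vcont u2 t -> vcont (fun s => u1 s - u2 s) t.
Proof.
move=> c1 c2 e e0.
have [d1 d10 H1] := c1 (e / 2) ltac:(by rewrite divr_gt0).
have [d2 d20 H2] := c2 (e / 2) ltac:(by rewrite divr_gt0).
exists (Num.min d1 d2); first by rewrite lt_min d10.
move=> s; rewrite lt_min => /andP[/H1 {}H1 /H2 {}H2].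
rewrite opprD addrACA -opprD.
by apply: le_lt_trans (sipn_sub _ _ _) _; lra.
Qed.

Lemma vcontZ (c : R -> R) u t : {for t, continuous c} -> vcont u t ->
  vcont (fun s => c s *: u s) t.
Proof.
move=> /continuous_epsP cc cu e e0.
have p0 : 0 < nrm (u t) + 1 by have := sipn_ge0 g (u t); lra.
have [d1 d10 H1] := cc (e / 2 / (nrm (u t) + 1)) ltac:(by rewrite !divr_gt0).
have [d3 d30 H3] := cc 1 ltr01.
have q0 : 0 < `|c t| + 1 by rewrite ltr_wpDl.
have [d2 d20 H2] := cu (e / 2 / (`|c t| + 1)) ltac:(by rewrite !divr_gt0).
exists (Num.min d1 (Num.min d2 d3)); first by rewrite !lt_min d10 d20.
move=> s; rewrite !lt_min => /andP[/H1 {}H1 /andP[/H2 {}H2 /H3 {}H3]].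
have -> : c s *: u s - c t *: u t = c s *: (u s - u t) + (c s - c t) *: u t.
  by rewrite scalerBr scalerBl addrA subrK.
apply: le_lt_trans (sipn_triangle _ _ _) _; rewrite !sipnZ.
have h1 : `|c s| <= `|c t| + 1.
  by have := ler_normD (c s - c t) (c t); rewrite subrK; lra.
have h2 : `|c s| * nrm (u s - u t) <= (`|c t| + 1) * nrm (u s - u t).
  by rewrite ler_wpM2r ?sipn_ge0.
have h3 : (`|c t| + 1) * nrm (u s - u t) < e / 2 by rewrite mulrC -ltr_pdivlMr.
have h4 : `|c s - c t| * nrm (u t) <= `|c s - c t| * (nrm (u t) + 1).
  by rewrite ler_wpM2l// lerDl.
have h5 : `|c s - c t| * (nrm (u t) + 1) < e / 2 by rewrite -ltr_pdivlMr.
lra.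
Qed.

Lemma vcont_nrm u t : vcont u t -> {for t, continuous (fun s => nrm (u s))}.
Proof.
move=> cu; apply/continuous_epsP => e e0; have [d d0 H] := cu e e0.
by exists d => // s /H; apply: le_lt_trans (sipn_dist _ _ _).
Qed.

(* The integral of a curve is the Riesz representative of
   [phi |-> \int g (f s) phi]. *)
Lemma vprimitive f c : complete g -> (forall t, vcont f t) ->
  exists2 U : R -> V, U c = 0 & forall t, c - 1 < t -> vderiv U t (f t).
Proof.
move=> cg cf.
(* The integral starts at [c - 1], so that [c] is an interior point with a two-sided derivative; the
   value at [c] is subtracted at the end. *)
pose P phi t := \int[@lebesgue_measure R]_(x in `[c - 1, t]) g (f x) phi.
have cfp phi t : {for t, continuous (fun s => g (f s) phi)} by exact: vcont_sip.
have iP phi t : (@lebesgue_measure R).-integrable `[c - 1, t] (EFin \o (fun s => g (f s) phi)).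
  exact: continuous_integrable_itv.
have dP phi t : c - 1 < t -> is_derive t 1 (P phi) (g (f t) phi).
  by move=> ct; apply: is_derive_primitive.
have /choice[U0 U0P] : forall t, exists w, forall phi, g w phi = P phi t.
  move=> t; have [tc|ct] := ltP t (c - 1).
    exists 0 => phi; rewrite sip0l /P set_itv_ge ?Rintegral_set0//.
    by rewrite bnd_simp -ltNge.
  have [M HM] := @compact_bound _ (fun s => nrm (f s)) _ _ ct (fun t _ => vcont_nrm (cf t)).
  apply: (@riesz _ _ g _ (M * fine ((@lebesgue_measure R) `[c - 1, t]))) => //.
    move=> a x y; rewrite /P -RintegralZl// -RintegralD//.
      by apply: eq_Rintegral => z _; rewrite !sipE.
    have -> : EFin \o (fun z => a * g (f z) x) = (fun z => a%:E * (EFin \o (fun s => g (f s) x)) z)%E.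
      by apply/funext => z /=; rewrite EFinM.
    exact: integrableZl.
  move=> phi; apply: le_trans (le_normr_Rintegral _ _) _ => //.
  apply: le_trans (_ : _ <= (\int[@lebesgue_measure R]_(x in `[c - 1, t]) (M * nrm phi))) _.
    apply: le_Rintegral => //.
    - exact: integrable_norm.
    - apply: continuous_integrable_itv => z _; exact: cst_continuous.
    - move=> z /=; rewrite in_itv/= => /HM fM; apply: le_trans (sip_CS _ _ _) _.
      by rewrite ler_wpM2r ?sipn_ge0.
  by rewrite Rintegral_cst// mulrAC.
exists (fun t => U0 t - U0 c); first by rewrite subrr.
move=> t ct e e0.
have [d d0 H] := cf t e e0.
exists (Num.min d (t - (c - 1))); first by rewrite lt_min d0 subr_gt0.
move=> s; rewrite lt_min => /andP[sd stc].
have -> : U0 s - U0 c - (U0 t - U0 c) = U0 s - U0 t by rewrite opprB addrA subrK.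
(* The remainder is tested with itself. For this fixed vector the mean value bound concerns a real
   function, and it bounds the square of [nrm w] by [e * nrm w * |s - t|]. *)
set w := _ - _ *: _.
have : `|(P w s - s * g (f t) w) - (P w t - t * g (f t) w)| <= e * nrm w * `|s - t|.
  apply: (@MVT_bound _ (fun x => P w x - x * g (f t) w)
     (fun x => g (f x) w - g (f t) w)).
    move=> x xt; apply: is_deriveB.
      apply: dP; move: (le_lt_trans xt stc); rewrite ltr_norml; lra.
    have := is_deriveZ (g (f t) w) (is_derive_id x 1).
    rewrite /GRing.scale/= mulr1 => h; apply: is_derive_near_eq h; first exact: ltr01.
    by move=> y _; rewrite /GRing.scale/= mulrC.
  move=> x xt; rewrite -sipBl; apply: le_trans (sip_CS _ _ _) _.
  rewrite ler_wpM2r ?sipn_ge0//; apply/ltW/H; exact: le_lt_trans xt sd.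
have -> : (P w s - s * g (f t) w) - (P w t - t * g (f t) w) = nrm w ^+ 2.
  have E x : g (U0 s - U0 t - (s - t) *: f t) x =
      P x s - P x t - (s - t) * g (f t) x by rewrite !sipE !U0P.
  rewrite sqr_sipn [RHS](E w); ring.
rewrite ger0_norm ?sqr_ge0// => Hw.
have [->|p0] := eqVneq (nrm w) 0; first by rewrite mulr_ge0// ltW.
have pp : 0 < nrm w by rewrite lt_neqAle eq_sym p0 sipn_ge0.
by rewrite -(ler_pM2l pp) -expr2 mulrA (mulrC (nrm w)).
Qed.

End VectorCalculus.

(** * The Picard theorem *)

Section Picard.
Context {R : realType} {V : lmodType R}.
Variables (g : sip V) (F : R -> V -> V) (T0 : R).
Local Notation nrm := (sipn g).
Hypothesis g_complete : complete g.
Hypothesis g_def : forall u, g u u = 0 -> u = 0.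
Hypothesis F_lip : forall T, T0 <= T -> exists2 L, 0 < L &
  forall t x y, T0 <= t <= T -> nrm (F t x - F t y) <= L * nrm (x - y).
Hypothesis F_cont : forall x t, T0 <= t -> forall e, 0 < e -> exists2 d, 0 < d &
  forall s, T0 <= s -> `|s - t| < d -> nrm (F s x - F t x) < e.

(** Freezing time before [T0] turns continuity on the half line into continuity on R, which
    [vprimitive] expects, and gives a two-sided derivative at [T0]. *)
Let clamp (t : R) := Num.max t T0.

Let clamp_ge t : T0 <= clamp t. Proof. by rewrite le_max lexx orbT. Qed.

Let clamp_id t : T0 <= t -> clamp t = t. Proof. by move=> /max_idPl. Qed.

Let clamp_lip s t : `|clamp s - clamp t| <= `|s - t|.
Proof.
rewrite /clamp /Num.max; case: ifP => sT; case: ifP => tT; move: sT tT;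
  rewrite ?ltNge => sT tT; rewrite ler_norml;
  have := ler_norm (s - t); have := ler_norm (t - s); rewrite (distrC t s);
  lra.
Qed.

Let contp (u : R -> V) := forall t, vcont g (fun s => u (clamp s)) t.

Let contp_F u : contp u -> forall t, vcont g (fun s => F (clamp s) (u (clamp s))) t.
Proof.
move=> cu t e e0.
have [L L0 HL] := F_lip (ler_wpDr ler01 (clamp_ge t)).
have [d1 d10 H1] := cu t (e / 2 / L) ltac:(by rewrite !divr_gt0).
have [d2 d20 H2] := F_cont (u (clamp t)) (clamp_ge t) (divr_gt0 e0 (ltr0Sn R 1)).
exists (Num.min 1 (Num.min d1 d2)); first by rewrite !lt_min ltr01 d10.
move=> s; rewrite !lt_min => /andP[s1 /andP[/H1 sd1 sd2]].
apply: le_lt_trans (sipn_split _ (F (clamp s) (u (clamp t))) _ _) _.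
have h1 : nrm (F (clamp s) (u (clamp s)) - F (clamp s) (u (clamp t))) <= e / 2.
  apply: le_trans (HL _ _ _ _) _; last by rewrite mulrC -ler_pdivlMr// ltW.
  rewrite clamp_ge/=; have := clamp_lip s t.
  have := ler_norm (clamp s - clamp t); lra.
have h2 := H2 _ (clamp_ge s) (le_lt_trans (clamp_lip s t) sd2).
lra.
Qed.

Let step x0 : exists S : (R -> V) -> R -> V, forall u, contp u ->
  [/\ contp (S u), S u T0 = x0 & forall t, T0 <= t -> vderiv g (S u) t (F t (u t))].
Proof.
suff /choice[S SP] : forall u, exists U, contp u ->
    [/\ contp U, U T0 = x0 & forall t, T0 <= t -> vderiv g U t (F t (u t))].
  by exists S.
move=> u.
have [cu|ncu] := pselect (contp u); last by exists u.
have [U U0 dU] := vprimitive T0 g_complete (contp_F cu).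
have dU' t : T0 <= t -> vderiv g (fun s => x0 + 1 *: U s) t (F t (u t)).
  move=> Tt; have := vderivD 1 (vderiv_cst g x0 t) (dU t _).
  rewrite add0r scale1r clamp_id//; apply; lra.
exists (fun s => x0 + 1 *: U s) => _; split => //.
- move=> t e e0; have [d d0 H] := vderiv_cont (dU' _ (clamp_ge t)) e0.
  exists d => // s st; apply: H; exact: le_lt_trans (clamp_lip s t) st.
- by rewrite U0 scaler0 addr0.
Qed.

(** Successive approximations on each [[T0, T]]. Measured against the weight [expR (2 L (t - T0))]
    each step gains a factor 1/2, whatever the length of the interval. *)
Lemma picard x0 : exists2 u : R -> V, u T0 = x0 &
  forall t, T0 <= t -> vderiv g u t (F t (u t)).
Proof.
have [S SP] := step x0.
have [un [un_0 unS]] : exists un, un 0%N = (fun=> x0) /\ forall n, un n.+1 = S (un n).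
  by exists (fun n => iter n S (fun=> x0)).
have cun n : contp (un n).
  elim: n => [|n IH]; last by rewrite unS; have [] := SP _ IH.
  by rewrite un_0 => t e e0; exists 1 => // s _; rewrite subrr sipn0.
have un0 n : un n T0 = x0.
  by case: n => [|n]; [rewrite un_0|rewrite unS; have [] := SP _ (cun n)].
have dun n t : T0 <= t -> vderiv g (un n.+1) t (F t (un n t)).
  by rewrite unS; have [_ _ + Tt] := SP _ (cun n); exact.
have nrm0 w : nrm w = 0 -> w = 0.
  by move=> w0; apply: g_def; rewrite -sqr_sipn w0 expr0n.
have est T : T0 <= T -> exists2 C, 0 <= C & forall n t, T0 <= t <= T ->
    nrm (un n.+1 t - un n t) <= C / 2 ^+ n.
  move=> TT; have [L L0 HL] := F_lip TT.
  have cF : forall t, T0 <= t <= T -> {for t, continuous (fun s => nrm (F (clamp s) x0))}.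
    move=> t _; apply: (vcont_nrm (u := fun s => F (clamp s) x0)).
    by have := contp_F (cun 0%N); rewrite un_0; exact.
  have [K HK] := compact_bound TT cF.
  have K0 : 0 <= K by apply: le_trans (HK T0 _); rewrite ?sipn_ge0// lexx.
  (* Chosen so that the derivative of [C * E] is [K * E], which dominates the bound [K] of the first
     increment's speed. *)
  pose C := K / (2 * L).
  have C0 : 0 <= C by rewrite divr_ge0// mulr_ge0// ltW.
  pose E (t : R) := expR (2 * L * (t - T0)).
  have dE (c t : R) : is_derive t 1 (fun s => c * E s) (2 * L * (c * E t)).
    have := is_deriveZ c (is_derive_gronwall_exp (2 * L) T0 t).
    by move=> h; apply: (is_derive_eq h); rewrite /GRing.scale/= mulrCA.
  have E1 t : T0 <= t -> 1 <= E t.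
    by move=> Tt; rewrite /E -expR0 ler_expR mulr_ge0 ?subr_ge0// mulr_ge0// ltW.
  have EE n t : T0 <= t <= T -> nrm (un n.+1 t - un n t) <= C / 2 ^+ n * E t.
    elim: n t => [|n IH] t /andP[Tt tT].
      have /= := @vderiv_mean _ _ g (fun s => un 1%N s - un 0%N s) (fun s => F s x0)
        (fun s => C * E s) (fun s => 2 * L * (C * E s)) T0 t Tt _ (fun s _ => dE C s) _.
      rewrite !un0 subrr subr0 expr0 divr1 => H; apply: le_trans (H _ _) _.
      - move=> s /andP[Ts sT]; have := vderivB (dun 0%N s Ts) (vderiv_cst g x0 s).
        by rewrite subr0 un_0.
      - move=> s /andP[Ts sT]; have := HK s; rewrite clamp_id// Ts (le_trans sT)//.
        move=> /(_ isT) /le_trans; apply.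
        have -> : 2 * L * (C * E s) = K * E s by rewrite /C; field; rewrite gt_eqF.
        by rewrite ler_peMr// E1.
      - by rewrite gerBl mulr_ge0// expR_ge0.
    have /= := @vderiv_mean _ _ g (fun s => un n.+2 s - un n.+1 s)
        (fun s => F s (un n.+1 s) - F s (un n s))
        (fun s => C / 2 ^+ n.+1 * E s) (fun s => 2 * L * (C / 2 ^+ n.+1 * E s)) T0 t Tt _ (fun s _ => dE _ s) _.
    rewrite !un0 subrr subr0 => H; apply: le_trans (H _ _) _.
    - by move=> s /andP[Ts sT]; exact: vderivB (dun _ _ Ts) (dun _ _ Ts).
    - move=> s /andP[Ts sT]; have sTT : T0 <= s <= T by rewrite Ts (le_trans sT).
      apply: le_trans (HL _ _ _ sTT) _.
      have -> : 2 * L * (C / 2 ^+ n.+1 * E s) = L * (C / 2 ^+ n * E s).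
        by rewrite exprS; field; rewrite expf_neq0.
      by rewrite ler_pM2l// IH.
    - by rewrite gerBl mulr_ge0 ?expR_ge0// divr_ge0// exprn_ge0.
  exists (C * E T); first by rewrite mulr_ge0// expR_ge0.
  move=> n t /andP[Tt tT]; apply: le_trans (EE _ _ _) _; first by rewrite Tt.
  rewrite mulrAC ler_wpM2r ?invr_ge0 ?exprn_ge0// ler_wpM2l//.
  by rewrite ler_expR ler_wpM2l ?lerD2r// mulr_ge0// ltW.
have est2 T : T0 <= T -> exists2 C, 0 <= C & forall n k t, T0 <= t <= T ->
    nrm (un (n + k)%N t - un n t) <= C / 2 ^+ n.
  move=> /est[C C0 H]; exists (2 * C); first by rewrite mulr_ge0.
  have H2 n k t : T0 <= t <= T ->
    nrm (un (n + k)%N t - un n t) <= 2 * C / 2 ^+ n - 2 * C / 2 ^+ (n + k).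
    move=> tT; elim: k => [|k IH]; first by rewrite addn0 !subrr sipn0.
    rewrite addnS; apply: le_trans (sipn_split _ (un (n + k)%N t) _ _) _.
    have := H (n + k)%N t tT.
    have -> : 2 * C / 2 ^+ (n + k).+1 = C / 2 ^+ (n + k).
      by rewrite exprS; field; rewrite expf_neq0.
    have E2 : 2 * C / 2 ^+ (n + k) = C / 2 ^+ (n + k) + C / 2 ^+ (n + k) by ring.
    move: IH; rewrite E2; lra.
  move=> n k t /H2 /le_trans; apply.
  by rewrite gerBl divr_ge0 ?mulr_ge0 ?exprn_ge0.
have pow2 (C e : R) : 0 < e -> exists N, forall n, (N <= n)%N -> C / 2 ^+ n < e.
  move=> e0; exists (Num.trunc (`|C| / e)).+1 => n Nn.
  rewrite ltr_pdivrMr ?exprn_gt0//; apply: le_lt_trans (ler_norm C) _.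
  rewrite mulrC -ltr_pdivrMr//; apply: lt_trans (truncnS_gt _) _.
  apply: (@le_lt_trans _ _ n%:R); first by rewrite ler_nat.
  by rewrite -natrX ltr_nat ltn_expl.
have /choice[v vP] : forall t, exists l, vcvg g (fun n => un n (clamp t)) l.
  move=> t; apply: g_complete => e e0.
  have [C C0 H] := est2 _ (clamp_ge t).
  have [N HN] := pow2 C (e / 2) ltac:(by rewrite divr_gt0).
  have K n : (N <= n)%N -> nrm (un n (clamp t) - un N (clamp t)) < e / 2.
    move=> /subnKC <-; apply: le_lt_trans (H _ _ _ _) (HN _ (leqnn _)).
    by rewrite clamp_ge lexx.
  exists N => m n /K Km /K Kn.
  apply: le_lt_trans (sipn_split _ (un N (clamp t)) _ _) _.
  by rewrite [X in _ + X]sipnB; lra.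
have uv T : T0 <= T -> exists2 C, 0 <= C & forall n t, T0 <= t <= T ->
    nrm (un n t - v t) <= C / 2 ^+ n.
  move=> /est2[C C0 H]; exists C => // n t tT.
  apply/ler_addgt0Pr => e e0.
  have [N HN] := vP t e e0.
  move: HN; rewrite clamp_id; last by case/andP: tT.
  move=> /(_ (n + N)%N (leq_addl _ _)) HN.
  apply: le_trans (sipn_split _ (un (n + N)%N t) _ _) _.
  by rewrite sipnB; have := H n N t tT; lra.
have cv : contp v.
  move=> t e e0.
  have [C C0 H] := uv (clamp t + 1) ltac:(by rewrite ler_wpDr).
  have [N HN] := pow2 C (e / 4) ltac:(by rewrite divr_gt0).
  have [d d0 Hd] := cun N t (e / 4) ltac:(by rewrite divr_gt0).
  exists (Num.min d 1); first by rewrite lt_min d0 ltr01.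
  move=> s; rewrite lt_min => /andP[/Hd sd s1].
  have := H N (clamp t); rewrite clamp_ge lerDl ler01 => /(_ isT) h1.
  have := H N (clamp s); rewrite clamp_ge/=.
  have -> : clamp s <= clamp t + 1.
    by have := clamp_lip s t; have := ler_norm (clamp s - clamp t); lra.
  move=> /(_ isT) h2; have := HN N (leqnn _) => h3.
  apply: le_lt_trans (sipn_split _ (un N (clamp s)) _ _) _.
  rewrite sipnB; apply: le_lt_trans (lerD (lexx _) (sipn_split _ (un N (clamp t)) _ _)) _.
  lra.
have [_ U0 dU] := SP _ cv.
(* [S v] and not [v]: the limit [v] is constant before [T0], so it need not have a two-sided
   derivative at [T0]. The two agree from [T0] on, both being limits of the iterates. *)
exists (S v) => // t Tt.
suff Uv s : T0 <= s -> S v s = v s by rewrite Uv//; exact: dU.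
move=> Ts; apply/eqP; rewrite -subr_eq0; apply/eqP/nrm0/eqP; rewrite eq_le sipn_ge0 andbT.
have [C C0 H] := uv _ Ts.
have [L L0 HL] := F_lip Ts.
apply/ler_addgt0Pr => e e0; rewrite add0r.
have [N HN] := pow2 (L * C * (s - T0) + C) e e0.
apply: le_trans (sipn_split _ (un N.+1 s) _ _) _.
have h1 : nrm (S v s - un N.+1 s) <= L * C / 2 ^+ N * (s - T0).
  have := @vderiv_mean _ _ g (fun s => S v s - un N.+1 s) (fun s => F s (v s) - F s (un N s))
    (fun x => L * C / 2 ^+ N * x) (fun=> L * C / 2 ^+ N) T0 s Ts _ _ _.
  rewrite U0 un0 subrr subr0 -mulrBr; apply.
  - by move=> x /andP[Tx _]; apply: vderivB; [exact: dU|exact: dun].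
  - move=> x _; have := is_deriveZ (L * C / 2 ^+ N) (is_derive_id x 1).
    by rewrite /GRing.scale/= mulr1.
  - move=> x xs; apply: le_trans (HL _ _ _ xs) _.
    by rewrite -mulrA ler_pM2l// sipnB H.
have h2 : nrm (un N.+1 s - v s) <= C / 2 ^+ N.
  apply: le_trans (H _ _ _) _; first by rewrite Ts lexx.
  by rewrite ler_wpM2l// lef_pV2 ?posrE ?exprn_gt0// ler_eXn2l// ltr1n.
have := HN N (leqnn _); have -> : (L * C * (s - T0) + C) / 2 ^+ N =
  L * C / 2 ^+ N * (s - T0) + C / 2 ^+ N by ring.
lra.
Qed.

End Picard.

(** * Energy spaces and their regularization *)

Section EnergySpace.
Context {R : realType} {V : lmodType R}.

(* [h] is the L^2 product, [d u v] stands for [\int u_x v_x], [I] for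
   multiplication by i, [N u] for (|a + u|^2 - |a|^2) (a + u) and [P u] for
   \int (|a + u|^2 - |a|^2)^2. *)
Record energy_space := EnergySpace {
  es_h : sip V;
  es_d : sip V;
  es_I : V -> V;
  es_N : V -> V;
  es_P : V -> R;
  es_K : R -> R;
  es_A : R;
  es_complete : complete (sip_add es_h es_d ler01);
  es_def : forall u, es_h u u = 0 -> u = 0;
  es_I_lin : forall (a : R) u v, es_I (a *: u + v) = a *: es_I u + es_I v;
  es_II : forall u, es_I (es_I u) = - u;
  es_hI : forall u v, es_h (es_I u) v = - es_h u (es_I v);
  es_dI : forall u v, es_d (es_I u) v = - es_d u (es_I v);
  es_N0 : es_N 0 = 0;
  es_P0 : es_P 0 = 0;
  es_P_ge0 : forall u, 0 <= es_P u;
  es_K_ge0 : forall M, 0 <= es_K M;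
  es_A_ge0 : 0 <= es_A;
  es_N_liph : forall M u v,
    sipn (sip_add es_h es_d ler01) u <= M -> sipn (sip_add es_h es_d ler01) v <= M ->
    sipn es_h (es_N u - es_N v) <= es_K M * sipn es_h (u - v);
  es_N_lipg : forall M u v,
    sipn (sip_add es_h es_d ler01) u <= M -> sipn (sip_add es_h es_d ler01) v <= M ->
    sipn (sip_add es_h es_d ler01) (es_N u - es_N v) <=
      es_K M * sipn (sip_add es_h es_d ler01) (u - v);
  es_P_lip : forall M u v,
    sipn (sip_add es_h es_d ler01) u <= M -> sipn (sip_add es_h es_d ler01) v <= M ->
    `|es_P u - es_P v| <= es_K M * sipn es_h (u - v);
  es_P_diff : forall u, exists C, forall x, sipn (sip_add es_h es_d ler01) x <= 1 ->
    `|es_P (u + x) - es_P u - 4 * es_h (es_N u) x| <=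
      C * sipn (sip_add es_h es_d ler01) x ^+ 2;
  es_NI : forall u (s : R), 0 < s ->
    2 * `|es_h (es_N u) (es_I u)| * s <= es_P u * s ^+ 2 + es_A * es_h u u }.

Definition es_g (X : energy_space) := sip_add (es_h X) (es_d X) ler01.

End EnergySpace.
Arguments energy_space {R} V.

Section Basic.
Context {R : realType} {V : lmodType R} (X : energy_space V).
Local Notation h := (es_h X).
Local Notation d := (es_d X).
Local Notation g := (es_g X).
Local Notation I := (es_I X).
Local Notation N := (es_N X).
Local Notation P := (es_P X).
Local Notation K := (es_K X).

Lemma es_gE u v : g u v = h u v + d u v.
Proof. by rewrite /= mul1r. Qed.

Lemma sipn_h_le u : sipn h u <= sipn g u.
Proof. by rewrite /sipn; apply: ler_wsqrtr; rewrite es_gE lerDl sip_ge0. Qed.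

Lemma sipn_d_le u : sipn d u <= sipn g u.
Proof. by rewrite /sipn; apply: ler_wsqrtr; rewrite es_gE lerDr sip_ge0. Qed.

Lemma es_g_def u : g u u = 0 -> u = 0.
Proof.
move=> gu; apply: (@es_def _ _ X); apply/eqP; rewrite eq_le sip_ge0 andbT -gu.
by rewrite es_gE lerDl sip_ge0.
Qed.

Lemma es_I0 : I 0 = 0.
Proof.
by have := es_I_lin X 1 0 0; rewrite !scale1r addr0 => /eqP; rewrite -subr_eq0 opprD addNKr oppr_eq0 => /eqP.
Qed.

Lemma es_IZ (a : R) u : I (a *: u) = a *: I u.
Proof. by rewrite -[a *: u]addr0 es_I_lin es_I0 addr0. Qed.

Lemma es_ID u v : I (u + v) = I u + I v.
Proof. by rewrite -[u in LHS]scale1r es_I_lin scale1r. Qed.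

Lemma es_IN u : I (- u) = - I u.
Proof. by rewrite -scaleN1r es_IZ scaleN1r. Qed.

Lemma es_IB u v : I (u - v) = I u - I v.
Proof. by rewrite es_ID es_IN. Qed.

Lemma es_gI u v : g (I u) v = - g u (I v).
Proof. by rewrite !es_gE es_hI es_dI opprD. Qed.

Lemma es_hIself u : h u (I u) = 0.
Proof. have := es_hI X u u; rewrite sipC; lra. Qed.

Lemma es_dIself u : d u (I u) = 0.
Proof. have := es_dI X u u; rewrite sipC; lra. Qed.

Lemma es_gIself u : g u (I u) = 0.
Proof. by rewrite es_gE es_hIself es_dIself addr0. Qed.

Lemma sipn_gI u : sipn g (I u) = sipn g u.
Proof. by rewrite /sipn es_gI es_II sipNr opprK. Qed.

Lemma sipn_hI u : sipn h (I u) = sipn h u.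
Proof. by rewrite /sipn es_hI es_II sipNr opprK. Qed.

Lemma sipn_dI u : sipn d (I u) = sipn d u.
Proof. by rewrite /sipn es_dI es_II sipNr opprK. Qed.

Lemma sipn_N_le M u : sipn g u <= M -> sipn h (N u) <= K M * M.
Proof.
move=> uM; have M0 := le_trans (sipn_ge0 g u) uM.
have := @es_N_liph _ _ X M u 0 uM; rewrite sipn0 => /(_ M0).
rewrite es_N0 !subr0 => /le_trans; apply.
by rewrite ler_wpM2l ?es_K_ge0//; exact: le_trans (sipn_h_le u) uM.
Qed.

End Basic.

(** * The resolvent and the regularized vector field *)

Section Regularized.
Context {R : realType} {V : lmodType R} (X : energy_space V).
Local Notation h := (es_h X).
Local Notation d := (es_d X).
Local Notation g := (es_g X).
Local Notation I := (es_I X).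
Local Notation N := (es_N X).
Local Notation P := (es_P X).
Local Notation K := (es_K X).
Variables (l : R) (l0 : 0 < l) (l1 : l <= 1).

(** For smooth arguments this is the L^2 product of u - l u_xx with v. It is equivalent to [g] for
    each [l], with a lower constant that degenerates as [l] tends to 0. *)
Definition gl := sip_add h d (ltW l0).

Lemma glE u v : gl u v = h u v + l * d u v. Proof. by []. Qed.

Lemma gl_le u : sipn gl u <= sipn g u.
Proof.
by rewrite /sipn; apply: ler_wsqrtr; rewrite glE es_gE lerD2l ler_piMl ?sip_ge0.
Qed.

Lemma sipn_h_gl u : sipn h u <= sipn gl u.
Proof. by rewrite /sipn; apply: ler_wsqrtr; rewrite glE lerDl mulr_ge0 ?sip_ge0// ltW. Qed.

Lemma sipn_d_gl u : Num.sqrt l * sipn d u <= sipn gl u.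
Proof.
rewrite /sipn -(sqrtrM _ (ltW l0)); apply: ler_wsqrtr.
by rewrite glE lerDr sip_ge0.
Qed.

Lemma gl_ge u : Num.sqrt l * sipn g u <= sipn gl u.
Proof.
rewrite /sipn -(sqrtrM _ (ltW l0)); apply: ler_wsqrtr.
by rewrite glE es_gE mulrDr lerD2r ler_piMl ?sip_ge0.
Qed.

Lemma gl_def u : gl u u = 0 -> u = 0.
Proof.
move=> gu; apply: (@es_def _ _ X); apply/eqP; rewrite eq_le sip_ge0 andbT -gu.
by rewrite glE lerDl mulr_ge0 ?sip_ge0// ltW.
Qed.

Lemma gl_complete : complete gl.
Proof.
have s0 : 0 < Num.sqrt l by rewrite sqrtr_gt0.
move=> x xC; have [|v vP] := @es_complete _ _ X x.
  move=> e e0; have [n Hn] := xC (Num.sqrt l * e) ltac:(by rewrite mulr_gt0).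
  exists n => i j ni nj; rewrite -(ltr_pM2l s0); apply: le_lt_trans (gl_ge _) _.
  exact: Hn.
exists v => e e0; have [n Hn] := vP e e0; exists n => m /Hn.
exact: le_lt_trans (gl_le _).
Qed.

Lemma J_exists : {J : V -> V | forall w phi, gl (J w) phi = h w phi}.
Proof.
apply: cid; suff /choice[J JP] : forall w, exists j, forall phi, gl j phi = h w phi by exists J.
move=> w; apply: (@riesz _ _ gl (h w) (sipn h w) gl_complete).
  by move=> a x y; rewrite !sipE.
move=> u; apply: le_trans (sip_CS _ _ _) _; rewrite ler_wpM2l ?sipn_ge0//.
exact: sipn_h_gl.
Qed.

(* [J = (1 - l \partial_x^2)^{-1}] *)
Definition J := sval J_exists.

Lemma J_gl w phi : gl (J w) phi = h w phi.
Proof. exact: (svalP J_exists). Qed.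

Lemma gl_inj u v : (forall phi, gl u phi = gl v phi) -> u = v.
Proof.
move=> H; apply/eqP; rewrite -subr_eq0; apply/eqP/gl_def.
by rewrite sipBl H subrr.
Qed.

Lemma J_lin (a : R) u v : J (a *: u + v) = a *: J u + J v.
Proof. by apply: gl_inj => phi; rewrite sip_linl !J_gl !sipE. Qed.

Lemma J0 : J 0 = 0.
Proof. by apply: gl_inj => phi; rewrite J_gl !sipE. Qed.

Lemma JB u v : J (u - v) = J u - J v.
Proof. by apply: gl_inj => phi; rewrite sipBl !J_gl sipBl. Qed.

Lemma JI u : J (I u) = I (J u).
Proof.
apply: gl_inj => phi; rewrite J_gl es_hI -J_gl !glE es_hI es_dI; ring.
Qed.

Lemma J_h u v : h (J u) v = h u (J v).
Proof. by rewrite [LHS]sipC -(J_gl v) sipC J_gl. Qed.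

(** Weak form of - l \partial_x^2 J = 1 - J. It lets [d (J u)] act on vectors that are controlled in
    L^2 only. *)
Lemma Jd u v : l * d (J u) v = h u v - h (J u) v.
Proof. by have := J_gl u v; rewrite glE; lra. Qed.

Lemma J_d u v : d (J u) v = d u (J v).
Proof.
have l0' : l != 0 by rewrite gt_eqF.
by apply: (mulfI l0'); rewrite Jd (sipC d) Jd J_h (sipC h (J v)) (sipC h v).
Qed.

Lemma sipn_hJ u : sipn h (J u) <= sipn h u.
Proof.
have [->|J0] := eqVneq (sipn h (J u)) 0; first exact: sipn_ge0.
have Jp : 0 < sipn h (J u) by rewrite lt_neqAle eq_sym J0 sipn_ge0.
rewrite -(ler_pM2r Jp) -expr2 sqr_sipn; apply: le_trans (sip_le _ _ _).
have := Jd u (J u); have := mulr_ge0 (ltW l0) (sip_ge0 d (J u)); lra.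
Qed.

(** Two instances of [Jd]. Nonnegativity of the left side makes [J] a contraction for [d]; the
    factor [l] on the right gives the convergence of [J] to the identity at rate sqrt l. *)
Lemma J_err_eq u : h (u - J u) (u - J u) = l * (d (J u) u - d (J u) (J u)).
Proof.
have := Jd u u; have := Jd u (J u); rewrite mulrBr => -> ->.
by rewrite sipBr !sipBl.
Qed.

Lemma sipn_dJ u : sipn d (J u) <= sipn d u.
Proof.
have [->|J0] := eqVneq (sipn d (J u)) 0; first exact: sipn_ge0.
have Jp : 0 < sipn d (J u) by rewrite lt_neqAle eq_sym J0 sipn_ge0.
rewrite -(ler_pM2r Jp) -expr2 sqr_sipn; apply: le_trans (sip_le _ _ _).
have := sip_ge0 h (u - J u); rewrite J_err_eq pmulr_rge0//.
rewrite (sipC d u); lra.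
Qed.

Lemma sipn_gJ u : sipn g (J u) <= sipn g u.
Proof.
apply: sipn_le; first exact: sipn_ge0.
rewrite sqr_sipn !es_gE lerD//.
  by rewrite -!sqr_sipn ler_sqr ?nnegrE ?sipn_ge0// sipn_hJ.
by rewrite -!sqr_sipn ler_sqr ?nnegrE ?sipn_ge0// sipn_dJ.
Qed.

Lemma J_err u : sipn h (u - J u) <= Num.sqrt l * sipn d u.
Proof.
rewrite /sipn -(sqrtrM _ (ltW l0)); apply: ler_wsqrtr.
rewrite J_err_eq ler_pM2l//.
have := sip_ge0 d (J u); have := sip_le d (J u) u; have := sipn_dJ u.
rewrite -(sqr_sipn d u); have := sipn_ge0 d u; nra.
Qed.

(** The gradient J E'(u) of the energy with respect to [gl]: by [Jd] the first term is - J u_xx. *)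
Definition fq (t : R) u := l^-1 *: (u - J u) + t^-1 *: J (N u).

Definition field_l (t : R) u := I (fq t u).

Lemma fq_gl t u phi : gl (fq t u) phi = d u phi + t^-1 * h (N u) phi.
Proof.
rewrite /fq sipDl !sipZl sipBl !J_gl glE; move: (t^-1) => r.
by field; rewrite gt_eqF.
Qed.

Lemma field_gl t u phi :
  gl (field_l t u) phi = - (d u (I phi) + t^-1 * h (N u) (I phi)).
Proof.
by rewrite -fq_gl !glE /field_l es_hI es_dI; ring.
Qed.

(** Tested in L^2 the field shows no factor [l^-1]: [J] moves onto [u] in the linear term and onto
    the test vector in the nonlinear one. The limit equation is obtained from this form. *)
Lemma field_h t u phi : h (field_l t u) phi =
  - (d (J u) (I phi) + t^-1 * h (N u) (J (I phi))).
Proof. by rewrite sipC -J_gl sipC field_gl -JI J_d. Qed.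

Lemma field_0 t : field_l t 0 = 0.
Proof.
by rewrite /field_l /fq es_N0 !J0 subrr !scaler0 addr0 es_I0.
Qed.

Lemma fq_sub t u v :
  fq t u - fq t v = l^-1 *: ((u - v) - J (u - v)) + t^-1 *: J (N u - N v).
Proof.
rewrite /fq opprD addrACA -!scalerBr -JB; congr (_ *: _ + _).
by rewrite opprB JB opprB addrACA [RHS]addrACA (addrC (- J u)).
Qed.

(** [J] is symmetric for [h] and for [d] and commutes with [I], so [I J] is skew for both. This
    removes the part of the field with factor 1/l from the H^1 estimates. *)
Lemma es_gIJ_self u : g (I (J u)) u = 0.
Proof.
have hz : h (I (J u)) u = - h (I (J u)) u.
  by rewrite -{1}JI J_h es_hI sipC.
have dz : d (I (J u)) u = - d (I (J u)) u.
  by rewrite -{1}JI J_d es_dI sipC.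
rewrite es_gE; lra.
Qed.

Lemma es_gIJ_sub_self u : g (I (u - J u)) u = 0.
Proof. by rewrite es_IB sipBl es_gIJ_self es_gI es_gIself !oppr0 addr0. Qed.

(** The constant grows like 2/l; it serves to solve the equation for a fixed parameter and plays no
    part in the estimates uniform in [l]. *)
Lemma field_lip t T M u v : 0 < T -> T <= t -> sipn g u <= M -> sipn g v <= M ->
  sipn g (field_l t u - field_l t v) <= (2 / l + K M / T) * sipn g (u - v).
Proof.
move=> T0 Tt uM vM; rewrite /field_l -es_IB sipn_gI.
have t0 := lt_le_trans T0 Tt.
rewrite fq_sub.
apply: le_trans (sipn_triangle _ _ _) _; rewrite mulrDl; apply: lerD.
  rewrite sipnZ gtr0_norm ?invr_gt0// (mulrC 2) -mulrA ler_pM2l ?invr_gt0//.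
  by apply: le_trans (sipn_sub _ _ _) _; have := sipn_gJ (u - v); lra.
rewrite sipnZ gtr0_norm ?invr_gt0// mulrAC [leRHS]mulrC; apply: ler_pM.
- by rewrite invr_ge0 ltW.
- exact: sipn_ge0.
- by rewrite lef_pV2.
- apply: le_trans (sipn_gJ _) _; exact: es_N_lipg.
Qed.

End Regularized.

(** * The regularized equation *)

Section Clip.
Context {R : realType}.
Implicit Types x y : R.

Definition clip x : R := Num.min 1 (Num.max 0 x).

Lemma clip_ge0 x : 0 <= clip x.
Proof. by rewrite /clip le_min ler01 le_max lexx. Qed.

Lemma clip_le1 x : clip x <= 1.
Proof. by rewrite /clip ge_min lexx. Qed.

Lemma clip_eq0 x : x <= 0 -> clip x = 0.
Proof. by move=> x0; rewrite /clip (max_idPl x0) (min_idPr ler01). Qed.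

Lemma clip_eq1 x : 1 <= x -> clip x = 1.
Proof.
move=> x1; rewrite /clip (max_idPr _); first by rewrite (min_idPl x1).
exact: le_trans ler01 x1.
Qed.

Lemma clip_lip x y : `|clip x - clip y| <= `|x - y|.
Proof.
rewrite ler_norml; have := ler_norm (x - y); have := ler_norm (y - x).
rewrite (distrC y x) => h1 h2.
have cc z : [\/ clip z = 0 /\ z <= 0, clip z = 1 /\ 1 <= z | clip z = z /\ 0 <= z <= 1].
  have [z0|z0] := leP z 0; first by constructor 1; rewrite clip_eq0.
  have [z1|z1] := leP 1 z; first by constructor 2; rewrite clip_eq1.
  constructor 3; rewrite /clip (max_idPr (ltW z0)) (min_idPr (ltW z1)).
  by rewrite !ltW.
case: (cc x) => -[-> xx]; case: (cc y) => -[-> yy]; lra.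
Qed.

End Clip.

Section Truncated.
Context {R : realType} {V : lmodType R} (X : energy_space V).
Local Notation h := (es_h X).
Local Notation d := (es_d X).
Local Notation g := (es_g X).
Local Notation I := (es_I X).
Local Notation N := (es_N X).
Local Notation P := (es_P X).
Local Notation K := (es_K X).
Variables (l : R) (l0 : 0 < l) (l1 : l <= 1) (T0 : R) (T00 : 0 < T0).
Variables (B : R -> R) (B1 : forall t, 1 <= B t)
  (Bc : forall t, {for t, continuous B}).
Local Notation nrm := (sipn g).
Local Notation F := (field_l X l0 l1).

(* The cut-off makes the field globally Lipschitz; a priori bounds keep the
   solution where it equals 1. *)
Definition cutoff (t : R) u := clip (2 - nrm u / B t).

Let B0 t : 0 < B t. Proof. exact: lt_le_trans (B1 t). Qed.

Lemma cutoff_lip t u v : `|cutoff t u - cutoff t v| <= nrm (u - v).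
Proof.
apply: le_trans (clip_lip _ _) _.
have -> : 2 - nrm u / B t - (2 - nrm v / B t) = - ((nrm u - nrm v) / B t) by ring.
rewrite normrN normrM normfV (gtr0_norm (B0 t)) ler_pdivrMr//.
apply: le_trans (sipn_dist _ _ _) _.
by rewrite ler_peMr// ?sipn_ge0.
Qed.

Lemma cutoff0 t u : 2 * B t <= nrm u -> cutoff t u = 0.
Proof. by move=> Bu; apply: clip_eq0; rewrite subr_le0 ler_pdivlMr. Qed.

Lemma cutoff1 t u : nrm u <= B t -> cutoff t u = 1.
Proof.
move=> uB; apply: clip_eq1.
have : nrm u / B t <= 1 by rewrite ler_pdivrMr// mul1r.
lra.
Qed.

Definition truncated t u := cutoff t u *: F t u.

(** Beyond radius [2 M] the truncated field vanishes, so by symmetry one state may be taken inside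
    the ball. The product is split so that the field is bounded at that state alone. *)
Lemma truncated_lip T : T0 <= T -> exists2 L, 0 < L &
  forall t u v, T0 <= t <= T -> nrm (truncated t u - truncated t v) <= L * nrm (u - v).
Proof.
move=> TT; have [M HM] := compact_bound TT (fun t _ => @Bc t).
have M1 : 1 <= M by apply: le_trans (B1 T0) (HM _ _); rewrite lexx.
pose L1 := 2 / l + K (2 * M) / T0.
have L10 : 0 < L1 by rewrite ltr_pwDl ?divr_gt0// divr_ge0 ?es_K_ge0// ltW.
have M2 : 0 <= 2 * M by lra.
exists (L1 + L1 * (2 * M)); first by rewrite ltr_pwDl// mulr_ge0// ltW.
move=> t u v tT; have /andP[T0t tT'] := tT.
have big w : 2 * M < nrm w -> cutoff t w = 0.
  by move=> Mw; apply: cutoff0; have := HM t tT; lra.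
have Fb w : nrm w <= 2 * M -> nrm (F t w) <= L1 * (2 * M).
  move=> wM; have := @field_lip _ _ X _ l0 l1 t T0 (2 * M) w 0 T00 T0t wM.
  rewrite sipn0 => /(_ M2); rewrite field_0 !subr0 => /le_trans; apply.
  by rewrite ler_pM2l.
have key x y : nrm y <= 2 * M ->
    nrm (truncated t x - truncated t y) <= (L1 + L1 * (2 * M)) * nrm (x - y).
  move=> yM.
  have -> : truncated t x - truncated t y =
     cutoff t x *: (F t x - F t y) + (cutoff t x - cutoff t y) *: F t y.
    by rewrite /truncated scalerBr scalerBl addrA subrK.
  apply: le_trans (sipn_triangle _ _ _) _; rewrite !sipnZ mulrDl; apply: lerD.
    have [xM|/big->] := leP (nrm x) (2 * M); last first.
      by rewrite normr0 mul0r mulr_ge0 ?sipn_ge0// ltW.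
    rewrite ger0_norm ?clip_ge0//; apply: le_trans (_ : _ <= 1 * _) _.
      by apply: ler_wpM2r; [exact: sipn_ge0|exact: clip_le1].
    by rewrite mul1r; exact: field_lip.
  rewrite mulrC; apply: ler_pM; rewrite ?sipn_ge0//; first exact: Fb.
  exact: cutoff_lip.
have [vM|vM] := leP (nrm v) (2 * M); first exact: key.
have [uM|uM] := leP (nrm u) (2 * M); first by rewrite (sipnB g u) (sipnB g (truncated t u)); exact: key.
rewrite /truncated !big// !scale0r subr0 sipn0 mulr_ge0 ?sipn_ge0//.
by apply: addr_ge0; [exact: ltW|apply: mulr_ge0 => //; exact: ltW].
Qed.

Lemma truncated_cont u t : T0 <= t -> forall e, 0 < e -> exists2 r, 0 < r &
  forall s, T0 <= s -> `|s - t| < r -> nrm (truncated s u - truncated t u) < e.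
Proof.
move=> T0t e e0; have t0 := lt_le_trans T00 T0t.
have c1 : {for t, continuous (fun s => cutoff s u)}.
  apply/continuous_epsP => r r0.
  have : {for t, continuous (fun s => nrm u / B s)}.
    apply: (@continuousM _ _ (cst (nrm u)) (fun s => (B s)^-1)).
      exact: cst_continuous.
    by apply: continuousV; [rewrite gt_eqF|exact: Bc].
  move=> /continuous_epsP/(_ r r0)[e1 e10 H]; exists e1 => // s /H {}H.
  apply: le_lt_trans (clip_lip _ _) _.
  have -> : 2 - nrm u / B s - (2 - nrm u / B t) = - (nrm u / B s - nrm u / B t) by ring.
  by rewrite normrN.
have c2 : {for t, continuous (fun s => cutoff s u * s^-1)}.
  apply: (@continuousM _ _ (fun s => cutoff s u) (fun s => s^-1)) => //.
  by apply: (@continuousV _ _ (fun s => s)) => //; rewrite gt_eqF.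
pose A1 := I (l^-1 *: (u - J X l0 l1 u)); pose A2 := I (J X l0 l1 (N u)).
(* Time enters through two scalar coefficients only; the vectors [A1] and [A2] are fixed. *)
have E s : truncated s u = cutoff s u *: A1 + (cutoff s u * s^-1) *: A2.
  by rewrite /truncated /field_l /fq es_ID scalerDr (es_IZ X s^-1) scalerA.
pose m := nrm A1 + nrm A2 + 1.
have m0 : 0 < m by have := sipn_ge0 g A1; have := sipn_ge0 g A2; rewrite /m; lra.
have em : 0 < e / m by rewrite divr_gt0.
have [r1 r10 H1] := (continuous_epsP _ _).1 c1 _ em.
have [r2 r20 H2] := (continuous_epsP _ _).1 c2 _ em.
exists (Num.min r1 r2); first by rewrite lt_min r10.
move=> s T0s; rewrite lt_min => /andP[/H1 {}H1 /H2 {}H2].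
rewrite !E opprD addrACA -!scalerBl; apply: le_lt_trans (sipn_triangle _ _ _) _.
rewrite !sipnZ.
apply: (@le_lt_trans _ _ (e / m * nrm A1 + e / m * nrm A2)).
  by apply: lerD; apply: ler_wpM2r; rewrite ?sipn_ge0// ltW.
rewrite -mulrDr -[ltRHS](divfK (_ : m != 0)) ?gt_eqF// ltr_pM2l//.
by rewrite /m; lra.
Qed.

Lemma truncated_solution u0 : exists2 u : R -> V, u T0 = u0 &
  forall t, T0 <= t -> vderiv g u t (cutoff t (u t) *: F t (u t)).
Proof.
apply: (picard (g := g) (F := truncated)).
- exact: es_complete.
- exact: es_g_def.
- exact: truncated_lip.
- exact: truncated_cont.
Qed.

End Truncated.

Section PointwiseRules.
Context {R : realType}.
Implicit Types (f : R -> R) (t : R).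

Lemma is_derive_scalef f t (c a : R) : is_derive t 1 f a ->
  is_derive t 1 (fun s => c * f s) (c * a).
Proof. by move=> df; exact: is_deriveZ. Qed.

Lemma is_derive_addf f1 f2 t (a1 a2 : R) : is_derive t 1 f1 a1 -> is_derive t 1 f2 a2 ->
  is_derive t 1 (fun s => f1 s + f2 s) (a1 + a2).
Proof. by move=> d1 d2; exact: is_deriveD. Qed.

Lemma is_derive_subf f1 f2 t (a1 a2 : R) : is_derive t 1 f1 a1 -> is_derive t 1 f2 a2 ->
  is_derive t 1 (fun s => f1 s - f2 s) (a1 - a2).
Proof. by move=> d1 d2; exact: is_deriveB. Qed.

Lemma is_derive_mulf f1 f2 t (a1 a2 : R) : is_derive t 1 f1 a1 -> is_derive t 1 f2 a2 ->
  is_derive t 1 (fun s => f1 s * f2 s) (a1 * f2 t + f1 t * a2).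
Proof.
move=> d1 d2; have d3 := is_deriveM d1 d2; apply: (is_derive_eq d3).
by rewrite /GRing.scale/= addrC mulrC.
Qed.

Lemma is_derive_invf (c t : R) : c != 0 -> t != 0 ->
  is_derive t 1 (fun s => (c * s)^-1) (- (c * t ^+ 2)^-1).
Proof.
move=> c0 t0.
have ct : c * t != 0 by rewrite mulf_neq0.
have d1 : is_derive t 1 (fun s => c * s) (c * 1) by apply: is_derive_scalef.
have d2 := is_deriveV ct d1; apply: (is_derive_eq d2).
by rewrite /GRing.scale/=; field; rewrite c0 t0.
Qed.

End PointwiseRules.

(** * Energy identity and global solutions for a fixed parameter *)

Section Energy.
Context {R : realType} {V : lmodType R} (X : energy_space V).
Local Notation h := (es_h X).
Local Notation d := (es_d X).
Local Notation g := (es_g X).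
Local Notation I := (es_I X).
Local Notation N := (es_N X).
Local Notation P := (es_P X).
Local Notation K := (es_K X).
Local Notation nrm := (sipn g).

Definition es_energy (t : R) u := 2^-1 * d u u + (4 * t)^-1 * P u.

Lemma is_derive_P u t w : vderiv g u t w ->
  is_derive t 1 (fun s => P (u s)) (4 * h (N (u t)) w).
Proof.
have [C HC] := es_P_diff X (u t).
apply: (@is_derive_chain _ _ g P (fun x => 4 * h (N (u t)) x) C (4 * sipn h (N (u t)))) => //.
  by move=> a x y; rewrite !sipE; ring.
move=> x; rewrite normrM ger0_norm// -mulrA ler_wpM2l//.
apply: le_trans (sip_CS _ _ _) _; rewrite ler_wpM2l ?sipn_ge0//.
exact: sipn_h_le.
Qed.

Lemma is_derive_energy u t w : 0 < t -> vderiv g u t w ->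
  is_derive t 1 (fun s => es_energy s (u s))
    (d w (u t) + t^-1 * h (N (u t)) w - (4 * t ^+ 2)^-1 * P (u t)).
Proof.
move=> t0 du.
have d1 : is_derive t 1 (fun s => d (u s) (u s)) (2 * d w (u t)).
  apply: (is_derive_sip_sqr (g := g) (C := 1)) => // x.
  by rewrite mul1r sipn_d_le.
have d4 : is_derive t 1 (fun s => (4 * s)^-1) (- (4 * t ^+ 2)^-1).
  by apply: is_derive_invf => //; rewrite gt_eqF.
have := is_derive_addf (is_derive_scalef 2^-1 d1) (is_derive_mulf d4 (is_derive_P du)).
by move=> D; apply: (is_derive_eq D); field; rewrite gt_eqF.
Qed.

Variables (T0 : R) (T00 : 0 < T0).

(** Bounds the initial energy on the ball of radius [r]; the term [K r * r] is the Lipschitz bound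
    of [P] between [u] and 0. *)
Definition energy_bound (r : R) := 2^-1 * r ^+ 2 + (4 * T0)^-1 * (K r * r).

Lemma energy_bound_ge0 r : 0 <= r -> 0 <= energy_bound r.
Proof.
move=> r0; rewrite addr_ge0 ?mulr_ge0 ?invr_ge0 ?exprn_ge0 ?es_K_ge0//.
by rewrite mulr_ge0// ltW.
Qed.

Lemma es_energy_le r u : nrm u <= r -> es_energy T0 u <= energy_bound r.
Proof.
move=> ur; have r0 := le_trans (sipn_ge0 g u) ur.
apply: lerD.
  rewrite ler_wpM2l ?invr_ge0//; apply: le_sipn => //.
  exact: le_trans (sipn_d_le X u) ur.
rewrite ler_wpM2l ?invr_ge0 ?mulr_ge0 ?(ltW T00)//.
have := @es_P_lip _ _ X r u 0 ur; rewrite sipn0 => /(_ r0).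
rewrite es_P0 !subr0 ger0_norm ?es_P_ge0// => /le_trans; apply.
rewrite ler_wpM2l ?es_K_ge0//; exact: le_trans (sipn_h_le X u) ur.
Qed.

(** Rate and source of the L^2 growth. [es_NI] with [s = t^-1] leaves [es_A * h u u] and
    [P u / t^2]; the energy gives [P u <= 4 t E], hence a source of at most [4 E / T0]. The 1 added
    to [es_A] makes the rate positive. *)
Definition growth_rate := es_A X + 1.
Definition growth_source r := 4 * energy_bound r / T0.

(** Gronwall for the L^2 part plus twice the energy for the derivative; the last 1 ensures the lower
    bound 1 required of a cut-off radius. *)
Definition norm_bound (r t : R) := Num.sqrt
  ((r ^+ 2 + growth_source r / growth_rate) * expR (growth_rate * (t - T0))
    + 2 * energy_bound r + 1).

Lemma growth_rate_gt0 : 0 < growth_rate.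
Proof. by rewrite ltr_wpDl ?es_A_ge0. Qed.

Lemma growth_source_ge0 r : 0 <= r -> 0 <= growth_source r.
Proof.
by move=> r0; rewrite divr_ge0 ?mulr_ge0 ?energy_bound_ge0// ltW.
Qed.

Let radicand_ge1 (r t : R) : 0 <= r ->
  1 <= (r ^+ 2 + growth_source r / growth_rate) * expR (growth_rate * (t - T0))
    + 2 * energy_bound r + 1.
Proof.
move=> r0; rewrite lerDr addr_ge0//.
  rewrite mulr_ge0 ?expR_ge0// addr_ge0 ?sqr_ge0// divr_ge0 ?growth_source_ge0//.
  exact/ltW/growth_rate_gt0.
by rewrite mulr_ge0 ?energy_bound_ge0.
Qed.

Lemma norm_bound_ge1 (r t : R) : 0 <= r -> 1 <= norm_bound r t.
Proof.
move=> r0; rewrite -[leLHS]sqrtr1; apply: ler_wsqrtr; exact: radicand_ge1.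
Qed.

Lemma norm_bound_continuous (r t : R) : {for t, continuous (norm_bound r)}.
Proof.
apply: (@continuous_comp _ _ _ _ (@Num.sqrt R)); last exact: sqrt_continuous.
have := is_derive_gronwall_exp growth_rate T0 t.
move=> /(is_derive_scalef (r ^+ 2 + growth_source r / growth_rate)) d1.
have := is_derive_addf (is_derive_addf d1 (is_derive_cst (2 * energy_bound r) t 1))
  (is_derive_cst (1 : R) t 1).
exact: is_derive_continuous.
Qed.

Section Flow.
Variables (l : R) (l0 : 0 < l) (l1 : l <= 1).
Local Notation F := (field_l X l0 l1).
Local Notation gl := (gl X l0).

(** The left side is the [gl] pairing of the gradient [fq] with [I fq], and [I] is skew. *)
Lemma field_energy (t : R) u : d (F t u) u + t^-1 * h (N u) (F t u) = 0.
Proof.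
rewrite (sipC d) -(fq_gl X l0 l1) /field_l glE es_hIself es_dIself; ring.
Qed.

Lemma gl_field_self (t : R) u : gl (F t u) u = - (t^-1 * h (N u) (I u)).
Proof. by rewrite field_gl es_dIself add0r. Qed.

(** Both a priori bounds hold for the truncated equation itself: its field is the original one times
    a factor in [0, 1], which keeps the energy identity and does not worsen the growth estimate. The
    solution therefore stays where the cut-off is 1, without a continuation argument. *)
Lemma solution_exists r u0 : nrm u0 <= r -> exists u : R -> V,
  [/\ u T0 = u0, (forall t, T0 <= t -> vderiv g u t (F t (u t))) &
      forall t, T0 <= t -> nrm (u t) <= norm_bound r t].
Proof.
move=> ur; have r0 := le_trans (sipn_ge0 g u0) ur.
have [u uT du] := @truncated_solution _ _ X l l0 l1 T0 T00 (norm_bound r)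
  (fun t => norm_bound_ge1 t r0) (fun t => @norm_bound_continuous r t) u0.
pose c t := cutoff X (norm_bound r) t (u t).
have cE t : cutoff X (norm_bound r) t (u t) = c t by [].
have c01 t : 0 <= c t <= 1 by rewrite clip_ge0 clip_le1.
have uE t : T0 <= t -> es_energy t (u t) <= energy_bound r.
  move=> Tt; apply: le_trans (es_energy_le ur); rewrite -uT.
  apply: (@le_derive_nincr _ (fun s => es_energy s (u s))
    (fun s => - ((4 * s ^+ 2)^-1 * P (u s)))) => //.
    move=> s /andP[Ts _]; have := is_derive_energy (lt_le_trans T00 Ts) (du s Ts).
    move=> D; apply: (is_derive_eq D); rewrite sipZl sipZr mulrCA -mulrDr field_energy; ring.
  move=> s /andP[Ts _]; rewrite oppr_le0 mulr_ge0 ?es_P_ge0//.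
  by rewrite invr_ge0 mulr_ge0 ?sqr_ge0.
have ub t : T0 <= t -> nrm (u t) <= norm_bound r t.
  move=> Tt; have t0 := lt_le_trans T00 Tt.
  (* The growth is followed in [gl] and not in [h]: there the field contributes [d u (I u)], which
     vanishes, and only the nonlinear term is left. *)
  have := @gronwall _ (fun s => gl (u s) (u s)) (fun s => 2 * gl (c s *: F s (u s)) (u s))
    growth_rate (growth_source r) T0 t growth_rate_gt0 Tt.
  have H1 s : T0 <= s <= t -> is_derive s 1 (fun s => gl (u s) (u s))
     (2 * gl (c s *: F s (u s)) (u s)).
    move=> /andP[Ts _]; apply: (is_derive_sip_sqr (g := g) (C := 1)).
      by move=> x; rewrite mul1r gl_le.
    exact: du.
  have H2 s : T0 <= s <= t -> 2 * gl (c s *: F s (u s)) (u s) <=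
     growth_rate * gl (u s) (u s) + growth_source r.
    move=> /andP[Ts _]; have s0 := lt_le_trans T00 Ts.
    rewrite sipZl gl_field_self.
    apply: (@le_trans _ _ (2 * `|h (N (u s)) (I (u s))| * s^-1)).
      have := c01 s; have := ler_norm (h (N (u s)) (I (u s))).
      have := ler_norm (- h (N (u s)) (I (u s))); rewrite normrN => h1 h2 /andP[h3 h4].
      rewrite mulrN -mulrN -mulrA ler_wpM2l// mulrN -mulrN.
      rewrite (mulrC s^-1) -mulNr mulrA ler_wpM2r ?invr_ge0 ?(ltW s0)//; nra.
    have sV : 0 < s^-1 by rewrite invr_gt0.
    apply: le_trans (es_NI X (u s) sV) _; rewrite addrC; apply: lerD.
      rewrite /growth_rate mulrDl mul1r; apply: ler_wpDr; first exact: sip_ge0.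
      rewrite ler_wpM2l ?es_A_ge0// glE lerDl mulr_ge0 ?sip_ge0//; exact: ltW.
    have Es := uE s Ts; have dp := sip_ge0 d (u s).
    have PE : P (u s) <= 4 * s * energy_bound r.
      have : (4 * s)^-1 * P (u s) <= energy_bound r.
        by move: Es; rewrite /es_energy; lra.
      by rewrite mulrC ler_pdivrMr ?mulr_gt0// mulrC.
    apply: (@le_trans _ _ (4 * s * energy_bound r * s^-1 ^+ 2)).
      by rewrite ler_wpM2r// exprn_ge0// ltW.
    have -> : 4 * s * energy_bound r * s^-1 ^+ 2 = 4 * energy_bound r / s.
      by field; rewrite gt_eqF.
    rewrite /growth_source ler_wpM2l ?mulr_ge0 ?energy_bound_ge0//.
    by rewrite lef_pV2 ?posrE.
  move=> /(_ H1 H2) H.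
  apply: sipn_le; first exact: le_trans ler01 (norm_bound_ge1 t r0).
  rewrite sqr_sqrtr; last exact: le_trans ler01 (radicand_ge1 t r0).
  have hu : h (u t) (u t) <= gl (u t) (u t).
    by rewrite glE lerDl mulr_ge0 ?sip_ge0// ltW.
  have Et : d (u t) (u t) <= 2 * energy_bound r.
    have := uE t Tt; rewrite /es_energy.
    have : 0 <= (4 * t)^-1 * P (u t).
      by rewrite mulr_ge0 ?es_P_ge0// invr_ge0 mulr_ge0// ltW.
    lra.
  have u0r : gl u0 u0 <= r ^+ 2.
    by apply: le_sipn => //; exact: le_trans (gl_le X l0 l1 u0) ur.
  have KC : 0 <= growth_source r / growth_rate.
    by rewrite divr_ge0 ?growth_source_ge0// ltW// growth_rate_gt0.
  rewrite es_gE.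
  have : (gl (u T0) (u T0) + growth_source r / growth_rate) * expR (growth_rate * (t - T0)) <=
     (r ^+ 2 + growth_source r / growth_rate) * expR (growth_rate * (t - T0)).
    by rewrite ler_wpM2r ?expR_ge0// lerD2r uT.
  lra.
exists u; split => // t Tt; have := du t Tt; rewrite cutoff1 ?scale1r ?ub// => s.
exact: norm_bound_ge1.
Qed.

Lemma is_derive_flow_energy u t : 0 < t -> vderiv g u t (F t (u t)) ->
  is_derive t 1 (fun s => es_energy s (u s)) (- ((4 * t ^+ 2)^-1 * P (u t))).
Proof.
move=> t0 du; have := is_derive_energy t0 du.
by move=> D; apply: (is_derive_eq D); rewrite field_energy sub0r.
Qed.

End Flow.
End Energy.

(** * Uniform estimates *)

Section Estimates.
Context {R : realType} {V : lmodType R} (X : energy_space V).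
Local Notation h := (es_h X).
Local Notation d := (es_d X).
Local Notation g := (es_g X).
Local Notation I := (es_I X).
Local Notation N := (es_N X).
Local Notation K := (es_K X).
Local Notation nrm := (sipn g).
Variables (T0 : R) (T00 : 0 < T0).

Definition flow_on (l : R) (l0 : 0 < l) (l1 : l <= 1) (T M : R) (u : R -> V) :=
  forall t, T0 <= t <= T -> vderiv g u t (field_l X l0 l1 t (u t)) /\ nrm (u t) <= M.

Definition stability_rate (M : R) := 2 * K M / T0 + 1.

Lemma stability_rate_gt0 M : 0 < stability_rate M.
Proof. by rewrite ltr_wpDl// divr_ge0 ?mulr_ge0 ?es_K_ge0// ltW. Qed.

(** For equal parameters the linear part drops out by [es_gIJ_sub_self], so the rate depends on [M]
    and [T0] but not on [l]. The square root of the exponential is not taken, the exponential being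
    at least 1. *)
Lemma flow_stable l l0 l1 T M u w (t : R) : @flow_on l l0 l1 T M u -> @flow_on l l0 l1 T M w ->
  T0 <= t <= T ->
  nrm (u t - w t) <= nrm (u T0 - w T0) * expR (stability_rate M * (T - T0)).
Proof.
move=> fu fw /andP[Tt tT].
pose F s := field_l X l0 l1 s.
pose z s := u s - w s.
have inT s : T0 <= s <= t -> T0 <= s <= T.
  by move=> /andP[-> /= st]; exact: le_trans tT.
have H := @gronwall _ (fun s => g (z s) (z s))
  (fun s => 2 * g (F s (u s) - F s (w s)) (z s)) (stability_rate M) 0 T0 t
  (stability_rate_gt0 M) Tt.
have H1 s : T0 <= s <= t -> is_derive s 1 (fun s => g (z s) (z s))
    (2 * g (F s (u s) - F s (w s)) (z s)).
  move=> /inT sT; apply: (is_derive_sip_sqr (g := g) (C := 1)); first exact: self_bound.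
  exact: vderivB (fu s sT).1 (fw s sT).1.
have H2 s : T0 <= s <= t -> 2 * g (F s (u s) - F s (w s)) (z s) <=
    stability_rate M * g (z s) (z s) + 0.
  move=> /inT sT; have [_ uM] := fu s sT; have [_ wM] := fw s sT.
  case/andP: sT => Ts _; have s0 := lt_le_trans T00 Ts.
  rewrite /F /field_l -es_IB fq_sub es_ID !es_IZ sipDl !sipZl -/(z s) es_gIJ_sub_self mulr0 add0r.
  rewrite addr0; set A := g _ _.
  have HA : `|A| <= K M * g (z s) (z s).
    apply: le_trans (sip_CS _ _ _) _; rewrite sipn_gI -sqr_sipn expr2 mulrA.
    rewrite ler_wpM2r ?sipn_ge0//; apply: le_trans (sipn_gJ _ _ _ _) _.
    exact: es_N_lipg.
  have z0 := sip_ge0 g (z s); have k0 := es_K_ge0 X M.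
  have sA : s^-1 * A <= T0^-1 * (K M * g (z s) (z s)).
    apply: le_trans (ler_norm _) _; rewrite normrM gtr0_norm ?invr_gt0//.
    by apply: ler_pM => //; rewrite ?invr_ge0 ?(ltW s0)// lef_pV2.
  rewrite /stability_rate; move: sA z0; lra.
have := H H1 H2; rewrite mul0r !addr0 => {}H.
have e1 : 1 <= expR (stability_rate M * (T - T0)).
  rewrite -expR0 ler_expR mulr_ge0 ?(ltW (stability_rate_gt0 _))// subr_ge0.
  exact: le_trans Tt tT.
apply: sipn_le; first by rewrite mulr_ge0 ?sipn_ge0// (le_trans ler01).
rewrite exprMn sqr_sipn; apply: le_trans H _.
rewrite ler_wpM2l ?sip_ge0// expr2; apply: le_trans (_ : _ <= expR (stability_rate M * (T - T0))) _.
  by rewrite ler_expR ler_wpM2l ?lerD2r// ltW// stability_rate_gt0.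
by rewrite ler_peMr// (le_trans ler01).
Qed.

(** Weak form of: u_xx is in L^2 with norm at most [c]. *)
Definition regular (c : R) u := forall phi, `|d u phi| <= c * sipn h phi.

Section Speed.
Variables (M c : R) (c0 : 0 <= c) (M0 : 0 <= M).

Let c4 := c + K M * M / T0.

Let KMM0 : 0 <= K M * M / T0.
Proof. by rewrite divr_ge0 ?mulr_ge0 ?es_K_ge0// ltW. Qed.

(** As [d z (I z) = 0] for [z = u - u T0], the linear part of the field acts on [z] through the
    datum, whose regularity bounds it. Gronwall is run with rate [1 / (t - T0)], which makes the
    exponent 1 and the factor [expR 1]. *)
Lemma flow_initial_speed l l0 l1 (T : R) u (t : R) : @flow_on l l0 l1 T M u -> regular c (u T0) ->
  T0 < t <= T ->
  gl X l0 (u t - u T0) (u t - u T0) <= c4 ^+ 2 * (t - T0) ^+ 2 * expR 1.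
Proof.
move=> fu ru /andP[Tt tT].
pose F s := field_l X l0 l1 s; pose G := gl X l0.
pose r := t - T0; have r0 : 0 < r by rewrite subr_gt0.
have inT s : T0 <= s <= t -> T0 <= s <= T.
  by move=> /andP[-> /= st]; exact: le_trans tT.
pose z s := u s - u T0.
have H := @gronwall _ (fun s => G (z s) (z s)) (fun s => 2 * G (F s (u s)) (z s))
  r^-1 (c4 ^+ 2 * r) T0 t _ (ltW Tt).
have H1 s : T0 <= s <= t -> is_derive s 1 (fun s => G (z s) (z s))
    (2 * G (F s (u s)) (z s)).
  move=> /inT sT; apply: (is_derive_sip_sqr (g := g) (C := 1)).
    by move=> x; rewrite mul1r gl_le.
  by rewrite -[F _ _]subr0; exact: vderivB (fu s sT).1 (vderiv_cst g (u T0) s).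
have H2 s : T0 <= s <= t -> 2 * G (F s (u s)) (z s) <=
    r^-1 * G (z s) (z s) + c4 ^+ 2 * r.
  move=> /inT sT; have [_ uM] := fu s sT.
  case/andP: sT => Ts _; have s0 := lt_le_trans T00 Ts.
  have : G (F s (u s)) (z s) <= c4 * sipn G (z s).
    rewrite /G /F field_gl.
    have -> : d (u s) (I (z s)) = d (u T0) (I (z s)).
      by apply/eqP; rewrite -subr_eq0 -sipBl es_dIself.
    apply: (@le_trans _ _ (c4 * sipn h (z s))); last first.
      by rewrite ler_wpM2l ?sipn_h_gl// addr_ge0.
    rewrite /c4 mulrDl opprD; apply: lerD.
      apply: le_trans (_ : `|d (u T0) (I (z s))| <= _); first by rewrite -normrN ler_norm.
      by rewrite -(sipn_hI X (z s)).
    apply: le_trans (ler_norm _) _; rewrite normrN normrM gtr0_norm ?invr_gt0//.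
    rewrite -!mulrA mulrCA mulrA mulrC [leRHS]mulrC -!mulrA.
    have hN : `|h (N (u s)) (I (z s))| <= K M * M * sipn h (z s).
      apply: le_trans (sip_CS _ _ _) _; rewrite sipn_hI ler_wpM2r ?sipn_ge0//.
      exact: sipn_N_le.
    have sT : s^-1 <= T0^-1 by rewrite lef_pV2.
    have : `|h (N (u s)) (I (z s))| * s^-1 <= (K M * M * sipn h (z s)) * T0^-1.
      by apply: ler_pM; rewrite ?invr_ge0 ?(ltW s0).
    lra.
  have := sqr_sipn G (z s); set Z := sipn G _ => ZE.
  have : 2 * (c4 * Z) <= r^-1 * Z ^+ 2 + c4 ^+ 2 * r.
    have -> : r^-1 * Z ^+ 2 + c4 ^+ 2 * r = 2 * (c4 * Z) + r^-1 * (Z - c4 * r) ^+ 2.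
      by field; rewrite gt_eqF.
    by rewrite lerDl mulr_ge0 ?invr_ge0 ?(ltW r0)// sqr_ge0.
  rewrite ZE; lra.
have := H _ H1 H2; rewrite invr_gt0 => /(_ r0).
rewrite /z subrr sip0l add0r invrK mulVf ?gt_eqF// -/r.
have -> : c4 ^+ 2 * r * r = c4 ^+ 2 * r ^+ 2 by ring.
have := mulr_ge0 (sqr_ge0 c4) (sqr_ge0 r); rewrite /G; lra.
Qed.

Let k1 := K M / T0.
Let k2 := K M * M / T0 ^+ 2.

(** [c4] bounds the increment near [T0], [k2] the effect of the explicit coefficient 1/t, and
    [2 * k1 + 1] is the growth rate of the difference of two translates. *)
Definition speed_bound (T : R) :=
  Num.sqrt ((c4 ^+ 2 * expR 1 + k2 ^+ 2) * expR ((2 * k1 + 1) * (T - T0))).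

(** Compares the flow with its translate by [s], in place of differentiating the equation in time.
    The principal part cancels; the translate up to time [T + 1] explains the interval of [fu]. *)
Lemma flow_difference l l0 l1 (T : R) u (t s : R) : @flow_on l l0 l1 (T + 1) M u -> regular c (u T0) ->
  T0 <= t <= T -> 0 < s <= 1 ->
  gl X l0 (u (t + s) - u t) (u (t + s) - u t) <= s ^+ 2 * speed_bound T ^+ 2.
Proof.
move=> fu ru /andP[Tt tT] /andP[s0 s1].
pose F x := field_l X l0 l1 x; pose G := gl X l0.
have k10 : 0 <= k1 by rewrite divr_ge0 ?es_K_ge0// ltW.
have k20 : 0 <= k2 by rewrite divr_ge0 ?sqr_ge0 ?mulr_ge0 ?es_K_ge0.
have C0 : 0 < 2 * k1 + 1 by rewrite ltr_wpDl// mulr_ge0.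
have inT x : T0 <= x <= t -> (T0 <= x <= T + 1) /\ (T0 <= x + s <= T + 1).
  by move=> /andP[Tx xt]; split; lra.
pose z x := u (x + s) - u x.
have H := @gronwall _ (fun x => G (z x) (z x))
  (fun x => 2 * G (F (x + s) (u (x + s)) - F x (u x)) (z x))
  (2 * k1 + 1) (s ^+ 2 * k2 ^+ 2) T0 t C0 Tt.
have H1 x : T0 <= x <= t -> is_derive x 1 (fun x => G (z x) (z x))
    (2 * G (F (x + s) (u (x + s)) - F x (u x)) (z x)).
  move=> /inT[x1 x2]; apply: (is_derive_sip_sqr (g := g) (C := 1)).
    by move=> y; rewrite mul1r gl_le.
  by apply: vderivB (fu x x1).1; apply: vderiv_shift; exact: (fu _ x2).1.
have H2 x : T0 <= x <= t -> 2 * G (F (x + s) (u (x + s)) - F x (u x)) (z x) <=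
    (2 * k1 + 1) * G (z x) (z x) + s ^+ 2 * k2 ^+ 2.
  move=> /inT[x1 x2]; have [_ aM] := fu _ x1; have [_ bM] := fu _ x2.
  case/andP: x1 => Tx _; have x0 := lt_le_trans T00 Tx.
  have Txs : T0 <= x + s by rewrite ler_wpDr// ltW.
  have xs0 := lt_le_trans T00 Txs.
  have E : G (F (x + s) (u (x + s)) - F x (u x)) (z x) =
     - ((x + s)^-1 * h (N (u (x + s)) - N (u x)) (I (z x))
       - (x^-1 - (x + s)^-1) * h (N (u x)) (I (z x))).
    rewrite sipBl /G /F !field_gl.
    have : d (z x) (I (z x)) = 0 by exact: es_dIself.
    rewrite {1}/z sipBl sipBl; lra.
  have := sqr_sipn h (z x); set Z := sipn h _ => ZE.
  have Z0 : 0 <= Z by exact: sipn_ge0.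
  have E1 : `|(x + s)^-1 * h (N (u (x + s)) - N (u x)) (I (z x))| <= k1 * Z ^+ 2.
    rewrite normrM gtr0_norm ?invr_gt0//.
    have -> : k1 * Z ^+ 2 = T0^-1 * (K M * Z * Z) by rewrite /k1; ring.
    apply: ler_pM => //; rewrite ?invr_ge0 ?(ltW xs0)//; first by rewrite lef_pV2.
    apply: le_trans (sip_CS _ _ _) _; rewrite sipn_hI ler_wpM2r//.
    exact: es_N_liph.
  have E2 : `|(x^-1 - (x + s)^-1) * h (N (u x)) (I (z x))| <= s * k2 * Z.
    rewrite normrM.
    have -> : x^-1 - (x + s)^-1 = s * (x * (x + s))^-1.
      by field; rewrite !gt_eqF.
    rewrite normrM (gtr0_norm s0) gtr0_norm ?invr_gt0 ?mulr_gt0//.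
    rewrite -[leLHS]mulrA -[leRHS]mulrA ler_pM2l//.
    have -> : k2 * Z = (T0 ^+ 2)^-1 * (K M * M * Z) by rewrite /k2; ring.
    apply: ler_pM => //; first by rewrite invr_ge0 mulr_ge0// ltW.
      by rewrite lef_pV2 ?posrE ?mulr_gt0 ?exprn_gt0// expr2 ler_pM// ltW.
    apply: le_trans (sip_CS _ _ _) _; rewrite sipn_hI ler_wpM2r//.
    exact: sipn_N_le.
  have ZG : Z ^+ 2 <= G (z x) (z x).
    by rewrite ZE /G glE lerDl mulr_ge0 ?sip_ge0// ltW.
  have E3 : 2 * (s * k2 * Z) <= Z ^+ 2 + s ^+ 2 * k2 ^+ 2.
    have := sqr_ge0 (Z - s * k2); lra.
  have : (2 * k1 + 1) * Z ^+ 2 <= (2 * k1 + 1) * G (z x) (z x) by rewrite ler_pM2l.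
  move: E1 E2; rewrite !ler_norml => /andP[E1 _] /andP[_ E2].
  rewrite E; lra.
have {H H1 H2} := H H1 H2.
have T0s : G (z T0) (z T0) <= c4 ^+ 2 * s ^+ 2 * expR 1.
  have := @flow_initial_speed _ l0 l1 (T + 1) u (T0 + s) fu ru.
  rewrite (addrC T0 s) addrK (addrC s) ltrDl s0 /=; apply; lra.
move=> H; rewrite sqr_sqrtr; last first.
  apply: mulr_ge0; last exact: expR_ge0.
  apply: addr_ge0; last exact: sqr_ge0.
  by apply: mulr_ge0; [exact: sqr_ge0|exact: expR_ge0].
set C := 2 * k1 + 1 in C0 H *.
have C1 : 1 <= C by rewrite /C; lra.
have q0 : 0 <= s ^+ 2 * k2 ^+ 2 by rewrite mulr_ge0 ?sqr_ge0.
have qC : 0 <= s ^+ 2 * k2 ^+ 2 / C by rewrite divr_ge0// ltW.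
have qC1 : s ^+ 2 * k2 ^+ 2 / C <= s ^+ 2 * k2 ^+ 2 by rewrite ler_pdivrMr// ler_peMr.
have : (G (z T0) (z T0) + s ^+ 2 * k2 ^+ 2 / C) * expR (C * (t - T0)) <=
   (c4 ^+ 2 * s ^+ 2 * expR 1 + s ^+ 2 * k2 ^+ 2) * expR (C * (T - T0)).
  apply: ler_pM; rewrite ?expR_ge0//.
  - by rewrite addr_ge0 ?sip_ge0.
  - by rewrite lerD.
  - by rewrite ler_expR ler_wpM2l ?lerD2r// ltW.
have -> : s ^+ 2 * ((c4 ^+ 2 * expR 1 + k2 ^+ 2) * expR (C * (T - T0))) =
  (c4 ^+ 2 * s ^+ 2 * expR 1 + s ^+ 2 * k2 ^+ 2) * expR (C * (T - T0)) by ring.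
by rewrite -/(z t) -/G; lra.
Qed.

(** Difference quotients with step tending to 0: the remainder in the definition of [vderiv] is
    [e * s], and [gl] is dominated by [g]. *)
Lemma flow_speed l l0 l1 (T : R) u (t : R) : @flow_on l l0 l1 (T + 1) M u -> regular c (u T0) ->
  T0 <= t <= T -> sipn (gl X l0) (field_l X l0 l1 t (u t)) <= speed_bound T.
Proof.
move=> fu ru tT; set F := field_l _ _ _ _ _; set G := gl X l0.
apply/ler_addgt0Pr => e e0.
have [du _] : vderiv g u t F /\ nrm (u t) <= M by apply: fu; move: tT; lra.
have [r r0 Hr] := du e e0.
pose s := Num.min (r / 2) 1.
have s0 : 0 < s by rewrite lt_min ltr01 andbT divr_gt0.
have s1 : s <= 1 by rewrite ge_min lexx orbT.
have sr : s < r by rewrite /s gt_min; apply/orP; left; lra.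
have := flow_difference fu ru tT _; move=> /(_ s); rewrite s0 s1 => /(_ isT).
rewrite -exprMn => H1.
have {}H1 : sipn G (u (t + s) - u t) <= s * speed_bound T.
  by apply: sipn_le; rewrite // mulr_ge0 ?sqrtr_ge0// ltW.
have := Hr (t + s); rewrite (addrC t s) addrK gtr0_norm// => /(_ sr).
move=> /(le_trans (gl_le X l0 l1 _)) H2.
rewrite -(ler_pM2l s0) mulrDr.
have -> : s * sipn G F = sipn G (s *: F) by rewrite sipnZ gtr0_norm.
have -> : s *: F = (u (s + t) - u t) - (u (s + t) - u t - s *: F).
  by rewrite subKr.
apply: le_trans (sipn_sub _ _ _) _; apply: lerD.
  by rewrite (addrC s t).
by rewrite mulrC.
Qed.

End Speed.
End Estimates.

(** * Convergence as the regularization parameter tends to zero *)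

Section Cauchy.
Context {R : realType} {V : lmodType R} (X : energy_space V).
Local Notation h := (es_h X).
Local Notation d := (es_d X).
Local Notation g := (es_g X).
Local Notation I := (es_I X).
Local Notation N := (es_N X).
Local Notation K := (es_K X).
Local Notation nrm := (sipn g).
Variables (T0 : R) (T00 : 0 < T0).

Section TwoFlows.
Variables (l m : R) (l0 : 0 < l) (l1 : l <= 1) (m0 : 0 < m) (m1 : m <= 1).
Variables (T M S : R) (M0 : 0 <= M) (S0 : 0 <= S) (u w : R -> V).
Hypothesis fu : flow_on X T0 l0 l1 T M u.
Hypothesis fw : flow_on X T0 m0 m1 T M w.
Hypothesis su : forall t, T0 <= t <= T -> sipn (gl X l0) (field_l X l0 l1 t (u t)) <= S.
Hypothesis sw : forall t, T0 <= t <= T -> sipn (gl X m0) (field_l X m0 m1 t (w t)) <= S.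

Let sq := Num.sqrt l + Num.sqrt m.

Let sq0 : 0 <= sq. Proof. by rewrite addr_ge0 ?sqrtr_ge0. Qed.

(** Passing from [gl] to [h] costs [k * d F x]. One factor sqrt k is absorbed by the bound [S] of
    the speed in [gl], the other one remains and makes the error small. *)
Lemma field_h_lag k (k0 : 0 < k) (k1 : k <= 1) (t : R) v x :
  sipn (gl X k0) (field_l X k0 k1 t v) <= S -> nrm x <= 2 * M ->
  `|h (field_l X k0 k1 t v) x + (d v (I x) + t^-1 * h (N v) (I x))| <=
    Num.sqrt k * (2 * S * M).
Proof.
move=> vS xM; have := field_gl X k0 k1 t v x; rewrite glE => E.
have -> : h (field_l X k0 k1 t v) x + (d v (I x) + t^-1 * h (N v) (I x)) =
  - (k * d (field_l X k0 k1 t v) x) by lra.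
rewrite normrN normrM gtr0_norm//; set A := `|_|.
have -> : k * A = Num.sqrt k * (Num.sqrt k * A).
  by rewrite mulrA -expr2 sqr_sqrtr ?(ltW k0).
rewrite ler_wpM2l ?sqrtr_ge0//.
apply: (@le_trans _ _ (Num.sqrt k * (sipn d (field_l X k0 k1 t v) * sipn d x))).
  by rewrite ler_wpM2l ?sqrtr_ge0// /A sip_CS.
rewrite mulrA [leRHS](_ : _ = S * (2 * M)); last by ring.
apply: ler_pM; rewrite ?mulr_ge0 ?sipn_ge0 ?sqrtr_ge0//.
- exact: le_trans (sipn_d_gl X k0 _) vS.
- exact: le_trans (sipn_d_le X _) xM.
Qed.

(** The principal parts cancel since [d z (I z) = 0], the nonlinearity is Lipschitz in L^2, and the
    two lags, each doubled, form the source [4 * S * M * sq]. *)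
Lemma flow_h_close (t : R) : u T0 = w T0 -> T0 <= t <= T ->
  h (u t - w t) (u t - w t) <=
    4 * S * M * expR (stability_rate X T0 M * (T - T0)) * sq.
Proof.
move=> uw /andP[Tt tT].
pose z s := u s - w s.
have inT s : T0 <= s <= t -> T0 <= s <= T.
  by move=> /andP[-> /= st]; exact: le_trans tT.
have C0 := stability_rate_gt0 X T00 M.
have H := @gronwall _ (fun s => h (z s) (z s))
  (fun s => 2 * h (field_l X l0 l1 s (u s) - field_l X m0 m1 s (w s)) (z s))
  (stability_rate X T0 M) (4 * S * M * sq) T0 t C0 Tt.
have H1 s : T0 <= s <= t -> is_derive s 1 (fun s => h (z s) (z s))
    (2 * h (field_l X l0 l1 s (u s) - field_l X m0 m1 s (w s)) (z s)).
  move=> /inT sT; apply: (is_derive_sip_sqr (g := g) (C := 1)).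
    by move=> x; rewrite mul1r sipn_h_le.
  exact: vderivB (fu sT).1 (fw sT).1.
have H2 s : T0 <= s <= t ->
    2 * h (field_l X l0 l1 s (u s) - field_l X m0 m1 s (w s)) (z s) <=
    stability_rate X T0 M * h (z s) (z s) + 4 * S * M * sq.
  move=> /inT sT; have [_ uM] := fu sT; have [_ wM] := fw sT.
  have zM : nrm (z s) <= 2 * M by apply: le_trans (sipn_sub _ _ _) _; lra.
  have := field_h_lag (su sT) zM; have := field_h_lag (sw sT) zM.
  case/andP: sT => Ts _; have s0 := lt_le_trans T00 Ts.
  rewrite sipBl !ler_norml => /andP[A1 _] /andP[_ A2].
  have D0 : d (u s) (I (z s)) - d (w s) (I (z s)) = 0 by rewrite -sipBl es_dIself.
  have : `|s^-1 * h (N (u s) - N (w s)) (I (z s))| <= K M / T0 * h (z s) (z s).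
    rewrite normrM gtr0_norm ?invr_gt0//.
    rewrite -sqr_sipn (_ : K M / T0 * _ = T0^-1 * (K M * sipn h (z s) * sipn h (z s))); last by ring.
    apply: ler_pM => //; rewrite ?invr_ge0 ?(ltW s0)//; first by rewrite lef_pV2.
    apply: le_trans (sip_CS _ _ _) _; rewrite sipn_hI ler_wpM2r ?sipn_ge0//.
    exact: es_N_liph.
  have hz := sip_ge0 h (z s).
  rewrite sipBl ler_norml => /andP[A3 _].
  rewrite /stability_rate /sq; move: A1 A2 A3 hz D0; lra.
have := H H1 H2; rewrite /z uw subrr sip0l add0r.
set q := 4 * S * M * sq; set E := expR _ => {}H.
have q0 : 0 <= q by rewrite /q !mulr_ge0.
have C1 : 1 <= stability_rate X T0 M.
  by rewrite /stability_rate lerDr divr_ge0 ?mulr_ge0 ?es_K_ge0// ltW.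
have qC : q / stability_rate X T0 M <= q by rewrite ler_pdivrMr// ler_peMr.
have qC0 : 0 <= q / stability_rate X T0 M by rewrite divr_ge0// ltW.
have EE : E <= expR (stability_rate X T0 M * (T - T0)).
  by rewrite ler_expR ler_wpM2l ?lerD2r// ltW.
have : q / stability_rate X T0 M * E <= q * expR (stability_rate X T0 M * (T - T0)).
  by apply: ler_pM; rewrite ?expR_ge0.
rewrite (_ : 4 * S * M * _ * sq = q * expR (stability_rate X T0 M * (T - T0))); last by rewrite /q; ring.
lra.
Qed.

Lemma J_flow_h_close (t : R) : T0 <= t <= T ->
  sipn h (J X l0 l1 (u t) - J X m0 m1 (w t)) <= sq * M + sipn h (u t - w t).
Proof.
move=> tT; have [_ uM] := fu tT; have [_ wM] := fw tT.
apply: le_trans (sipn_split _ (u t) _ _) _.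
apply: le_trans (lerD (lexx _) (sipn_split _ (w t) _ _)) _.
rewrite sipnB.
have a1 : sipn h (u t - J X l0 l1 (u t)) <= Num.sqrt l * M.
  apply: le_trans (J_err _ _ _ _) _; rewrite ler_wpM2l ?sqrtr_ge0//.
  exact: le_trans (sipn_d_le X _) uM.
have a2 : sipn h (w t - J X m0 m1 (w t)) <= Num.sqrt m * M.
  apply: le_trans (J_err _ _ _ _) _; rewrite ler_wpM2l ?sqrtr_ge0//.
  exact: le_trans (sipn_d_le X _) wM.
rewrite /sq; lra.
Qed.

(** By [Jd], [d (J v)] is the L^2 pairing with [l^-1 (v - J v)], which is [fq] minus the nonlinear
    term; and [fq] has the L^2 norm of the field. So the second derivative of [J v] is bounded in
    L^2 uniformly in [k]. *)
Lemma d_J_bounded k (k0 : 0 < k) (k1 : k <= 1) (t : R) v x : T0 <= t -> nrm v <= M ->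
  sipn (gl X k0) (field_l X k0 k1 t v) <= S ->
  `|d (J X k0 k1 v) x| <= (S + K M * M / T0) * sipn h x.
Proof.
move=> Tt vM vS; have t0 := lt_le_trans T00 Tt.
have -> : d (J X k0 k1 v) x = h (fq X k0 k1 t v - t^-1 *: J X k0 k1 (N v)) x.
  rewrite /fq addrK sipZl sipBl -Jd// mulrA mulVf ?mul1r// gt_eqF//.
apply: le_trans (sip_CS _ _ _) _; rewrite ler_wpM2r ?sipn_ge0//.
apply: le_trans (sipn_sub _ _ _) _; apply: lerD.
  by rewrite -(sipn_hI X); apply: le_trans (sipn_h_gl X k0 _) vS.
rewrite sipnZ gtr0_norm ?invr_gt0// mulrC; apply: ler_pM; rewrite ?sipn_ge0 ?invr_ge0 ?(ltW t0)//.
  apply: le_trans (sipn_hJ _ _ _ _) _; exact: sipn_N_le.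
by rewrite lef_pV2.
Qed.

(** Interpolation: with [z = J u - J w], the quantity [d z z] is linear in the second derivative of
    [z], which is bounded, and in the L^2 norm [q] of [z]. *)
Lemma J_flow_close (t q : R) : T0 <= t <= T ->
  q = sipn h (J X l0 l1 (u t) - J X m0 m1 (w t)) ->
  nrm (J X l0 l1 (u t) - J X m0 m1 (w t)) ^+ 2 <=
    q ^+ 2 + 2 * (S + K M * M / T0) * q.
Proof.
move=> tT qE; rewrite sqr_sipn es_gE -sqr_sipn -qE lerD2l.
have [_ uM] := fu tT; have [_ wM] := fw tT.
case/andP: (tT) => Tt _.
have := d_J_bounded (J X l0 l1 (u t) - J X m0 m1 (w t)) Tt uM (su tT).
have := d_J_bounded (J X l0 l1 (u t) - J X m0 m1 (w t)) Tt wM (sw tT).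
rewrite -qE sipBl !ler_norml => /andP[A1 _] /andP[_ A2]; lra.
Qed.

End TwoFlows.

Lemma regular_J_cauchy (T M c : R) : T0 <= T -> 0 <= M -> 0 <= c -> forall e, 0 < e ->
  exists2 r, 0 < r & forall l m (l0 : 0 < l) (l1 : l <= 1) (m0 : 0 < m) (m1 : m <= 1) u w,
    l < r -> m < r ->
    flow_on X T0 l0 l1 (T + 1) M u -> flow_on X T0 m0 m1 (T + 1) M w ->
    u T0 = w T0 -> regular X c (u T0) ->
    forall t, T0 <= t <= T -> nrm (J X l0 l1 (u t) - J X m0 m1 (w t)) <= e.
Proof.
move=> TT M0 c0 e e0.
pose S := speed_bound X T0 M c T.
have S0 : 0 <= S by exact: sqrtr_ge0.
pose C5 := 2 * (S + K M * M / T0).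
have C50 : 0 <= C5.
  by rewrite mulr_ge0// addr_ge0// divr_ge0 ?mulr_ge0 ?es_K_ge0// ltW.
pose C6 := 4 * S * M * expR (stability_rate X T0 M * (T - T0)).
have C60 : 0 <= C6 by rewrite !mulr_ge0 ?expR_ge0.
pose q0 := Num.min 1 (e ^+ 2 / (1 + C5)).
have q00 : 0 < q0 by rewrite lt_min ltr01 divr_gt0 ?exprn_gt0// ltr_pwDl.
have q01 : q0 <= 1 by rewrite ge_min lexx.
have q0e : (1 + C5) * q0 <= e ^+ 2.
  by rewrite mulrC -ler_pdivlMr ?ltr_pwDl// ge_min lexx orbT.
(* With sqrt l and sqrt m below [p], the first entry gives [2 p M <= q0 / 2] and the second
   [C6 * (2 p) <= (q0 / 2) ^+ 2]; hence [q <= q0]. As [q0 <= 1], the choice of [q0] then yields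
   [q ^+ 2 + C5 * q <= e ^+ 2]. *)
pose p := Num.min (q0 / (4 * (M + 1))) (q0 ^+ 2 / (8 * (C6 + 1))).
have p0 : 0 < p by rewrite lt_min !divr_gt0 ?exprn_gt0 ?mulr_gt0 ?ltr_wpDl.
exists (p ^+ 2); first by rewrite exprn_gt0.
move=> l m l0 l1 m0 m1 u w lp mp fu fw uw ru t tT.
have sub k (k0 : 0 < k) k1 v : flow_on X T0 k0 k1 (T + 1) M v -> flow_on X T0 k0 k1 T M v.
  by move=> fv x /andP[xa xb]; apply: fv; rewrite xa/=; lra.
have su x : T0 <= x <= T -> sipn (gl X l0) (field_l X l0 l1 x (u x)) <= S.
  exact: flow_speed.
have sw x : T0 <= x <= T -> sipn (gl X m0) (field_l X m0 m1 x (w x)) <= S.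
  by apply: flow_speed => //; rewrite -uw.
have sqr_lt k : 0 < k -> k < p ^+ 2 -> Num.sqrt k <= p.
  by move=> k0 kp; rewrite -[leRHS]gtr0_norm// -sqrtr_sqr; apply/ler_wsqrtr/ltW.
set q := sipn h (J X l0 l1 (u t) - J X m0 m1 (w t)).
have sq2 : Num.sqrt l + Num.sqrt m <= 2 * p.
  by have := sqr_lt _ l0 lp; have := sqr_lt _ m0 mp; lra.
have pa : 4 * (M + 1) * p <= q0.
  by rewrite mulrC -ler_pdivlMr ?mulr_gt0 ?ltr_wpDl// /p ge_min lexx.
have pb : 8 * (C6 + 1) * p <= q0 ^+ 2.
  by rewrite mulrC -ler_pdivlMr ?mulr_gt0 ?ltr_wpDl// /p ge_min lexx orbT.
have z1 : sipn h (u t - w t) <= q0 / 2.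
  apply: sipn_le; first by rewrite divr_ge0// ltW.
  apply: le_trans (flow_h_close M0 S0 (sub _ _ _ _ fu) (sub _ _ _ _ fw) su sw uw tT) _.
  rewrite -/C6; apply: (@le_trans _ _ (C6 * (2 * p))); first by rewrite ler_wpM2l.
  move: pb; lra.
have qq : q <= q0.
  apply: le_trans (J_flow_h_close (sub _ _ _ _ fu) (sub _ _ _ _ fw) tT) _.
  have : (Num.sqrt l + Num.sqrt m) * M <= 2 * p * M by rewrite ler_wpM2r.
  move: pa z1; lra.
rewrite -ler_sqr ?nnegrE ?sipn_ge0 ?(ltW e0)//.
apply: le_trans (J_flow_close (sub _ _ _ _ fu) (sub _ _ _ _ fw) su sw tT (erefl q)) _.
rewrite -/C5; apply: le_trans q0e.
have q_0 : 0 <= q by exact: sipn_ge0.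
rewrite mulrDl mul1r; apply: lerD; last by rewrite ler_wpM2l.
by apply: le_trans (qq); rewrite expr2 ler_piMl// (le_trans qq).
Qed.

(** The regular vectors are the range of [J] with [l = 1], for which [gl] is [g]. A vector [k]
    orthogonal to the range satisfies [h k k = g (J k) k = 0]. *)
Lemma regular_dense u (e : R) : 0 < e -> exists c w,
  [/\ 0 <= c, regular X c w & nrm (w - u) < e].
Proof.
move=> e0; pose D w := exists x, w = J X ltr01 (lexx 1) x.
have gE x y : gl X ltr01 x y = g x y by rewrite glE es_gE mul1r.
have [||w [x ->] wu] := @dense_of_orthogonal _ _ g D (@es_complete _ _ X) _ _ u e e0.
- split; first by exists 0; rewrite J0.
  by move=> a _ _ [x ->] [y ->]; exists (a *: x + y); rewrite J_lin.
- move=> k kD; have := kD _ (ex_intro _ k erefl).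
  by rewrite sipC -gE J_gl => /(@es_def _ _ X) ->; rewrite sip0l.
exists (sipn h x + sipn h (J X ltr01 (lexx 1) x)), (J X ltr01 (lexx 1) x).
split => //; first by rewrite addr_ge0 ?sipn_ge0.
move=> phi; have := Jd X ltr01 (lexx 1) x phi; rewrite mul1r => ->.
rewrite -sipBl; apply: le_trans (sip_CS _ _ _) _.
by rewrite ler_wpM2r ?sipn_ge0// sipn_sub.
Qed.

End Cauchy.

(** * Solutions and uniqueness *)

Section Solution.
Context {R : realType} {V : lmodType R} (X : energy_space V).
Local Notation h := (es_h X).
Local Notation d := (es_d X).
Local Notation g := (es_g X).
Local Notation I := (es_I X).
Local Notation N := (es_N X).
Local Notation P := (es_P X).
Local Notation K := (es_K X).
Local Notation nrm := (sipn g).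
Variables (T0 : R) (T00 : 0 < T0).

(* [weak_rhs t u phi] is the value of d/dt <v, phi> at time [t] along the weak
   form of the equation. *)
Definition weak_rhs (t : R) u phi := - (d u (I phi) + t^-1 * h (N u) (I phi)).

Lemma vcont_bounded (v : R -> V) a b : a <= b -> (forall t, vcont g v t) ->
  exists2 M, 0 <= M & forall t, a <= t <= b -> nrm (v t) <= M.
Proof.
move=> ab cv; have [M HM] := compact_bound ab (fun t _ => vcont_nrm (cv t)).
by exists M => //; apply: le_trans (sipn_ge0 g _) (HM a _); rewrite lexx.
Qed.

Lemma vcont_N (v : R -> V) t : (forall t, vcont g v t) -> vcont g (fun s => N (v s)) t.
Proof.
move=> cv e e0.
have [M M0 HM] := @vcont_bounded v (t - 1) (t + 1) ltac:(lra) cv.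
have k0 : 0 < K M + 1 by rewrite ltr_wpDl ?es_K_ge0.
have [r r0 Hr] := cv t (e / (K M + 1)) ltac:(by rewrite divr_gt0).
exists (Num.min r 1); first by rewrite lt_min r0 ltr01.
move=> s; rewrite lt_min => /andP[/Hr sr]; rewrite ltr_norml => /andP[s1 s2].
apply: le_lt_trans (@es_N_lipg _ _ X M _ _ (HM _ _) (HM _ _)) _; [lra|lra|].
apply: le_lt_trans (_ : (K M + 1) * nrm (v s - v t) < e).
  by rewrite ler_wpM2r ?sipn_ge0// lerDl.
by rewrite mulrC -ltr_pdivlMr.
Qed.

Lemma continuous_inv (t : R) : 0 < t -> {for t, continuous (fun s : R => s^-1)}.
Proof. by move=> t0; apply: (@continuousV _ _ (fun s => s)) => //; rewrite gt_eqF. Qed.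

Lemma weak_rhs_continuous (v : R -> V) phi t : 0 < t -> (forall t, vcont g v t) ->
  {for t, continuous (fun s => weak_rhs s (v s) phi)}.
Proof.
move=> t0 cv.
have c1 : {for t, continuous (fun s => d (v s) (I phi))}.
  by apply: (vcont_sip_dom (g := g)) => // x; exact: sipn_d_le.
have c2 : {for t, continuous (fun s => h (N (v s)) (I phi))}.
  apply: (vcont_sip_dom (g := g) (u := fun s => N (v s))); last exact: vcont_N.
  by move=> x; exact: sipn_h_le.
have c3 := continuousM (continuous_inv t0) c2.
exact: continuousN (continuousD c1 c3).
Qed.

Section Limit.
Variable u0 : V.

Let ln (n : nat) : R := n.+1%:R^-1.
Let ln0 n : 0 < ln n. Proof. by rewrite invr_gt0. Qed.
Let ln1 n : ln n <= 1. Proof. by rewrite invf_le1 ?ler1n. Qed.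
Let Jn n := J X (ln0 n) (ln1 n).
Let Fn n := field_l X (ln0 n) (ln1 n).
(** The extra unit lets regular data near [u0] share the a priori bounds of [u0]. *)
Let r := nrm u0 + 1.
Let r0 : 0 <= r. Proof. by rewrite addr_ge0 ?sipn_ge0. Qed.

Let approx w0 (w : nat -> R -> V) := forall n, [/\ w n T0 = w0,
  (forall t, T0 <= t -> vderiv g (w n) t (Fn n t (w n t))) &
  forall t, T0 <= t -> nrm (w n t) <= norm_bound X T0 r t].

Let approx_ex w0 : nrm w0 <= r -> exists w, approx w0 w.
Proof.
move=> w0r; have /choice[w wP] := fun n => solution_exists T00 (ln0 n) (ln1 n) w0r.
by exists w.
Qed.

Let Mbound T : T0 <= T -> exists2 M, 0 <= M & forall w0 w, approx w0 w ->
  forall n, flow_on X T0 (ln0 n) (ln1 n) T M (w n).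
Proof.
move=> TT; have [M HM] := compact_bound TT (fun t _ => @norm_bound_continuous _ _ X T0 r t).
exists M.
  apply: le_trans (HM T0 _); last by rewrite lexx.
  exact: le_trans ler01 (norm_bound_ge1 X T00 T0 r0).
move=> w0 w aw n t tT; have [_ dw bw] := aw n; case/andP: (tT) => Tt _.
split; first exact: dw.
by apply: le_trans (bw _ Tt) _; exact: HM.
Qed.

(** Three errors of [e / 3]: two from replacing [u0] by regular data, uniform in [n] by
    [flow_stable] and because [J] contracts [g], and one from the regular case. *)
Let J_cauchy (un : nat -> R -> V) : approx u0 un -> forall T, T0 <= T -> forall e, 0 < e ->
  exists n0, forall m n, (n0 <= m)%N -> (n0 <= n)%N -> forall t, T0 <= t <= T ->
  nrm (Jn m (un m t) - Jn n (un n t)) <= e.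
Proof.
move=> aun T TT e e0.
have [M M0 HM] := @Mbound (T + 1) ltac:(by rewrite ler_wpDr).
pose E := expR (stability_rate X T0 M * (T + 1 - T0)).
have E0 : 0 < E by exact: expR_gt0.
have e30 : 0 < Num.min 1 (e / 3 / E) by rewrite lt_min ltr01 !divr_gt0.
have [c [w0 [c0 rw w0e]]] := regular_dense X u0 e30.
move: w0e; rewrite lt_min => /andP[w01 w0e].
have w0r : nrm w0 <= r.
  by rewrite -[w0](subrK u0); apply: le_trans (sipn_triangle _ _ _) _; rewrite /r; lra.
have [wn awn] := approx_ex w0r.
have [q q0 Hq] := regular_J_cauchy X T00 TT M0 c0 (divr_gt0 e0 (ltr0Sn R 2)).
have [n0 Hn] := invn_lt q0.
have close n t : T0 <= t <= T -> nrm (Jn n (un n t) - Jn n (wn n t)) <= e / 3.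
  move=> /andP[Tt tT]; rewrite -JB; apply: le_trans (sipn_gJ _ _ _ _) _.
  have tT1 : T0 <= t <= T + 1 by rewrite Tt ler_wpDr.
  apply: le_trans (flow_stable T00 (HM _ _ aun n) (HM _ _ awn n) tT1) _.
  have [-> _ _] := aun n; have [-> _ _] := awn n.
  by rewrite -/E -ler_pdivlMr// sipnB ltW.
exists n0 => m n nm nn t tT.
have wT k : wn k T0 = w0 by have [] := awn k.
have := Hq _ _ (ln0 m) (ln1 m) (ln0 n) (ln1 n) (wn m) (wn n) (Hn _ nm) (Hn _ nn)
  (HM _ _ awn m) (HM _ _ awn n).
rewrite !wT => /(_ erefl rw t tT) H.
apply: le_trans (sipn_split _ (Jn m (wn m t)) _ _) _.
apply: le_trans (lerD (lexx _) (sipn_split _ (Jn n (wn n t)) _ _)) _.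
have := close m t tT; have := close n t tT; rewrite (sipnB g (Jn n (un n t))).
move: H; rewrite -!/(Jn _); lra.
Qed.

(** [G] stands for the time integral of [P (v t) / (4 t^2)]. Any function with this derivative after
    [T0] and arbitrarily small upper bounds near [T0] is allowed, which keeps time integrals out of
    the abstract setting. *)
Theorem es_solution : exists v : R -> V, [/\ v T0 = u0, (forall t, vcont g v t),
  (forall phi t, T0 < t -> is_derive t 1 (fun s => h (v s) phi) (weak_rhs t (v t) phi)) &
  forall G : R -> R, (forall e, 0 < e -> exists2 q, 0 < q &
      forall s, T0 < s -> s - T0 < q -> G s < e) ->
    (forall t, T0 < t -> is_derive t 1 G ((4 * t ^+ 2)^-1 * P (v t))) ->
    forall t, T0 < t -> es_energy X t (v t) + G t <= es_energy X T0 u0].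
Proof.
have u0r : nrm u0 <= r by rewrite lerDl.
have [un aun] := approx_ex u0r.
pose clamp t := Num.max t T0.
have clamp_ge t : T0 <= clamp t by rewrite le_max lexx orbT.
have clamp_id t : T0 <= t -> clamp t = t by move=> /max_idPl.
have clamp_lip s t : `|clamp s - clamp t| <= `|s - t|.
  rewrite /clamp /Num.max; case: ifP => sT; case: ifP => tT; move: sT tT;
  rewrite ?ltNge => sT tT; rewrite ler_norml;
  have := ler_norm (s - t); have := ler_norm (t - s); rewrite (distrC t s); lra.
have /choice[v vP] : forall t, exists l, vcvg g (fun n => Jn n (un n (clamp t))) l.
  move=> t; apply: (@es_complete _ _ X) => e e0.
  have [n0 Hn] := J_cauchy aun (clamp_ge t) (divr_gt0 e0 (ltr0Sn R 1)).
  exists n0 => m n nm nn; have := Hn m n nm nn (clamp t).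
  rewrite clamp_ge lexx => /(_ isT) H; apply: le_lt_trans H _; lra.
have U T : T0 <= T -> forall e, 0 < e -> exists n0, forall n, (n0 <= n)%N ->
    forall t, T0 <= t <= T -> nrm (Jn n (un n t) - v t) <= e.
  move=> TT e e0; have [n0 Hn] := J_cauchy aun TT e0; exists n0 => n nn t tT.
  apply/ler_addgt0Pr => e1 e10; have [n1 Hn1] := vP t e1 e10.
  have := Hn1 (n0 + n1)%N (leq_addl _ _); rewrite clamp_id; last by case/andP: tT.
  have := Hn n (n0 + n1)%N nn (leq_addr _ _) t tT => h1 h2.
  by apply: le_trans (sipn_split _ (Jn (n0 + n1)%N (un (n0 + n1)%N t)) _ _) _; lra.
(* The limits at [t] and at [clamp t] were picked separately; definiteness of [g] identifies
   them. *)
have ext t : v (clamp t) = v t.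
  apply/eqP; rewrite -subr_eq0; apply/eqP/(@es_g_def _ _ X).
  suff : nrm (v (clamp t) - v t) <= 0.
    by move=> H; rewrite -sqr_sipn; apply/eqP; rewrite sqrf_eq0 eq_le H sipn_ge0.
  apply/ler_addgt0Pr => e e0; rewrite add0r.
  have [n1 H1] := vP t (e / 2) ltac:(by rewrite divr_gt0).
  have [n2 H2] := vP (clamp t) (e / 2) ltac:(by rewrite divr_gt0).
  have := H2 _ (leq_maxr n1 n2); rewrite (clamp_id (clamp t))// => h2.
  have := H1 _ (leq_maxl n1 n2) => h1.
  apply: le_trans (sipn_split _ (Jn (maxn n1 n2) (un (maxn n1 n2) (clamp t))) _ _) _.
  by rewrite sipnB; lra.
have cv t : vcont g v t.
  move=> e e0.
  have [n0 Hn] := U (clamp t + 1) ltac:(by rewrite ler_wpDr) (e / 4) ltac:(by rewrite divr_gt0).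
  have [_ dn _] := aun n0.
  have [q q0 Hq] := vderiv_cont (dn _ (clamp_ge t)) (divr_gt0 e0 (ltr0Sn R 3)).
  exists (Num.min q 1); first by rewrite lt_min q0 ltr01.
  move=> s; rewrite lt_min => /andP[sq s1].
  have := Hq (clamp s) (le_lt_trans (clamp_lip s t) sq) => h1.
  have h2 := Hn n0 (leqnn _) (clamp t).
  have h3 := Hn n0 (leqnn _) (clamp s).
  have cs : clamp s <= clamp t + 1.
    by have := clamp_lip s t; have := ler_norm (clamp s - clamp t); lra.
  move: h2 h3; rewrite clamp_ge lerDl ler01 => /(_ isT) h2; rewrite clamp_ge cs => /(_ isT) h3.
  rewrite -(ext s) -(ext t).
  apply: le_lt_trans (sipn_split _ (Jn n0 (un n0 (clamp s))) _ _) _; rewrite sipnB.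
  apply: le_lt_trans (lerD (lexx _) (sipn_split _ (Jn n0 (un n0 (clamp t))) _ _)) _.
  have h4 : nrm (Jn n0 (un n0 (clamp s)) - Jn n0 (un n0 (clamp t))) < e / 4.
    by rewrite -JB; apply: le_lt_trans (sipn_gJ _ _ _ _) h1.
  lra.
(* In L^2 the flows themselves converge and not only their images by [J]: the difference is at most
   sqrt l times the bound [M]. *)
have Uh T : T0 <= T -> forall e, 0 < e -> exists n0, forall n, (n0 <= n)%N ->
    forall t, T0 <= t <= T -> sipn h (un n t - v t) <= e.
  move=> TT e e0; have [M M0 HM] := Mbound TT.
  have [n0 Hn] := U T TT (e / 2) ltac:(by rewrite divr_gt0).
  have [n1 Hn1] := invn_lt (e := (e / 2 / (M + 1)) ^+ 2) ltac:(by rewrite exprn_gt0// !divr_gt0// ltr_wpDl).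
  exists (maxn n0 n1) => n; rewrite geq_max => /andP[nn nn1] t tT.
  apply: le_trans (sipn_split _ (Jn n (un n t)) _ _) _.
  have h1 : sipn h (Jn n (un n t) - v t) <= e / 2.
    by apply: le_trans (sipn_h_le X _) _; exact: Hn.
  have [_ uM] := HM _ _ aun n t tT.
  have h2 : sipn h (un n t - Jn n (un n t)) <= e / 2.
    apply: le_trans (J_err _ _ _ _) _.
    apply: (@le_trans _ _ (e / 2 / (M + 1) * (M + 1))); last first.
      by rewrite divfK// gt_eqF// ltr_wpDl.
    apply: ler_pM; rewrite ?sqrtr_ge0 ?sipn_ge0//; last first.
      by apply: le_trans (sipn_d_le X _) _; lra.
    have eM : 0 <= e / 2 / (M + 1) by rewrite !divr_ge0 ?addr_ge0// ltW.
    by rewrite -[leRHS]ger0_norm// -sqrtr_sqr; apply/ler_wsqrtr/ltW/Hn1.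
  lra.
have vT0 : v T0 = u0.
  apply/eqP; rewrite -subr_eq0; apply/eqP/(@es_def _ _ X).
  suff : sipn h (v T0 - u0) <= 0.
    by move=> H; rewrite -sqr_sipn; apply/eqP; rewrite sqrf_eq0 eq_le H sipn_ge0.
  apply/ler_addgt0Pr => e e0; rewrite add0r.
  have [n0 Hn] := Uh T0 (lexx _) e e0.
  have := Hn n0 (leqnn _) T0; rewrite lexx => /(_ isT).
  by have [-> _ _] := aun n0; rewrite sipnB.
have vM T M : T0 <= T -> (forall n, flow_on X T0 (ln0 n) (ln1 n) T M (un n)) ->
    forall t, T0 <= t <= T -> nrm (v t) <= M.
  move=> TT HM t tT; apply/ler_addgt0Pr => e e0.
  have [n0 Hn] := U T TT e e0; have := Hn n0 (leqnn _) t tT.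
  have [_ uM] := HM n0 t tT; have := sipn_gJ X (ln0 n0) (ln1 n0) (un n0 t).
  have := sipn_split g (Jn n0 (un n0 t)) (v t) 0.
  by rewrite !subr0 sipnB -/(Jn n0); lra.
have weak phi t : T0 < t -> is_derive t 1 (fun s => h (v s) phi) (weak_rhs t (v t) phi).
  move=> Tt; have t0 := lt_trans T00 Tt.
  have TT : T0 <= t + 1 by lra.
  have [M M0 HM] := Mbound TT.
  (* The L^2 derivatives of the approximations converge to the weak right-hand side, uniformly on
     [[T0, t + 1]]; the differentiated limit below rests on this. *)
  have DU e : 0 < e -> exists n0, forall n, (n0 <= n)%N -> forall s, T0 <= s <= t + 1 ->
      `|h (Fn n s (un n s)) phi - weak_rhs s (v s) phi| <= e.
    move=> e0.
    pose c := 1 + K M / T0 + K M * M / T0.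
    have KT : 0 <= K M / T0 by rewrite divr_ge0 ?es_K_ge0// ltW.
    have KTM : 0 <= K M * M / T0 by rewrite divr_ge0 ?mulr_ge0 ?es_K_ge0// ltW.
    have c0 : 0 < c by rewrite /c; lra.
    have p0 : 0 < nrm phi + 1 by have := sipn_ge0 g phi; lra.
    pose q := e / c / (nrm phi + 1).
    have q0 : 0 < q by rewrite !divr_gt0.
    have [n0 Hn0] := U _ TT q q0.
    have [n1 Hn1] := Uh _ TT q q0.
    have [n2 Hn2] := invn_lt (e := q ^+ 2) ltac:(by rewrite exprn_gt0).
    exists (maxn n0 (maxn n1 n2)) => n; rewrite !geq_max => /andP[nn0 /andP[nn1 nn2]] s sT.
    have {}Hn0 := Hn0 n nn0 s sT; have {}Hn1 := Hn1 n nn1 s sT.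
    have {}Hn2 : Num.sqrt (ln n) <= q.
      by rewrite -[leRHS]gtr0_norm// -sqrtr_sqr; apply/ler_wsqrtr/ltW/Hn2.
    have [_ uM] := HM _ _ aun n s sT.
    have vsM := vM _ _ TT (HM _ _ aun) s sT.
    case/andP: (sT) => Ts _; have s0 := lt_le_trans T00 Ts.
    rewrite /Fn field_h /weak_rhs -/(Jn n).
    have -> : - (d (Jn n (un n s)) (I phi) + s^-1 * h (N (un n s)) (Jn n (I phi))) -
       - (d (v s) (I phi) + s^-1 * h (N (v s)) (I phi)) =
       - (d (Jn n (un n s) - v s) (I phi) + s^-1 * (h (N (un n s) - N (v s)) (Jn n (I phi))
           - h (N (v s)) (I phi - Jn n (I phi)))).
      by rewrite !sipBl sipBr; ring.
    rewrite normrN; apply: le_trans (ler_normD _ _) _.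
    have a1 : `|d (Jn n (un n s) - v s) (I phi)| <= q * nrm phi.
      apply: le_trans (sip_CS _ _ _) _; rewrite sipn_dI; apply: ler_pM; rewrite ?sipn_ge0//.
        exact: le_trans (sipn_d_le X _) Hn0.
      exact: sipn_d_le.
    have a2 : `|h (N (un n s) - N (v s)) (Jn n (I phi))| <= K M * q * nrm phi.
      apply: le_trans (sip_CS _ _ _) _; apply: ler_pM; rewrite ?sipn_ge0//.
        apply: le_trans (@es_N_liph _ _ X M _ _ uM vsM) _.
        by rewrite ler_wpM2l ?es_K_ge0.
      apply: le_trans (sipn_hJ _ _ _ _) _; rewrite sipn_hI; exact: sipn_h_le.
    have a3 : `|h (N (v s)) (I phi - Jn n (I phi))| <= K M * M * (q * nrm phi).
      apply: le_trans (sip_CS _ _ _) _; apply: ler_pM; rewrite ?sipn_ge0//.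
        exact: sipn_N_le.
      apply: le_trans (J_err _ _ _ _) _; rewrite sipn_dI; apply: ler_pM; rewrite ?sipn_ge0 ?sqrtr_ge0//.
      exact: sipn_d_le.
    have a4 : `|s^-1 * (h (N (un n s) - N (v s)) (Jn n (I phi)) - h (N (v s)) (I phi - Jn n (I phi)))| <=
      T0^-1 * (K M * q * nrm phi + K M * M * (q * nrm phi)).
      rewrite normrM gtr0_norm ?invr_gt0//; apply: ler_pM; rewrite ?invr_ge0 ?(ltW s0)//.
        by rewrite lef_pV2.
      by apply: le_trans (ler_normB _ _) _; rewrite lerD.
    have a5 : c * (q * nrm phi) <= e.
      apply: (@le_trans _ _ (c * (q * (nrm phi + 1)))).
        by rewrite ler_wpM2l ?(ltW c0)// ler_wpM2l ?(ltW q0)// lerDl.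
      rewrite le_eqVlt; apply/orP; left; apply/eqP.
      by rewrite /q divfK ?gt_eqF// mulrC divfK// gt_eqF.
    have : c * (q * nrm phi) = q * nrm phi +
       T0^-1 * (K M * q * nrm phi + K M * M * (q * nrm phi)) by rewrite /c; ring.
    lra.
  apply/is_deriveP => e e0.
  have [q q0 Hq] := (continuous_epsP _ _).1 (@weak_rhs_continuous v phi t t0 cv)
    (e / 2) ltac:(by rewrite divr_gt0).
  exists (Num.min q (Num.min 1 (t - T0))); first by rewrite !lt_min q0 ltr01 subr_gt0.
  move=> s; rewrite !lt_min => /andP[sq /andP[s1 sT]].
  have inT x : `|x - t| <= `|s - t| -> T0 <= x <= t + 1.
    move=> xs; have := le_lt_trans xs s1; have := le_lt_trans xs sT.
    by rewrite !ltr_norml; lra.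
  have sT' : T0 <= s <= t + 1 by exact: inT.
  have tT' : T0 <= t <= t + 1 by apply: inT; rewrite subrr normr0.
  pose D := weak_rhs t (v t) phi; rewrite -/D.
  (* With [s] fixed, [e1] pays for replacing [v] by an approximation at the two endpoints; the index
     [n] may depend on it. *)
  apply/ler_addgt0Pr => e1 e10.
  have [n0 Hn0] := DU (e / 2) ltac:(by rewrite divr_gt0).
  have p0 : 0 < sipn h phi + 1 by have := sipn_ge0 h phi; lra.
  have [n1 Hn1] := Uh _ TT (e1 / 2 / (sipn h phi + 1)) ltac:(by rewrite !divr_gt0).
  pose n := maxn n0 n1.
  have hv x : T0 <= x <= t + 1 -> `|h (v x - un n x) phi| <= e1 / 2.
    move=> xT; apply: le_trans (sip_CS _ _ _) _.
    apply: (@le_trans _ _ (e1 / 2 / (sipn h phi + 1) * (sipn h phi + 1))); last first.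
      by rewrite divfK// gt_eqF.
    apply: ler_pM; rewrite ?sipn_ge0 ?lerDl//.
    by rewrite sipnB; apply: Hn1 => //; exact: leq_maxr.
  have : `|(h (un n s) phi - s * D) - (h (un n t) phi - t * D)| <= e * `|s - t|.
    apply: (@MVT_bound _ (fun x => h (un n x) phi - x * D)
      (fun x => h (Fn n x (un n x)) phi - 1 * D)).
      move=> x /inT /andP[Tx _]; apply: is_derive_subf.
        apply: (is_derive_sip_cst (g := g) (C := 1)).
          by move=> y; rewrite mul1r sipn_h_le.
        by have [_ + _] := aun n; exact.
      have := is_derive_mulf (is_derive_id x 1) (is_derive_cst D x 1).
      by rewrite mulr0 addr0.
    move=> x xs; have := Hn0 n (leq_maxl _ _) x (inT x xs).
    have := Hq x (le_lt_trans xs sq); rewrite mul1r -/D.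
    have := ler_normD (h (Fn n x (un n x)) phi - weak_rhs x (v x) phi) (weak_rhs x (v x) phi - D).
    by rewrite subrKA; lra.
  have := hv s sT'; have := hv t tT'; rewrite !sipBl => h1 h2 h3.
  have -> : h (v s) phi - h (v t) phi - (s - t) * D =
    ((h (un n s) phi - s * D) - (h (un n t) phi - t * D)) +
    ((h (v s) phi - h (un n s) phi) - (h (v t) phi - h (un n t) phi)) by ring.
  apply: le_trans (ler_normD _ _) _; apply: lerD => //.
  by apply: le_trans (ler_normB _ _) _; lra.
exists v; split => // G Gc dG t Tt; have t0 := lt_trans T00 Tt.
have TT : T0 <= t := ltW Tt.
have [M M0 HM] := Mbound TT.
have vtM := vM _ _ TT (HM _ _ aun).
pose S := es_energy X T0 u0.
have main e : 0 < e -> es_energy X t (v t) + G t <= S + e.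
  move=> e0.
  have PU q : 0 < q -> exists n0, forall n, (n0 <= n)%N -> forall s, T0 <= s <= t ->
      `|P (v s) - P (un n s)| <= q /\ `|P (v s) - P (Jn n (un n s))| <= q.
    move=> q0; have k0 : 0 < K M + 1 by rewrite ltr_wpDl ?es_K_ge0.
    have qk : 0 < q / (K M + 1) by rewrite divr_gt0.
    have [n0 Hn0] := Uh t TT _ qk; have [n1 Hn1] := U t TT _ qk.
    exists (maxn n0 n1) => n; rewrite geq_max => /andP[nn0 nn1] s sT.
    have [_ uM] := HM _ _ aun n s sT.
    have JM : nrm (Jn n (un n s)) <= M by exact: le_trans (sipn_gJ _ _ _ _) uM.
    have kq x : sipn h x <= q / (K M + 1) -> K M * sipn h x <= q.
      rewrite ler_pdivlMr// mulrC => /(le_trans _); apply.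
      by rewrite ler_wpM2r ?sipn_ge0// lerDl.
    split.
      apply: le_trans (@es_P_lip _ _ X M _ _ (vtM s sT) uM) _.
      by apply: kq; rewrite sipnB; exact: Hn0.
    apply: le_trans (@es_P_lip _ _ X M _ _ (vtM s sT) JM) _.
    by apply: kq; rewrite sipnB; apply: le_trans (sipn_h_le X _) (Hn1 _ _ _ _).
  (* The denominator collects the weights of an error [q] in the potential: 1/(4t) in the final
     energy and (t - T0)/(4 T0^2) in the integrated dissipation. The summand 1 is slack. *)
  have q0 : 0 < e / 4 / (1 + (4 * t)^-1 + (4 * T0 ^+ 2)^-1 * (t - T0)).
    rewrite !divr_gt0// addr_gt0 ?addr_gt0 ?invr_gt0 ?mulr_gt0 ?exprn_gt0//.
    by rewrite invr_gt0 mulr_gt0 ?exprn_gt0.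
    by rewrite subr_gt0.
  set q := e / 4 / _ in q0.
  have [n0 Hn0] := PU q q0.
  have [n1 Hn1] := U t TT (Num.min 1 (e / 4 / (M + 1))) ltac:(by rewrite lt_min ltr01 !divr_gt0// ltr_wpDl).
  pose n := maxn n0 n1; pose w := un n.
  have [wT dw bw] := aun n.
  have Hq s : T0 <= s <= t -> `|P (v s) - P (w s)| <= q /\ `|P (v s) - P (Jn n (w s))| <= q.
    by move=> sT; apply: Hn0 => //; exact: leq_maxl.
  have Qd s : T0 < s <= t -> is_derive s 1 (fun s => es_energy X s (w s) + G s)
     (- ((4 * s ^+ 2)^-1 * P (w s)) + (4 * s ^+ 2)^-1 * P (v s)).
    move=> /andP[Ts st]; apply: is_derive_addf; last exact: dG.
    apply: (is_derive_flow_energy (l0 := ln0 n) (l1 := ln1 n)); first exact: lt_trans Ts.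
    exact/dw/ltW.
  have Gt a : T0 < a <= t ->
     es_energy X t (w t) + G t <= es_energy X a (w a) + G a + (4 * T0 ^+ 2)^-1 * q * (t - T0).
    move=> /andP[Ta at_].
    have := @le_derive_nincr _
      (fun s => es_energy X s (w s) + G s - (4 * T0 ^+ 2)^-1 * q * s)
      (fun s => - ((4 * s ^+ 2)^-1 * P (w s)) + (4 * s ^+ 2)^-1 * P (v s) - (4 * T0 ^+ 2)^-1 * q * 1)
      a t at_ _ _.
    have B1 : (4 * T0 ^+ 2)^-1 * q * a >= (4 * T0 ^+ 2)^-1 * q * T0.
      by rewrite ler_wpM2l ?(ltW Ta)// mulr_ge0 ?(ltW q0)// invr_ge0 mulr_ge0 ?sqr_ge0.
    move=> H; have {}H := H _ _; rewrite mulrBr; move: B1.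
    suff : es_energy X t (w t) + G t - (4 * T0 ^+ 2)^-1 * q * t <=
           es_energy X a (w a) + G a - (4 * T0 ^+ 2)^-1 * q * a by lra.
    apply: H.
      move=> s /andP[as_ st]; apply: is_derive_subf.
        by apply: Qd; rewrite st (lt_le_trans Ta).
    move=> s /andP[as_ st].
    have Ts := lt_le_trans Ta as_; have s0 := lt_trans T00 Ts.
    have [PP _] := Hq s ltac:(by rewrite st ltW).
    rewrite [leLHS](_ : _ = (4 * s ^+ 2)^-1 * (P (v s) - P (w s)) - (4 * T0 ^+ 2)^-1 * q); last by ring.
    rewrite subr_le0; apply: le_trans (ler_norm _) _; rewrite normrM.
    apply: ler_pM => //.
    rewrite gtr0_norm ?invr_gt0 ?mulr_gt0 ?exprn_gt0//.
    by rewrite lef_pV2 ?posrE ?mulr_gt0 ?exprn_gt0// ler_pM2l// ler_sqr ?nnegrE ?(ltW T00) ?(ltW s0)// ltW.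
  have ES a : T0 < a <= t -> es_energy X a (w a) <= S.
    move=> /andP[Ta at_]; rewrite /S -wT.
    apply: (@le_derive_nincr _ (fun s => es_energy X s (w s))
      (fun s => - ((4 * s ^+ 2)^-1 * P (w s)))); first exact: ltW.
      move=> s /andP[Ts _].
      apply: (is_derive_flow_energy (l0 := ln0 n) (l1 := ln1 n)); first exact: lt_le_trans Ts.
      exact: dw.
    move=> s _; rewrite oppr_le0 mulr_ge0 ?es_P_ge0// invr_ge0 mulr_ge0 ?sqr_ge0//.
  have [z z0 Hz] := Gc (e / 4) ltac:(by rewrite divr_gt0).
  (* The derivative of [G] is known only after [T0], so the balance is started at [a]. Up to [a] the
     energy of [w] alone is monotone, and [G a] is small. *)
  pose a := Num.min t (T0 + z / 2).
  have Ta : T0 < a <= t by rewrite lt_min Tt ltrDl divr_gt0//= ge_min lexx.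
  have Ga : G a < e / 4.
    apply: Hz; first by case/andP: Ta.
    have : a <= T0 + z / 2 by rewrite ge_min lexx orbT.
    lra.
  have := Gt a Ta; have := ES a Ta.
  have [] := Hq t ltac:(by rewrite TT lexx); rewrite ler_norml => /andP[_ P1] _.
  (* Lower semicontinuity of the kinetic part. Only the images [J w] converge in H^1, but [J]
     contracts [d], and this is the direction required. *)
  have dv : d (v t) (v t) <= d (w t) (w t) + 2 * (e / 4).
    have tT : T0 <= t <= t by rewrite TT lexx.
    have := Hn1 n (leq_maxr _ _) t tT; rewrite le_min => /andP[_ H1].
    have J1 : sipn d (v t) <= sipn d (w t) + sipn d (Jn n (w t) - v t).
      have := sipn_split d (Jn n (w t)) (v t) 0; rewrite !subr0 sipnB.
      have := sipn_dJ X (ln0 n) (ln1 n) (w t); rewrite -/(Jn n); lra.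
    have J2 : sipn d (Jn n (w t) - v t) * (M + 1) <= e / 4.
      rewrite -ler_pdivlMr ?ltr_wpDl//; exact: le_trans (sipn_d_le X _) H1.
    have J3 : sipn d (v t) <= M by exact: le_trans (sipn_d_le X _) (vtM _ tT).
    have [_ wM] := HM _ _ aun n t tT.
    have J4 : sipn d (w t) <= M by exact: le_trans (sipn_d_le X _) wM.
    rewrite -!sqr_sipn.
    have := sipn_ge0 d (v t); have := sipn_ge0 d (w t); have := sipn_ge0 d (Jn n (w t) - v t).
    move: J1 J2 J3 J4; set x := sipn d (v t); set y := sipn d (w t); set k := sipn d (_ - _).
    move=> J1 J2 J3 J4 k0 y0 x0.
    have : (x - y) * (x + y) <= k * (2 * M).
      have [xy|xy] := leP x y.
        apply: (@le_trans _ _ 0); last by rewrite !mulr_ge0.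
        by rewrite mulr_le0_ge0 ?addr_ge0// subr_le0.
      by apply: ler_pM; rewrite ?subr_ge0 ?addr_ge0 ?(ltW xy)//; lra.
    by move: J2; lra.
  have q4 : (4 * t)^-1 * q + (4 * T0 ^+ 2)^-1 * q * (t - T0) <= e / 4.
    have qE : q * (1 + (4 * t)^-1 + (4 * T0 ^+ 2)^-1 * (t - T0)) = e / 4.
      rewrite /q divfK// gt_eqF// addr_gt0 ?addr_gt0 ?invr_gt0 ?mulr_gt0//.
        by rewrite invr_gt0 mulr_gt0 ?exprn_gt0.
      by rewrite subr_gt0.
    by move: qE q0; lra.
  have P2 : (4 * t)^-1 * P (v t) <= (4 * t)^-1 * (P (w t) + q).
    by rewrite ler_wpM2l ?invr_ge0 ?mulr_ge0 ?(ltW t0)//; lra.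
  by rewrite /es_energy; move: dv q4 P2 Ga; lra.
by apply/ler_addgt0Pr => e e0; exact: main.
Qed.

End Limit.
End Solution.

(** * Uniqueness for the equation tested against a dense set *)

Section Uniqueness.
Context {R : realType} {V : lmodType R} (X : energy_space V).
Local Notation h := (es_h X).
Local Notation d := (es_d X).
Local Notation g := (es_g X).
Local Notation I := (es_I X).
Local Notation N := (es_N X).
Local Notation K := (es_K X).
Local Notation nrm := (sipn g).
Variables (T0 : R) (T00 : 0 < T0) (D : V -> Prop).
Hypothesis D_dense : forall u e, 0 < e -> exists2 w, D w & nrm (w - u) < e.
Variables v1 v2 : R -> V.
Hypothesis (c1 : forall t, vcont g v1 t) (c2 : forall t, vcont g v2 t).
Hypothesis d1 : forall phi t, D phi -> T0 < t ->
  is_derive t 1 (fun s => h (v1 s) phi) (weak_rhs X t (v1 t) phi).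
Hypothesis d2 : forall phi t, D phi -> T0 < t ->
  is_derive t 1 (fun s => h (v2 s) phi) (weak_rhs X t (v2 t) phi).

Let z t := v1 t - v2 t.
Let A t := t^-1 *: (N (v1 t) - N (v2 t)).
Let L t phi := - (d (z t) (I phi) + h (A t) (I phi)).

Let L_lin t : functional (L t).
Proof. by move=> a x y; rewrite /L es_I_lin !sipDr !sipZr; ring. Qed.

Let L_bound t phi : `|L t phi| <= (nrm (z t) + nrm (A t)) * nrm phi.
Proof.
rewrite normrN mulrDl; apply: le_trans (ler_normD _ _) _.
apply: lerD; apply: le_trans (sip_CS _ _ _) _; apply: ler_pM; rewrite ?sipn_ge0//.
- exact: sipn_d_le.
- by rewrite sipn_dI sipn_d_le.
- exact: sipn_h_le.
- by rewrite sipn_hI sipn_h_le.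
Qed.

Let z_cont t : vcont g z t. Proof. exact: vcontB. Qed.

Let A_cont t : 0 < t -> vcont g A t.
Proof.
move=> t0; apply: (vcontZ (c := fun s => s^-1)); first exact: continuous_inv.
by apply: vcontB; exact: vcont_N.
Qed.

Let L_near t e : 0 < t -> 0 < e -> exists2 r, 0 < r &
  forall s, `|s - t| < r -> forall phi, `|L s phi - L t phi| <= e * nrm phi.
Proof.
move=> t0 e0.
have [r1 r10 H1] := @z_cont t _ (divr_gt0 e0 (ltr0Sn R 1)).
have [r2 r20 H2] := A_cont t0 (divr_gt0 e0 (ltr0Sn R 1)).
exists (Num.min r1 r2); first by rewrite lt_min r10.
move=> s; rewrite lt_min => /andP[/H1 {}H1 /H2 {}H2] phi.
have -> : L s phi - L t phi = - (d (z s - z t) (I phi) + h (A s - A t) (I phi)).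
  by rewrite /L !sipBl; ring.
rewrite normrN; apply: le_trans (ler_normD _ _) _.
have a1 : `|d (z s - z t) (I phi)| <= e / 2 * nrm phi.
  apply: le_trans (sip_CS _ _ _) _; apply: ler_pM; rewrite ?sipn_ge0//.
    exact: le_trans (sipn_d_le X _) (ltW H1).
  by rewrite sipn_dI sipn_d_le.
have a2 : `|h (A s - A t) (I phi)| <= e / 2 * nrm phi.
  apply: le_trans (sip_CS _ _ _) _; apply: ler_pM; rewrite ?sipn_ge0//.
    exact: le_trans (sipn_h_le X _) (ltW H2).
  by rewrite sipn_hI sipn_h_le.
lra.
Qed.

Let dz phi t : D phi -> T0 < t -> is_derive t 1 (fun s => h (z s) phi) (L t phi).
Proof.
move=> Dphi Tt; have := is_derive_subf (d1 Dphi Tt) (d2 Dphi Tt) => H.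
have E : is_derive t 1 (fun s => h (z s) phi)
    (weak_rhs X t (v1 t) phi - weak_rhs X t (v2 t) phi).
  apply: is_derive_near_eq H; first exact: ltr01.
  by move=> s _; rewrite -sipBl.
apply: (is_derive_eq E); rewrite /weak_rhs /L /z /A sipZl !sipBl; ring.
Qed.

(** The mean value bound on [D] is proportional to [nrm phi], so by density it holds for every [phi]
    of H^1, in particular for vectors made from the solutions. *)
Let increment t e : T0 < t -> 0 < e -> exists2 r, 0 < r & forall s, `|s - t| < r ->
  forall phi, `|h (z s) phi - h (z t) phi - (s - t) * L t phi| <= e * `|s - t| * nrm phi.
Proof.
move=> Tt e0; have t0 := lt_trans T00 Tt.
have [r r0 Hr] := L_near t0 e0.
exists (Num.min r (t - T0)); first by rewrite lt_min r0 subr_gt0.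
move=> s; rewrite lt_min => /andP[sr sT].
pose l phi := h (z s) phi - h (z t) phi - (s - t) * L t phi.
apply: (@functional_dense_bound _ _ g D l
  (nrm (z s - z t) + `|s - t| * (nrm (z t) + nrm (A t)))) => //.
- by move=> a x y; rewrite /l L_lin !sipDr !sipZr; ring.
- move=> phi; rewrite /l -sipBl [leRHS]mulrDl; apply: le_trans (ler_normB _ _) _.
  apply: lerD; last by rewrite normrM -mulrA ler_wpM2l.
  apply: le_trans (sip_CS _ _ _) _; apply: ler_pM; rewrite ?sipn_ge0//; exact: sipn_h_le.
- move=> phi Dphi.
  have -> : l phi = (h (z s) phi - s * L t phi) - (h (z t) phi - t * L t phi).
    by rewrite /l; ring.
  rewrite mulrAC.
  apply: (@MVT_bound _ (fun x => h (z x) phi - x * L t phi)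
    (fun x => L x phi - L t phi)) => x xs.
    apply: is_derive_subf.
      by apply: dz => //; move: (le_lt_trans xs sT); rewrite ltr_norml; lra.
    have := is_derive_mulf (is_derive_id x 1) (is_derive_cst (L t phi) x 1).
    by rewrite mulr0 addr0 mul1r.
  exact/Hr/(le_lt_trans xs sr).
- by rewrite mulr_ge0// ltW.
Qed.

(** [h (z s) (z s) - h (z t) (z t)] is the increment of [z] tested with [z s + z t]. This vector
    moves with [s], which [increment] permits because it is uniform in [phi]. *)
Let dzz t : T0 < t -> is_derive t 1 (fun s => h (z s) (z s)) (2 * L t (z t)).
Proof.
move=> Tt; apply/is_deriveP => e e0.
pose m := 2 * nrm (z t) + 1 + (nrm (z t) + nrm (A t)).
have m0 : 0 < m.
  by rewrite /m; have := sipn_ge0 g (z t); have := sipn_ge0 g (A t); lra.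
have em : 0 < Num.min 1 (e / m) by rewrite lt_min ltr01 divr_gt0.
have [r1 r10 H1] := increment Tt em.
have [r2 r20 H2] := @z_cont t _ em.
exists (Num.min r1 r2); first by rewrite lt_min r10.
move=> s; rewrite lt_min => /andP[/H1 /(_ (z s + z t)) {}H1 /H2 {}H2].
have -> : h (z s) (z s) - h (z t) (z t) - (s - t) * (2 * L t (z t)) =
  (h (z s) (z s + z t) - h (z t) (z s + z t) - (s - t) * L t (z s + z t)) +
  (s - t) * L t (z s - z t).
  have L1 : L t (z s + z t) = L t (z s) + L t (z t).
    by have := L_lin t 1 (z s) (z t); rewrite scale1r mul1r.
  have L2 : L t (z s - z t) = L t (z s) - L t (z t).
    by have := L_lin t (-1) (z t) (z s); rewrite scaleN1r addrC => ->; ring.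
  by rewrite L1 L2 (sipDr h (z s) (z t) (z s)) (sipDr h (z s) (z t) (z t)) (sipC h (z t) (z s)); ring.
apply: le_trans (ler_normD _ _) _.
move: H2; rewrite lt_min => /andP[H21 H22].
set em1 := Num.min 1 (e / m) in em H1 *.
have em2 : em1 <= e / m by rewrite ge_min lexx orbT.
have n1 : nrm (z s + z t) <= 2 * nrm (z t) + 1.
  have E3 (x y : V) : x + y = (x - y) + (y + y) by rewrite addrA subrK.
  rewrite [z s + _]E3.
  apply: le_trans (sipn_triangle _ _ _) _.
  by have := sipn_triangle g (z t) (z t); lra.
have a1 : em1 * `|s - t| * nrm (z s + z t) <= e / m * `|s - t| * (2 * nrm (z t) + 1).
  by apply: ler_pM; rewrite ?mulr_ge0 ?sipn_ge0 ?(ltW em)// ler_wpM2r.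
have a2 : `|(s - t) * L t (z s - z t)| <= e / m * `|s - t| * (nrm (z t) + nrm (A t)).
  rewrite normrM [leRHS](_ : _ = `|s - t| * ((nrm (z t) + nrm (A t)) * (e / m))); last by ring.
  rewrite ler_wpM2l//; apply: le_trans (L_bound _ _) _.
  by rewrite ler_wpM2l ?addr_ge0 ?sipn_ge0// ltW.
have : e * `|s - t| = e / m * `|s - t| * (2 * nrm (z t) + 1) +
   e / m * `|s - t| * (nrm (z t) + nrm (A t)).
  rewrite -mulrDr -/m; field; exact: lt0r_neq0.
lra.
Qed.

Theorem es_unique : v1 T0 = v2 T0 -> forall t, T0 < t -> v1 t = v2 t.
Proof.
move=> v12 t Tt.
have [M1 _ HM1] := vcont_bounded (ltW Tt) c1.
have [M2 _ HM2] := vcont_bounded (ltW Tt) c2.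
pose M := Num.max M1 M2.
pose C := 2 * K M / T0 + 1.
have C0 : 0 < C by rewrite ltr_wpDl// divr_ge0 ?mulr_ge0 ?es_K_ge0// ltW.
have growth s : T0 < s <= t -> 2 * L s (z s) <= C * h (z s) (z s) + 0.
  move=> /andP[Ts st]; have s0 := lt_trans T00 Ts.
  have w1 : nrm (v1 s) <= M by rewrite le_max HM1// st ltW.
  have w2 : nrm (v2 s) <= M by rewrite le_max HM2 ?orbT// st ltW.
  rewrite addr0 /L es_dIself add0r.
  have : `|h (A s) (I (z s))| <= K M / T0 * h (z s) (z s).
    apply: le_trans (sip_CS _ _ _) _; rewrite sipn_hI -sqr_sipn expr2 mulrA.
    rewrite ler_wpM2r ?sipn_ge0// sipnZ gtr0_norm ?invr_gt0// mulrAC mulrC.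
    apply: ler_pM; rewrite ?sipn_ge0 ?invr_ge0 ?(ltW s0)//.
      exact: es_N_liph.
    by rewrite lef_pV2 ?posrE// ltW.
  have := sip_ge0 h (z s); rewrite ler_norml /C => hz /andP[A1 _].
  move: hz A1; lra.
suff : h (z t) (z t) <= 0.
  move=> H; apply/eqP; rewrite -subr_eq0; apply/eqP/(@es_def _ _ X)/eqP.
  by rewrite eq_le H sip_ge0.
apply/ler_addgt0Pr => e e0; rewrite add0r.
pose E := expR (C * (t - T0)); have E0 : 0 < E by exact: expR_gt0.
have q0 : 0 < Num.sqrt (e / E) by rewrite sqrtr_gt0 divr_gt0.
have [r r0 Hr] := @z_cont T0 _ q0.
(* The equation holds only after [T0]; Gronwall starts at [a], where continuity makes the difference
   as small as the exponential factor demands. *)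
pose a := Num.min t (T0 + r / 2).
have Ta : T0 < a by rewrite lt_min Tt ltrDl divr_gt0.
have at_ : a <= t by rewrite ge_min lexx.
have ar : `|a - T0| < r.
  have : a <= T0 + r / 2 by rewrite ge_min lexx orbT.
  by rewrite gtr0_norm ?subr_gt0//; lra.
have := Hr a ar; rewrite /z v12 subrr subr0 -/(z a) => za.
have hza : h (z a) (z a) <= e / E.
  rewrite -(sqr_sqrtr (ltW (divr_gt0 e0 E0))); apply: le_sipn; first exact: ltW.
  exact: le_trans (sipn_h_le X _) (ltW za).
have := @gronwall _ (fun s => h (z s) (z s)) (fun s => 2 * L s (z s)) C 0 a t C0 at_ _ _.
rewrite mul0r !addr0 => H; apply: le_trans (H _ _) _.
- by move=> s /andP[as_ _]; apply: dzz; exact: lt_le_trans as_.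
- by move=> s /andP[as_ st]; apply: growth; rewrite st (lt_le_trans Ta).
rewrite -[leRHS](divfK (_ : E != 0)) ?gt_eqF//; apply: ler_pM; rewrite ?sip_ge0 ?expR_ge0//.
by rewrite ler_expR ler_wpM2l ?(ltW C0)// lerD2l lerN2 ltW.
Qed.

End Uniqueness.

(** * Square integrable functions *)

Section SquareIntegrable.
Context {R : realType}.
Local Notation mu := (@lebesgue_measure R).
Implicit Types (f g k : R -> R) (A : set R).

Lemma aeS (P Q : R -> Prop) : {ae mu, forall x, P x} -> (forall x, P x -> Q x) ->
  {ae mu, forall x, Q x}.
Proof. by move=> HP PQ; apply: (@filterS _ _ (ae_filter_ringOfSetsType mu)) HP. Qed.

Lemma aeI (P Q : R -> Prop) : {ae mu, forall x, P x} -> {ae mu, forall x, Q x} ->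
  {ae mu, forall x, P x /\ Q x}.
Proof. by move=> HP HQ; exact: (@filterI _ _ (ae_filter_ringOfSetsType mu)). Qed.

Definition L2 f := measurable_fun [set: R] f /\
  mu.-integrable [set: R] (EFin \o (fun x => f x ^+ 2)).

Definition ip f g : R := \int[mu]_x (f x * g x).

Lemma measurable_sqr f A : measurable_fun A f -> measurable_fun A (fun x => f x ^+ 2).
Proof. by move=> mf; exact: measurable_funX. Qed.

Lemma L2_mul f g : L2 f -> L2 g ->
  mu.-integrable [set: R] (EFin \o (fun x => f x * g x)).
Proof.
move=> [mf f2] [mg g2].
have := integrableD measurableT f2 g2.
apply: le_integrable => //.
  by apply/measurable_EFinP; exact: measurable_funM.
move=> x _ /=; rewrite lee_fin normrM [leRHS]ger0_norm; last first.
  by rewrite addr_ge0 ?sqr_ge0.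
rewrite -(real_normK (num_real (f x))) -(real_normK (num_real (g x))).
have := sqr_ge0 (`|f x| - `|g x|); nra.
Qed.

Lemma L2_lin (a : R) f g : L2 f -> L2 g -> L2 (fun x => a * f x + g x).
Proof.
move=> Lf Lg; have [mf f2] := Lf; have [mg g2] := Lg; split.
  by apply: measurable_funD => //; exact: measurable_funM.
have i1 := integrableZl measurableT (a ^+ 2) f2.
have i2 := integrableZl measurableT (2 * a) (L2_mul Lf Lg).
have := integrableD measurableT (integrableD measurableT i1 i2) g2.
apply: eq_integrable => // x _ /=; rewrite -!EFinM -!EFinD; congr EFin; ring.
Qed.

Lemma L2_0 : L2 (fun=> 0).
Proof.
split; first exact: measurable_cst.
have -> : EFin \o (fun=> 0 ^+ 2) = cst 0%E :> (R -> \bar R).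
  by apply/funext => x /=; rewrite expr0n.
exact: integrable0.
Qed.

Lemma L2D f g : L2 f -> L2 g -> L2 (fun x => f x + g x).
Proof.
move=> Lf Lg; have := L2_lin 1 Lf Lg; congr L2.
by apply/funext => x; rewrite mul1r.
Qed.

Lemma L2B f g : L2 f -> L2 g -> L2 (fun x => f x - g x).
Proof.
move=> Lf Lg; have := L2_lin (-1) Lg Lf; congr L2.
by apply/funext => x; rewrite mulN1r addrC.
Qed.

Lemma ip_linl (a : R) f g k : L2 f -> L2 g -> L2 k ->
  ip (fun x => a * f x + g x) k = a * ip f k + ip g k.
Proof.
move=> Lf Lg Lk; rewrite /ip -RintegralZl//; last exact: L2_mul.
rewrite -RintegralD//; last 2 first.
- have := integrableZl measurableT a (L2_mul Lf Lk).
  by apply: eq_integrable => // x _ /=; rewrite EFinM.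
- exact: L2_mul.
by apply: eq_Rintegral => x _; ring.
Qed.

Lemma ipC f g : ip f g = ip g f.
Proof. by apply: eq_Rintegral => x _; rewrite mulrC. Qed.

Lemma ip_ge0 f : 0 <= ip f f.
Proof. by apply: Rintegral_ge0 => x _; rewrite -expr2 sqr_ge0. Qed.

Lemma ipE f : L2 f -> (\int[mu]_x ((f x ^+ 2)%:E))%E = (ip f f)%:E.
Proof.
move=> [mf f2]; rewrite /ip /Rintegral fineK.
  by apply: eq_integral => x _; rewrite expr2.
have := integrable_fin_num measurableT f2.
by congr (_ \is a fin_num); apply: eq_integral => x _ /=; rewrite expr2.
Qed.

Lemma L2_intro f : measurable_fun [set: R] f ->
  (\int[mu]_x ((f x ^+ 2)%:E) < +oo)%E -> L2 f.
Proof.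
move=> mf f2; split => //; apply/integrableP; split.
  by apply/measurable_EFinP; exact: measurable_sqr.
apply: le_lt_trans f2; rewrite le_eqVlt; apply/orP; left; apply/eqP.
by apply: eq_integral => x _ /=; rewrite ger0_norm ?sqr_ge0.
Qed.

Lemma ip_ae f1 f2 g : measurable_fun [set: R] f1 -> measurable_fun [set: R] f2 ->
  measurable_fun [set: R] g -> {ae mu, forall x, f1 x = f2 x} -> ip f1 g = ip f2 g.
Proof.
move=> m1 m2 mg f12; congr fine; apply: ae_eq_integral => //.
- by apply/measurable_EFinP; exact: measurable_funM.
- by apply/measurable_EFinP; exact: measurable_funM.
by apply: (aeS f12) => x /= -> _.
Qed.

Lemma L2_ae f1 f2 : measurable_fun [set: R] f2 -> L2 f1 ->
  {ae mu, forall x, f1 x = f2 x} -> L2 f2.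
Proof.
move=> m2 [m1 L1] f12; apply: L2_intro => //.
rewrite -(@ae_eq_integral _ _ _ mu _ _ (fun x => (f1 x ^+ 2)%:E)) => //.
- by rewrite ipE// ltry.
- by apply/measurable_EFinP; exact: measurable_sqr.
- by apply/measurable_EFinP; exact: measurable_sqr.
by apply: (aeS f12) => x /= -> _.
Qed.

Lemma L2_bounded_mul (M : R) f g : measurable_fun [set: R] f -> (forall x, `|f x| <= M) ->
  L2 g -> L2 (fun x => f x * g x).
Proof.
move=> mf fM [mg g2]; split; first exact: measurable_funM.
have := integrableZl measurableT (M ^+ 2) g2; apply: le_integrable => //.
  apply/measurable_EFinP; exact: (measurable_sqr (measurable_funM mf mg)).
move=> x _ /=; rewrite lee_fin (ger0_norm (sqr_ge0 _)) (@ger0_norm _ (_ * _)) ?(mulr_ge0 (sqr_ge0 _) (sqr_ge0 _))// exprMn.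
rewrite ler_wpM2r ?sqr_ge0// -real_normK ?num_real// ler_sqr ?nnegrE//.
exact: le_trans (fM x).
Qed.

Lemma ip_bounded_mul (M : R) f g : measurable_fun [set: R] f -> (forall x, `|f x| <= M) ->
  L2 g -> ip (fun x => f x * g x) (fun x => f x * g x) <= M ^+ 2 * ip g g.
Proof.
move=> mf fM Lg; have Lfg := L2_bounded_mul mf fM Lg.
rewrite -RintegralZl//; last exact: L2_mul.
apply: le_Rintegral => //; first exact: L2_mul.
  have := integrableZl measurableT (M ^+ 2) (L2_mul Lg Lg).
  by apply: eq_integrable => // x _ /=; rewrite EFinM.
move=> x _; rewrite -!expr2 exprMn.
rewrite ler_wpM2r ?sqr_ge0// -real_normK ?num_real// ler_sqr ?nnegrE//.
exact: le_trans (fM x).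
Qed.

Lemma discriminant (a b c : R) : 0 <= a -> 0 <= c ->
  (forall s, 0 <= a + 2 * s * b + s ^+ 2 * c) -> b ^+ 2 <= a * c.
Proof.
move=> a0 c0 H.
have [v0|v0] := eqVneq c 0.
  have [->|b0] := eqVneq b 0; first by rewrite expr0n/= mulr_ge0.
  have := H (- (a + 1) / (2 * b)); rewrite v0 mulr0 addr0.
  have -> : 2 * (- (a + 1) / (2 * b)) * b = - (a + 1) by field; rewrite b0.
  lra.
have vp : 0 < c by rewrite lt_neqAle eq_sym v0.
have := H (- b / c).
have -> : a + 2 * (- b / c) * b + (- b / c) ^+ 2 * c = (a * c - b ^+ 2) / c by field.
by rewrite pmulr_lge0 ?invr_gt0// subr_ge0.
Qed.

Lemma integrable_itvD f g a b : mu.-integrable `[a, b] (EFin \o f) ->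
  mu.-integrable `[a, b] (EFin \o g) ->
  mu.-integrable `[a, b] (EFin \o (fun x => f x + g x)).
Proof. by move=> i1 i2; apply: (integrableD _ i1 i2); exact: measurable_itv. Qed.

Lemma integrable_itvZ (c : R) f a b : mu.-integrable `[a, b] (EFin \o f) ->
  mu.-integrable `[a, b] (EFin \o (fun x => c * f x)).
Proof. by move=> i1; apply: (integrableZl _ c i1); exact: measurable_itv. Qed.

Lemma L2_integrable_itv g a b : L2 g -> mu.-integrable `[a, b] (EFin \o g).
Proof.
move=> [mg g2].
have i1 : mu.-integrable `[a, b] (EFin \o (fun x => g x ^+ 2)).
  exact: integrableS g2.
have i2 : mu.-integrable `[a, b] (EFin \o (cst (1 : R))).
  by apply: continuous_integrable_itv => t _; exact: cst_continuous.
have := integrable_itvD i2 i1; apply: le_integrable => //.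
  by apply/measurable_EFinP; exact: measurable_funS mg.
move=> x _ /=; rewrite lee_fin [leRHS]ger0_norm; last by rewrite addr_ge0 ?sqr_ge0.
rewrite -(real_normK (num_real (g x))); have := sqr_ge0 (`|g x| - 1); nra.
Qed.

Lemma L2_sqr_itv g a b : L2 g -> mu.-integrable `[a, b] (EFin \o (fun x => g x ^+ 2)).
Proof. by move=> [mg g2]; exact: integrableS g2. Qed.

Lemma sqr_itv_le g a b : L2 g -> \int[mu]_(x in `[a, b]) (g x ^+ 2) <= ip g g.
Proof.
move=> Lg; rewrite -lee_fin -ipE//.
rewrite /Rintegral fineK; last first.
  by apply: (integrable_fin_num _ (L2_sqr_itv a b Lg)); exact: measurable_itv.
apply: ge0_subset_integral => //; first by case: Lg => ? /integrableP[].
by move=> x _; rewrite lee_fin sqr_ge0.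
Qed.

Lemma Rintegral_itv_cst a b (c : R) : a <= b -> \int[mu]_(x in `[a, b]) c = c * (b - a).
Proof.
rewrite le_eqVlt => /predU1P[->|ab].
  by rewrite set_itv1 Rintegral_set1 subrr mulr0.
rewrite Rintegral_cst; last exact: measurable_itv.
by have := @lebesgue_measure_itv R `[a, b]; rewrite /= lte_fin ab => ->.
Qed.

(** Cauchy-Schwarz against the constant 1, from the nonnegative integral of [(1 + s * g x) ^+ 2]. *)
Lemma integral_sqr_le g a b : a <= b -> L2 g ->
  (\int[mu]_(x in `[a, b]) g x) ^+ 2 <= (b - a) * \int[mu]_(x in `[a, b]) (g x ^+ 2).
Proof.
move=> ab Lg; have i1 := L2_integrable_itv a b Lg; have i2 := L2_sqr_itv a b Lg.
have i0 (c : R) : mu.-integrable `[a, b] (EFin \o (cst c)).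
  by apply: continuous_integrable_itv => t _; exact: cst_continuous.
apply: discriminant; first by rewrite subr_ge0.
  by apply: Rintegral_ge0 => x _; rewrite sqr_ge0.
move=> s.
have i3 : mu.-integrable `[a, b] (EFin \o (fun x => 2 * s * g x)).
  exact: integrable_itvZ.
have i4 : mu.-integrable `[a, b] (EFin \o (fun x => s ^+ 2 * g x ^+ 2)).
  exact: integrable_itvZ.
have i5 : mu.-integrable `[a, b] (EFin \o (fun x => 1 + 2 * s * g x)).
  exact: (integrable_itvD (i0 1) i3).
have -> : b - a + 2 * s * \int[mu]_(x in `[a, b]) g x +
    s ^+ 2 * \int[mu]_(x in `[a, b]) (g x ^+ 2) =
    \int[mu]_(x in `[a, b]) (1 + 2 * s * g x + s ^+ 2 * g x ^+ 2).
  rewrite RintegralD// (RintegralD _ (i0 1) i3)// RintegralZl// RintegralZl//.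
  by rewrite (Rintegral_itv_cst 1 ab) mul1r.
apply: Rintegral_ge0 => x _; have := sqr_ge0 (1 + s * g x); nra.
Qed.

Lemma normr_integral_le g a b : a <= b -> L2 g ->
  `|\int[mu]_(x in `[a, b]) g x| <= Num.sqrt (b - a) * Num.sqrt (ip g g).
Proof.
move=> ab Lg; rewrite -sqrtrM ?subr_ge0// -sqrtr_sqr; apply: ler_wsqrtr.
apply: le_trans (integral_sqr_le ab Lg) _.
by rewrite ler_wpM2l ?subr_ge0 ?sqr_itv_le.
Qed.

Lemma Rintegral_itv_split f a b c : a <= b -> b <= c -> mu.-integrable `[a, c] (EFin \o f) ->
  \int[mu]_(x in `[a, c]) f x = \int[mu]_(x in `[a, b]) f x + \int[mu]_(x in `[b, c]) f x.
Proof.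
move=> ab bc fi; have := @Rintegral_itvB _ f (BLeft a) (BRight c) b fi.
rewrite !bnd_simp => /(_ ab bc) H.
rewrite -(@Rintegral_itv_obnd_cbnd _ b (BRight c)).
  by rewrite -H addrC subrK.
apply: integrableS fi; try exact: measurable_itv.
by move=> x /=; rewrite !in_itv/= => /andP[bx ->]; rewrite (le_trans ab (ltW bx)).
Qed.

Lemma L2_locally_integrable f : L2 f -> locally_integrable [set: R] f.
Proof.
move=> Lf; have [mf _] := Lf; split => //; first exact: openT.
move=> K _ cK; have [M [_ HM]] := compact_bounded cK.
have KM : K `<=` `[- (`|M| + 1), `|M| + 1].
  move=> x Kx /=; rewrite in_itv/= -ler_norml; apply: HM => //.
  by have := ler_norm M; lra.
have /integrableP[_ +] := L2_integrable_itv (- (`|M| + 1)) (`|M| + 1) Lf.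
apply: le_lt_trans; apply: ge0_subset_integral => //; first exact: compact_measurable.
by apply/measurable_EFinP/measurableT_comp => //; exact: measurable_funS mf.
Qed.

(** By Lebesgue differentiation [f] is, almost everywhere on each half line after [-n], the
    derivative of its primitive, which vanishes; countably many half lines cover R. *)
Lemma primitive0_ae f : locally_integrable [set: R] f ->
  (forall a b, a <= b -> \int[mu]_(x in `[a, b]) f x = 0) ->
  {ae mu, forall x, f x = 0}.
Proof.
move=> lf f0.
have fi a b : mu.-integrable `[a, b] (EFin \o f).
  have [mf _ lfi] := lf; apply/integrableP; split.
    by apply/measurable_EFinP; exact: measurable_funS mf.
  by apply: lfi => //; exact: segment_compact.
have H (n : nat) : {ae mu, forall x, - n%:R < x -> f x = 0}.
  have H0 := @FTC1 _ f (BLeft (- n%:R)) (fun y => fi _ y) lf.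
  apply: (aeS H0) => x /= H nx.
  have [] := H _; first by rewrite lte_fin.
  move=> _ <-; rewrite -(derive1_cst (0 : R) x).
  rewrite !derive1E; apply: near_eq_derive.
  near=> y; apply: f0; apply/ltW; near: y.
  exact: lt_nbhsr.
apply: (aeS (ae_foralln H)) => x Hx.
apply: (Hx (Num.trunc `|x|).+1).
rewrite ltrNl; apply: le_lt_trans (ler_norm _) _; rewrite normrN.
exact: truncnS_gt.
Unshelve. all: by end_near. Qed.

End SquareIntegrable.

(** * Completeness of L^2 *)

Section RieszFischer.
Context {R : realType}.
Local Notation mu := (@lebesgue_measure R).

Definition sqdist (f g : R -> R) : R := ip (fun x => f x - g x) (fun x => f x - g x).

Lemma geometric_cvg (a : nat -> R) (C : R) :
  (forall k, `|a k.+1 - a k| <= C / 2 ^+ k) -> cvgn a.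
Proof.
move=> Ha.
have H n k : `|a (n + k)%N - a n| <= 2 * C / 2 ^+ n - 2 * C / 2 ^+ (n + k).
  elim: k => [|k IH]; first by rewrite addn0 !subrr normr0.
  rewrite addnS; have := Ha (n + k)%N.
  have -> : 2 * C / 2 ^+ (n + k).+1 = C / 2 ^+ (n + k).
    by rewrite exprS; field; rewrite expf_neq0.
  have E2 : 2 * C / 2 ^+ (n + k) = C / 2 ^+ (n + k) + C / 2 ^+ (n + k) by ring.
  have := ler_normD (a (n + k).+1 - a (n + k)%N) (a (n + k)%N - a n).
  by rewrite subrKA; move: IH; rewrite E2; lra.
have C0 : 0 <= C by have := Ha 0%N; rewrite expr0 divr1; exact: le_trans.
apply/cauchy_cvgP/cauchy_exP => e e0.
pose n := (Num.trunc (2 * C / e)).+1.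
exists (a n); exists n => // m /= nm.
rewrite /ball/= distrC -(subnKC nm); apply: le_lt_trans (H _ _) _.
apply: (@le_lt_trans _ _ (2 * C / 2 ^+ n)).
  by rewrite gerBl divr_ge0 ?mulr_ge0 ?exprn_ge0.
rewrite ltr_pdivrMr ?exprn_gt0// [ltRHS]mulrC -ltr_pdivrMr//.
apply: lt_trans (truncnS_gt _) _; rewrite -/n.
by rewrite -natrX ltr_nat ltn_expl.
Qed.

Lemma limn_einf_le (u : nat -> \bar R) (c : \bar R) :
  (forall n, (u n <= c)%E) -> (limn_einf u <= c)%E.
Proof.
move=> uc; rewrite limn_einf_lim; apply: lime_le; first exact: is_cvg_einfs.
by apply: nearW => n; apply: le_trans (uc n); apply: ereal_inf_lbound; exists n => /=.
Qed.

(** The series of [4 ^+ k * d k x ^+ 2] has integral at most the sum of 4^k 8^-k, which is 2, so it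
    is finite almost everywhere; [C] is the square root of its value. *)
Lemma weighted_sum_integrable (d : nat -> R -> R) : (forall k, L2 (d k)) ->
  (forall k, ip (d k) (d k) <= 8 ^- k) ->
  {ae mu, forall x, exists C, forall k, `|d k x| <= C / 2 ^+ k}.
Proof.
move=> Ld dk.
pose u k x := (4 ^+ k * d k x ^+ 2)%:E.
have mu_k k : measurable_fun [set: R] (u k).
  apply/measurable_EFinP; apply: measurable_funM => //.
  by apply: measurable_sqr; have [] := Ld k.
have u0 k x : (0 <= u k x)%E by rewrite lee_fin mulr_ge0 ?sqr_ge0 ?exprn_ge0.
pose S x := (\sum_(0 <= k <oo) u k x)%E.
have S0 x : (0 <= S x)%E by apply: nneseries_ge0 => k _ _; exact: u0.
have mS : measurable_fun [set: R] S.
  by apply: ge0_emeasurable_sum => k // x _ _; exact: u0.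
have Sfin : (\int[mu]_x S x <= 2%:E)%E.
  rewrite integral_nneseries//.
  have intk k : (\int[mu]_x u k x)%E = (4 ^+ k * ip (d k) (d k))%:E.
    rewrite EFinM -ipE// -ge0_integralZl//.
    - by apply/measurable_EFinP; exact: (measurable_sqr (proj1 (Ld k))).
    - by move=> x _; rewrite lee_fin sqr_ge0.
  apply: lime_le; first by apply: is_cvg_nneseries => k _ _; apply: integral_ge0.
  apply: nearW => n.
  have : forall n, (\sum_(0 <= k < n) \int[mu]_x u k x <= (2 - 2 / 2 ^+ n)%:E)%E.
    elim=> [|m IH]; first by rewrite big_geq// expr0 divr1 subrr.
    rewrite big_nat_recr//= intk; apply: le_trans (leeD IH (lexx _)) _.
    rewrite -EFinD lee_fin.
    have p2 : 0 < 2 ^+ m :> R by rewrite exprn_gt0.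
    have : 4 ^+ m * ip (d m) (d m) <= 1 / 2 ^+ m.
      apply: (@le_trans _ _ (4 ^+ m * 8 ^- m)); first by rewrite ler_wpM2l ?exprn_ge0.
      rewrite (_ : 8 = 4 * 2); last by ring.
      by rewrite exprMn invfM mulrA divff ?expf_neq0// ?pnatr_eq0.
    have : 2 / 2 ^+ m.+1 = 1 / 2 ^+ m :> R by rewrite exprS; field; rewrite gt_eqF.
    have : 2 / 2 ^+ m = 1 / 2 ^+ m + 1 / 2 ^+ m :> R by ring.
    lra.
  move=> /(_ n) /le_trans; apply; rewrite lee_fin gerBl.
  by rewrite divr_ge0 ?exprn_ge0.
have iS : mu.-integrable [set: R] S.
  apply/integrableP; split => //; under eq_integral do rewrite gee0_abs//.
  by apply: le_lt_trans Sfin _; rewrite ltry.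
apply: (aeS (integrable_ae measurableT iS)) => x /(_ I) Sx.
exists (Num.sqrt (fine (S x))) => k.
have : (u k x <= S x)%E.
  rewrite /S (@nneseriesD1 _ (u^~ x) k xpredT)//.
  by rewrite leeDl// nneseries_ge0// => *; exact: u0.
rewrite -(fineK Sx) lee_fin => H.
rewrite ler_pdivlMr ?exprn_gt0// -[leLHS]ger0_norm; last by rewrite mulr_ge0 ?exprn_ge0.
rewrite -sqrtr_sqr; apply: ler_wsqrtr; apply: le_trans H.
rewrite exprMn real_normK ?num_real// -exprM mulnC exprM mulrC.
by rewrite (_ : 2 ^+ 2 = 4) //; ring.
Qed.

Lemma L2_fatou (u : nat -> R -> R) (f : R -> R) (c : R) : (forall j, L2 (u j)) ->
  measurable_fun [set: R] f -> {ae mu, forall x, u^~ x @ \oo --> f x} ->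
  (forall j, ip (u j) (u j) <= c) -> L2 f /\ ip f f <= c.
Proof.
move=> Lu mf uf uc; pose v j x := (u j x ^+ 2)%:E.
have mv j : measurable_fun [set: R] (v j).
  by apply/measurable_EFinP; exact: (measurable_sqr (Lu j).1).
have v0 j x : [set: R] x -> (0 <= v j x)%E by rewrite lee_fin sqr_ge0.
have E : (\int[mu]_x ((f x ^+ 2)%:E) = \int[mu]_x limn_einf (v^~ x))%E.
  apply: ae_eq_integral => //.
  - by apply/measurable_EFinP; exact: (measurable_sqr mf).
  - have -> : (fun x => limn_einf (v^~ x)) = (fun x => - limn_esup (-%E \o v^~ x))%E.
      by apply/funext => x; rewrite limn_esupN oppeK.
    apply: measurableT_comp => //; apply: (measurable_fun_limn_esup (f := fun j x => (- v j x)%E)).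
    by move=> j; exact: measurableT_comp.
  - apply: (aeS uf) => x fx _; apply/esym.
    apply: (cvg_limn_einf_sup (u := v^~ x) _).1.
    apply: cvg_EFin; first exact: nearW.
    exact: (cvgM fx fx).
have le : (\int[mu]_x ((f x ^+ 2)%:E) <= c%:E)%E.
  rewrite E; apply: le_trans (fatou mu measurableT mv v0) _.
  by apply: limn_einf_le => j; rewrite ipE// lee_fin.
have Lf : L2 f by apply: L2_intro => //; apply: le_lt_trans le _; rewrite ltry.
by split => //; rewrite -lee_fin -ipE.
Qed.

Lemma riesz_fischer (f : nat -> R -> R) : (forall n, L2 (f n)) ->
  (forall e, 0 < e -> exists N, forall m n, (N <= m)%N -> (N <= n)%N ->
     sqdist (f m) (f n) <= e) ->
  exists2 g, L2 g & forall e, 0 < e -> exists N, forall n, (N <= n)%N ->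
     sqdist (f n) g <= e.
Proof.
move=> Lf fC.
have /choice[p pP] : forall k : nat, exists N, forall m n, (N <= m)%N -> (N <= n)%N ->
    sqdist (f m) (f n) <= 8 ^- k.
  by move=> k; apply: fC; rewrite invr_gt0 exprn_gt0.
pose s k := (\sum_(j < k.+1) p j)%N.
have sp k : (p k <= s k)%N by rewrite /s big_ord_recr leq_addl.
have ss k : (s k <= s k.+1)%N by rewrite /s [leqRHS]big_ord_recr leq_addr.
have cvg_ae : {ae mu, forall x, cvgn (fun k => f (s k) x)}.
  have H := @weighted_sum_integrable (fun k x => f (s k.+1) x - f (s k) x) _ _.
  apply: (aeS (H _ _)).
  - by move=> k; exact: L2B.
  - by move=> k; apply: pP; [exact: leq_trans (ss k)|].
  - by move=> x [C HC]; exact: geometric_cvg HC.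
(* An upper limit is measurable without exceptional sets and equals the limit wherever that
   exists. *)
pose g x := fine (limn_esup (fun k => (f (s k) x)%:E)).
have mf n : measurable_fun [set: R] (f n) by have [] := Lf n.
have mg : measurable_fun [set: R] g.
  apply: (measurableT_comp (fine_measurable measurableT)).
  by apply: measurable_fun_limn_esup => n; apply/measurable_EFinP.
have fg : {ae mu, forall x, (fun k => f (s k) x) @ \oo --> g x}.
  apply: (aeS cvg_ae) => x cx.
  suff -> : g x = limn (fun k => f (s k) x) by exact: cx.
  rewrite /g; have : (fun k => (f (s k) x)%:E) @ \oo --> (limn (fun k => f (s k) x))%:E.
    by apply: cvg_EFin => //; exact: nearW.
  by move=> /cvg_limn_einf_sup[_ ->].
have le_s k i : (s k <= s (k + i)%N)%N.
  by elim: i => [|i IH]; rewrite ?addn0// addnS; exact: leq_trans IH (ss _).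
have key k n : (p k <= n)%N -> L2 (fun x => f n x - g x) /\ sqdist (f n) g <= 8 ^- k.
  move=> pn; apply: (@L2_fatou (fun j x => f n x - f (s (k + j)%N) x)).
  - by move=> j; exact: L2B.
  - exact: measurable_funB.
  - apply: (aeS fg) => x fx; apply: cvgB; first exact: cvg_cst.
    by have := fx; rewrite -(cvg_shiftn k); under eq_fun do rewrite addnC.
  - by move=> j; apply: pP => //; apply: leq_trans (sp _) (le_s _ _).
exists g.
  have := L2B (Lf (p 0%N)) (key _ _ (leqnn (p 0%N))).1; congr L2.
  by apply/funext => x; rewrite opprB addrC subrK.
move=> e e0.
have [k Hk] : exists k, 8 ^- k <= e.
  have [N HN] := invn_lt e0; exists N; apply: le_trans (ltW (HN _ (leqnn _))).
  rewrite lef_pV2 ?posrE ?exprn_gt0// -natrX ler_nat.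
  by apply: ltn_expl.
by exists (p k) => n /key[_ /le_trans]; apply.
Qed.

End RieszFischer.

(** * The space H^1 *)

Section Primitives.
Context {R : realType}.
Local Notation mu := (@lebesgue_measure R).
Implicit Types f g k l : R -> R.

(** Integral form of f' = g, with [f] fixed at every point and [g] relevant up to null sets. Square
    integrability is asked of [g] alone, so constants plus H^1 functions are included. *)
Definition prim f g := L2 g /\
  forall x y, x <= y -> f y - f x = \int[mu]_(t in `[x, y]) g t.

Lemma prim_holder f g x y : prim f g ->
  `|f y - f x| <= Num.sqrt `|y - x| * Num.sqrt (ip g g).
Proof.
move=> [Lg fg]; wlog xy : x y / x <= y.
  by move=> H; have [/H//|/ltW/H] := leP x y; rewrite distrC (distrC x).
by rewrite fg// (@ger0_norm _ (y - x)) ?subr_ge0// normr_integral_le.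
Qed.

Lemma prim_continuous f g : prim f g -> forall x, {for x, continuous f}.
Proof.
move=> pf x; apply/continuous_epsP => e e0.
pose c := Num.sqrt (ip g g) + 1.
have c0 : 0 < c by rewrite ltr_wpDl ?sqrtr_ge0.
exists ((e / c) ^+ 2); first by rewrite exprn_gt0// divr_gt0.
move=> s sx; apply: le_lt_trans (prim_holder x s pf) _.
have h1 : Num.sqrt `|s - x| < e / c.
  by rewrite -[ltRHS]gtr0_norm ?divr_gt0// -(sqrtr_sqr (e / c)) ltr_sqrt// exprn_gt0// divr_gt0.
apply: (@le_lt_trans _ _ (Num.sqrt `|s - x| * c)).
  by rewrite ler_wpM2l ?sqrtr_ge0// /c lerDl.
by rewrite -ltr_pdivlMr.
Qed.

Lemma prim_measurable f g : prim f g -> measurable_fun [set: R] f.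
Proof.
move=> pf; apply: continuous_measurable_fun => x; exact: prim_continuous pf x.
Qed.

Lemma prim_lin (a : R) f g k l : prim f g -> prim k l ->
  prim (fun x => a * f x + k x) (fun x => a * g x + l x).
Proof.
move=> [Lg fg] [Ll kl]; split; first exact: L2_lin.
move=> x y xy; rewrite RintegralD//; last 2 first.
- exact/integrable_itvZ/L2_integrable_itv.
- exact: L2_integrable_itv.
rewrite RintegralZl//; last exact: L2_integrable_itv.
by rewrite -fg// -kl//; ring.
Qed.

Lemma prim_ae f g g' : prim f g -> prim f g' -> {ae mu, forall x, g x = g' x}.
Proof.
move=> [Lg fg] [Lg' fg'].
have : {ae mu, forall x, g x - g' x = 0}.
  apply: primitive0_ae; first by apply: L2_locally_integrable; exact: L2B.
  move=> a b ab; rewrite RintegralB//; try exact: L2_integrable_itv.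
  by rewrite -fg// -fg'// subrr.
by move=> H; apply: (aeS H) => x /eqP; rewrite subr_eq0 => /eqP.
Qed.

(** On [[x, x + 1]] the oscillation of [f] is at most the L^2 norm of [g]; averaging
    [f x ^+ 2 <= 2 f y ^+ 2 + 2 ip g g] over [y] gives the bound. *)
Lemma prim_sup f g x : L2 f -> prim f g -> f x ^+ 2 <= 2 * (ip f f + ip g g).
Proof.
move=> Lf pf; have [Lg _] := pf.
have x1 : x <= x + 1 by rewrite lerDl.
have i0 c : mu.-integrable `[x, x + 1] (EFin \o (cst (c : R))).
  by apply: continuous_integrable_itv => t _; exact: cst_continuous.
have i1 : mu.-integrable `[x, x + 1] (EFin \o (fun y => 2 * f y ^+ 2 + cst (2 * ip g g) y)).
  apply: integrable_itvD => //; apply: integrable_itvZ; exact: L2_sqr_itv.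
have : \int[mu]_(y in `[x, x + 1]) (cst (f x ^+ 2) y) <=
   \int[mu]_(y in `[x, x + 1]) (2 * f y ^+ 2 + cst (2 * ip g g) y).
  apply: le_Rintegral => // y /=; rewrite in_itv/= => /andP[xy y1].
  have : (f y - f x) ^+ 2 <= ip g g.
    rewrite -(sqr_sqrtr (ip_ge0 g)) -real_normK ?num_real// ler_sqr ?nnegrE ?sqrtr_ge0//.
    apply: le_trans (prim_holder x y pf) _; rewrite ler_piMl ?sqrtr_ge0//.
    by rewrite -sqrtr1 ler_wsqrtr// ger0_norm ?subr_ge0//; lra.
  have := sqr_ge0 (f y + (f y - f x)); lra.
rewrite Rintegral_itv_cst// RintegralD//; last first.
  by apply: integrable_itvZ; exact: L2_sqr_itv.
rewrite Rintegral_itv_cst// RintegralZl//; last exact: L2_sqr_itv.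
have := sqr_itv_le x (x + 1) Lf; lra.
Qed.

(** The product rule without pointwise derivatives: the defect [D] is additive over intervals and on
    an interval of length c is at most sqrt c times an additive quantity. Fine subdivisions force it
    to vanish. *)
Lemma prim_mul f g k l : prim f g -> prim k l ->
  L2 (fun x => k x * g x) -> L2 (fun x => f x * l x) ->
  prim (fun x => f x * k x) (fun x => k x * g x + f x * l x).
Proof.
move=> pf pk Lkg Lfl; have [Lg fg] := pf; have [Ll kl] := pk.
pose q x := k x * g x + f x * l x.
have Lq : L2 q by exact: L2D.
pose a x := `|g x| + `|l x|.
have ia x y : mu.-integrable `[x, y] (EFin \o a).
  apply: (integrable_itvD (f := fun x => `|g x|) (g := fun x => `|l x|)).
    by apply/integrable_norm/L2_integrable_itv.
  by apply/integrable_norm/L2_integrable_itv.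
pose D x y := f y * k y - f x * k x - \int[mu]_(t in `[x, y]) q t.
pose w := Num.sqrt (ip g g) + Num.sqrt (ip l l).
have w0 : 0 <= w by rewrite addr_ge0 ?sqrtr_ge0.
have step x y : x <= y ->
    `|D x y| <= w * Num.sqrt (y - x) * \int[mu]_(t in `[x, y]) a t.
  move=> xy.
  have ig := L2_integrable_itv x y Lg; have il := L2_integrable_itv x y Ll.
  have iq := L2_integrable_itv x y Lq.
  have ip1 : mu.-integrable `[x, y] (EFin \o (fun t => k x * g t + f y * l t)).
    by apply: integrable_itvD; exact: integrable_itvZ.
  have -> : D x y = \int[mu]_(t in `[x, y]) ((k x * g t + f y * l t) - q t).
    rewrite RintegralB// RintegralD//; try exact: integrable_itvZ.
    rewrite RintegralZl// RintegralZl// -fg// -kl// /D; ring.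
  have i3 : mu.-integrable `[x, y] (EFin \o (fun t => (k x * g t + f y * l t) - q t)).
    have := integrable_itvD ip1 (integrable_itvZ (-1) iq).
    by apply: eq_integrable => // t _ /=; rewrite mulN1r.
  apply: le_trans (le_normr_Rintegral _ i3) _ => //.
  rewrite -RintegralZl//; apply: le_Rintegral => //.
  - exact: integrable_norm.
  - exact: integrable_itvZ.
  move=> t /=; rewrite in_itv/= => /andP[xt ty].
  have -> : k x * g t + f y * l t - q t = (k x - k t) * g t + (f y - f t) * l t.
    by rewrite /q; ring.
  have sq (z c : R) : `|z| <= y - x -> 0 <= c -> c <= w ->
      Num.sqrt `|z| * c <= w * Num.sqrt (y - x).
    by move=> zxy c0 cw; rewrite mulrC; apply: ler_pM => //; rewrite ?sqrtr_ge0 ?ler_wsqrtr.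
  have h1 : `|k x - k t| <= w * Num.sqrt (y - x).
    apply: le_trans (prim_holder t x pk) _; apply: sq; rewrite ?sqrtr_ge0//.
      by rewrite distrC ger0_norm ?subr_ge0//; lra.
    by rewrite /w lerDr sqrtr_ge0.
  have h2 : `|f y - f t| <= w * Num.sqrt (y - x).
    apply: le_trans (prim_holder t y pf) _; apply: sq; rewrite ?sqrtr_ge0//.
      by rewrite ger0_norm ?subr_ge0//; lra.
    by rewrite /w lerDl sqrtr_ge0.
  rewrite /a mulrDr; apply: le_trans (ler_normD _ _) _.
  by apply: lerD; rewrite normrM ler_wpM2r.
have split3 x y z : x <= y -> y <= z -> D x z = D x y + D y z.
  move=> xy yz; rewrite /D (Rintegral_itv_split xy yz); first ring.
  exact: L2_integrable_itv.
have iter n x c : 0 <= c -> `|D x (x + n%:R * c)| <=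
    w * Num.sqrt c * \int[mu]_(t in `[x, (x + n%:R * c)]) a t.
  move=> c0; elim: n => [|n IH].
    rewrite mul0r addr0 /D set_itv1 !Rintegral_set1 !subrr normr0 mulr0//.
  have e1 : x <= x + n%:R * c by rewrite lerDl mulr_ge0.
  have e2 : x + n%:R * c <= x + n.+1%:R * c by rewrite lerD2l ler_wpM2r// ler_nat.
  rewrite (split3 _ _ _ e1 e2) (Rintegral_itv_split e1 e2)// mulrDr.
  apply: le_trans (ler_normD _ _) _; apply: lerD => //.
  apply: le_trans (step _ _ e2) _.
  have -> : x + n.+1%:R * c - (x + n%:R * c) = c by rewrite -natr1; ring.
  by [].
split => // x y xy; apply/eqP; rewrite -subr_eq0 -normr_le0.
apply/ler_addgt0Pr => e e0; rewrite add0r.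
pose A := w * \int[mu]_(t in `[x, y]) a t.
have A0 : 0 <= A.
  by rewrite mulr_ge0//; apply: Rintegral_ge0 => t _; rewrite addr_ge0.
pose b := (e / (A + 1)) ^+ 2.
have b0 : 0 < b by rewrite exprn_gt0// divr_gt0// ltr_wpDl.
pose n := (Num.trunc ((y - x) / b)).+1.
pose c := (y - x) / n%:R.
have c0 : 0 <= c by rewrite divr_ge0// subr_ge0.
have nc : x + n%:R * c = y by rewrite /c mulrCA divff ?pnatr_eq0// mulr1 addrC subrK.
have cb : c <= b.
  rewrite /c ler_pdivrMr ?ltr0n// mulrC -ler_pdivrMr//.
  by apply/ltW; exact: truncnS_gt.
have := iter n x c c0; rewrite nc => /le_trans; apply.
have -> : w * Num.sqrt c * \int[mu]_(t in `[x, y]) a t = Num.sqrt c * A by rewrite /A; ring.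
apply: (@le_trans _ _ (e / (A + 1) * (A + 1))); last by rewrite divfK// gt_eqF// ltr_wpDl.
apply: ler_pM => //; rewrite ?sqrtr_ge0 ?lerDl//.
rewrite -[leRHS]gtr0_norm ?divr_gt0 ?ltr_wpDl// -sqrtr_sqr.
exact: ler_wsqrtr.
Qed.

End Primitives.

(** * H^1 as a space of continuous functions *)

Section H1Space.
Context {R : realType}.
Local Notation mu := (@lebesgue_measure R).

Definition H1c (f : R -> R) := L2 f /\ exists g, prim f g.

(** The codomain [R^o] makes functions an [R]-module, from which H^1 inherits its vector space
    structure as a submodule. *)
Definition H1pred : {pred R -> R^o} := [pred f | `[< H1c f >]].

Lemma H1predP (f : R -> R) : reflect (H1c f) ((f : R -> R^o) \in H1pred).
Proof. by rewrite inE; exact: asboolP. Qed.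

Lemma H1_submod_closed : submod_closed H1pred.
Proof.
split.
  apply/H1predP; split; first exact: L2_0.
  exists (fun=> 0); split; first exact: L2_0.
  by move=> x y xy; rewrite Rintegral_itv_cst// mul0r subrr.
move=> a f g /H1predP[Lf [f' pf]] /H1predP[Lg [g' pg]]; apply/H1predP; split.
  exact: L2_lin.
by exists (fun x => a * f' x + g' x); exact: prim_lin.
Qed.

HB.instance Definition _ := GRing.isSubmodClosed.Build R (R -> R^o) H1pred
  H1_submod_closed.

Record H1 := MkH1 { H1fun :> R -> R^o ; _ : H1fun \in H1pred }.

HB.instance Definition _ := [isSub for H1fun].
HB.instance Definition _ := [Choice of H1 by <:].
HB.instance Definition _ := [SubChoice_isSubLmodule of H1 by <:].

End H1Space.
Arguments H1 : clear implicits.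

Section H1Theory.
Context {R : realType}.
Local Notation mu := (@lebesgue_measure R).
Implicit Types u v w : H1 R.

Lemma H1P u : H1c u.
Proof. by case: u => f /= /H1predP. Qed.

Lemma H1_L2 u : L2 u. Proof. by have [] := H1P u. Qed.

(** A chosen derivative, hence linear in [u] only up to null sets; [ip_ae2] absorbs these in every
    product. *)
Definition dv u : R -> R := sval (cid (H1P u).2).

Lemma dvP u : prim u (dv u). Proof. exact: (svalP (cid (H1P u).2)). Qed.

Lemma dv_L2 u : L2 (dv u). Proof. by have [] := dvP u. Qed.

Lemma H1_eq u v : (forall x, u x = v x) -> u = v.
Proof. by move=> uv; apply: val_inj; apply/funext => x; exact: uv. Qed.

Lemma H1_exists (f g : R -> R) : L2 f -> prim f g -> exists u, forall x, u x = f x.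
Proof.
move=> Lf pf; have Hf : (f : R -> R^o) \in H1pred by apply/H1predP; split => //; exists g.
by exists (MkH1 Hf).
Qed.

Lemma dv_ae u (f g : R -> R) : prim f g -> (forall x, u x = f x) ->
  {ae mu, forall x, dv u x = g x}.
Proof.
move=> [Lg fg] uf; apply: (prim_ae (f := u)); first exact: dvP.
by split => // x y xy; rewrite !uf fg.
Qed.

Lemma dv_lin (a : R) u v : {ae mu, forall x, dv (a *: u + v) x = a * dv u x + dv v x}.
Proof. exact: dv_ae (prim_lin a (dvP u) (dvP v)) _. Qed.

Lemma ip_ae2 (f1 f2 g1 g2 : R -> R) : L2 f1 -> L2 f2 -> L2 g1 -> L2 g2 ->
  {ae mu, forall x, f1 x = f2 x} -> {ae mu, forall x, g1 x = g2 x} -> ip f1 g1 = ip f2 g2.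
Proof.
move=> [mf1 _] [mf2 _] [mg1 _] [mg2 _] f12 g12.
by rewrite (ip_ae mf1 mf2 mg1 f12) ipC (ip_ae mg1 mg2 mf2 g12) ipC.
Qed.

Lemma h0_lin (a : R) u v w : ip (a *: u + v) w = a * ip u w + ip v w.
Proof. exact: ip_linl (H1_L2 u) (H1_L2 v) (H1_L2 w). Qed.

Lemma d0_lin (a : R) u v w :
  ip (dv (a *: u + v)) (dv w) = a * ip (dv u) (dv w) + ip (dv v) (dv w).
Proof.
rewrite -ip_linl; try exact: dv_L2.
apply: ip_ae2; try exact: dv_L2.
- by apply: L2_lin; exact: dv_L2.
- exact: dv_lin.
- exact: aeW.
Qed.

Definition h0 := @Sip R (H1 R) (fun u v => ip u v) h0_lin (fun u v => ipC u v) (fun u => ip_ge0 u).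
Definition d0 := @Sip R (H1 R) (fun u v => ip (dv u) (dv v)) d0_lin
  (fun u v => ipC (dv u) (dv v)) (fun u => ip_ge0 (dv u)).
Definition g0 := sip_add h0 d0 ler01.
Local Notation nrm := (sipn g0).

Lemma g0E u v : g0 u v = ip u v + ip (dv u) (dv v).
Proof. by rewrite /= mul1r. Qed.

Lemma H1_sup u x : `|u x| <= 2 * nrm u.
Proof.
rewrite -ler_sqr ?nnegrE ?mulr_ge0 ?sipn_ge0// real_normK ?num_real// exprMn sqr_sipn g0E.
have := prim_sup x (H1_L2 u) (dvP u).
have := ip_ge0 u; have := ip_ge0 (dv u); lra.
Qed.

Lemma H1_continuous u x : {for x, continuous (u : R -> R)}.
Proof. exact: prim_continuous (dvP u) x. Qed.

Lemma H1_measurable u : measurable_fun [set: R] (u : R -> R).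
Proof. by have [] := H1_L2 u. Qed.

(** The primitive of the continuous function [u ^+ 2] is identically 0, so its derivative vanishes
    at every point. *)
Lemma h0_def u : h0 u u = 0 -> u = 0.
Proof.
move=> hu; apply: H1_eq => x; apply/eqP; rewrite -[_ == _](sqrf_eq0 (u x)); apply/eqP.
pose F t := \int[mu]_(y in `[x - 1, t]) (u y ^+ 2).
have F0 t : F t = 0.
  apply/eqP; rewrite eq_le; apply/andP; split; last first.
    by apply: Rintegral_ge0 => y _; rewrite sqr_ge0.
  by rewrite -[leRHS]hu; exact: sqr_itv_le (H1_L2 u).
have cu t : {for t, continuous (fun y => u y ^+ 2)}.
  exact: (continuousM (@H1_continuous u t) (@H1_continuous u t)).
have dF : is_derive x 1 F (u x ^+ 2).
  by apply: is_derive_primitive; [move=> t _; exact: cu|rewrite ltrBlDr ltrDl].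
have dF0 : is_derive x 1 F 0.
  by apply: is_derive_near_eq (is_derive_cst (0 : R) x 1); first exact: ltr01.
by have [_ <-] := dF; have [_ ->] := dF0.
Qed.

(** Derivatives converge in L^2, functions converge at every point by [H1_sup]. The integral
    identity passes to the limit, and Fatou puts the pointwise limit in L^2. *)
Lemma H1_complete : complete g0.
Proof.
move=> u uC.
have dvB m n : {ae mu, forall x, dv (u m - u n) x = dv (u m) x - dv (u n) x}.
  have := dv_lin (-1) (u n) (u m); rewrite scaleN1r addrC => H.
  by apply: (aeS H) => x ->; rewrite mulN1r addrC.
have dE m n : sqdist (dv (u m)) (dv (u n)) = d0 (u m - u n) (u m - u n).
  apply/esym/ip_ae2; try exact: dv_L2; try exact: dvB.
    by apply: L2B; exact: dv_L2.
  by apply: L2B; exact: dv_L2.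
have small e : 0 < e -> exists N, forall m n, (N <= m)%N -> (N <= n)%N ->
    h0 (u m - u n) (u m - u n) <= e /\ d0 (u m - u n) (u m - u n) <= e.
  move=> e0; have [N HN] := uC (Num.sqrt e) ltac:(by rewrite sqrtr_gt0).
  exists N => m n Nm Nn; have := HN m n Nm Nn => /ltW /(le_sipn (sqrtr_ge0 e)).
  rewrite sqr_sqrtr ?(ltW e0)// g0E => H.
  by have := sip_ge0 h0 (u m - u n); have := sip_ge0 d0 (u m - u n); move: H => /=; lra.
have [g Lg gP] : exists2 g, L2 g & forall e, 0 < e -> exists N, forall n, (N <= n)%N ->
    sqdist (dv (u n)) g <= e.
  apply: riesz_fischer; first by move=> n; exact: dv_L2.
  move=> e /small[N HN]; exists N => m n Nm Nn; rewrite dE.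
  by have [] := HN m n Nm Nn.
pose f x := limn (fun n => u n x).
have uf x : (fun n => u n x) @ \oo --> f x.
  apply/cauchy_cvgP/cauchy_exP => e e0.
  have [N HN] := uC (e / 2) ltac:(by rewrite divr_gt0).
  exists (u N x); exists N => // m /= Nm.
  rewrite /ball/=; have := HN N m (leqnn _) Nm => H.
  by apply: le_lt_trans (H1_sup (u N - u m) x) _; lra.
have pf : prim f g.
  split => // x y xy.
  have c1 : (fun n => u n y - u n x) @ \oo --> f y - f x by exact: cvgB.
  have c2 : (fun n => u n y - u n x) @ \oo --> \int[mu]_(t in `[x, y]) g t.
    apply/cvgrPdist_le => e e0.
    pose c := (y - x) + 1; have c0 : 0 < c by rewrite /c; lra.
    have [N HN] := gP (e ^+ 2 / c) ltac:(by rewrite divr_gt0// exprn_gt0).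
    exists N => // n /= Nn; rewrite (dvP (u n)).2// distrC -RintegralB//; last 2 first.
      exact/L2_integrable_itv/dv_L2.
      exact: L2_integrable_itv.
    have Ld : L2 (fun t => dv (u n) t - g t) by apply: L2B => //; exact: dv_L2.
    apply: le_trans (normr_integral_le xy Ld) _.
    rewrite -sqrtrM ?subr_ge0// -[leRHS]gtr0_norm// -sqrtr_sqr; apply: ler_wsqrtr.
    apply: (@le_trans _ _ (c * (e ^+ 2 / c))); last by rewrite mulrC divfK// gt_eqF.
    by apply: ler_pM; rewrite ?subr_ge0 ?ip_ge0 ?lerDl ?HN.
  have := cvg_unique _ c1 c2; exact.
have mf : measurable_fun [set: R] f by exact: prim_measurable pf.
have fatou e N : (forall m n, (N <= m)%N -> (N <= n)%N -> h0 (u m - u n) (u m - u n) <= e) ->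
    forall n, (N <= n)%N -> L2 (fun x => u n x - f x) /\ sqdist (u n) f <= e.
  move=> HN n Nn; apply: (@L2_fatou _ (fun j x => u n x - u (N + j)%N x)).
  - by move=> j; exact: L2B (H1_L2 _) (H1_L2 _).
  - by apply: measurable_funB => //; exact: H1_measurable.
  - apply: aeW => x; apply: cvgB; first exact: cvg_cst.
    by have := @uf x; rewrite -(cvg_shiftn N); under eq_fun do rewrite addnC.
  - by move=> j; apply: HN; rewrite ?leq_addr.
have Lf : L2 f.
  have [N HN] := small 1 ltr01.
  have [] := fatou 1 N (fun m n Nm Nn => (HN m n Nm Nn).1) N (leqnn N) => H _.
  have := L2B (H1_L2 (u N)) H; congr L2.
  by apply/funext => x; rewrite opprB addrC subrK.
have [l lf] := H1_exists Lf pf.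
exists l => e e0.
have [N HN] := small (e ^+ 2 / 4) ltac:(by rewrite divr_gt0// exprn_gt0).
have [M HM] := gP (e ^+ 2 / 4) ltac:(by rewrite divr_gt0// exprn_gt0).
exists (maxn N M) => n; rewrite geq_max => /andP[Nn Mn].
rewrite -ltr_sqr ?nnegrE ?sipn_ge0 ?(ltW e0)// sqr_sipn g0E.
have [_ h1] := fatou _ N (fun m n Nm Nn => (HN m n Nm Nn).1) n Nn.
have -> : ip (u n - l) (u n - l) = sqdist (u n) f.
  have E : (fun x => u n x - f x) = (u n - l : H1 R) :> (R -> R).
    by apply/funext => x; rewrite -lf.
  by rewrite /sqdist E.
have -> : ip (dv (u n - l)) (dv (u n - l)) = sqdist (dv (u n)) g.
  have H : {ae mu, forall x, dv (u n - l) x = dv (u n) x - g x}.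
    have p : prim (fun x => - 1 * f x + u n x) (fun x => - 1 * g x + dv (u n) x).
      exact: prim_lin pf (dvP _).
    have := dv_ae (u := u n - l) p _; move=> H; apply: (aeS (H _)).
      by move=> x; rewrite -lf mulN1r addrC.
    by move=> x ->; rewrite mulN1r addrC.
  by apply: ip_ae2 => //; try exact: dv_L2; apply: L2B => //; exact: dv_L2.
have := HM n Mn; have : 0 < e ^+ 2 by rewrite exprn_gt0.
by move: h1; lra.
Qed.

Lemma H1_mul_L2 u (f : R -> R) : L2 f -> L2 (fun x => u x * f x).
Proof. exact: L2_bounded_mul (H1_measurable u) (H1_sup u). Qed.

Lemma H1_prim_mul u v : prim (fun x => u x * v x) (fun x => v x * dv u x + u x * dv v x).
Proof. by apply: prim_mul (dvP u) (dvP v) _ _; exact: H1_mul_L2 (dv_L2 _). Qed.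

Lemma H1_mul_exists u v : exists w, forall x, w x = u x * v x.
Proof. exact: H1_exists (H1_mul_L2 u (H1_L2 v)) (H1_prim_mul u v). Qed.

Definition hmul u v : H1 R := sval (cid (H1_mul_exists u v)).

Lemma hmulE u v x : hmul u v x = u x * v x.
Proof. exact: (svalP (cid (H1_mul_exists u v))). Qed.

Lemma dv_hmul u v : {ae mu, forall x, dv (hmul u v) x = v x * dv u x + u x * dv v x}.
Proof. exact: dv_ae (H1_prim_mul u v) (hmulE u v). Qed.

Lemma hmulC u v : hmul u v = hmul v u.
Proof. by apply: H1_eq => x; rewrite !hmulE mulrC. Qed.

Lemma h0_hmul u v w : h0 (hmul u v) w = h0 u (hmul v w).
Proof. by apply: eq_Rintegral => x _; rewrite !hmulE mulrA. Qed.

Lemma hmul_h0 u v : sipn h0 (hmul u v) <= 2 * nrm u * sipn h0 v.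
Proof.
apply: sipn_le; first by rewrite !mulr_ge0 ?sipn_ge0.
rewrite exprMn sqr_sipn.
have := ip_bounded_mul (H1_measurable u) (H1_sup u) (H1_L2 v).
have -> : (fun x => u x * v x) = hmul u v :> (R -> R) by apply/funext => x; rewrite hmulE.
by [].
Qed.

(** The square receives 4 from the function and 16 from the two terms of the derivative, by the sup
    bound with factor 2 and the parallelogram law; 20 is at most 5^2. *)
Lemma hmul_g0 u v : nrm (hmul u v) <= 5 * nrm u * nrm v.
Proof.
apply: sipn_le; first by rewrite !mulr_ge0 ?sipn_ge0.
have h1 := le_sipn _ (hmul_h0 u v).
have {}h1 : h0 (hmul u v) (hmul u v) <= (2 * nrm u * nrm v) ^+ 2.
  apply: le_trans (h1 _) _; first by rewrite !mulr_ge0 ?sipn_ge0.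
  rewrite ler_sqr ?nnegrE ?mulr_ge0 ?sipn_ge0// ler_wpM2l ?mulr_ge0 ?sipn_ge0//.
  by apply: sipn_le; rewrite ?sipn_ge0// sqr_sipn g0E lerDl ip_ge0.
pose p x := v x * dv u x; pose q x := u x * dv v x.
have Lp : L2 p by exact: L2_bounded_mul (H1_measurable v) (H1_sup v) (dv_L2 u).
have Lq : L2 q by exact: L2_bounded_mul (H1_measurable u) (H1_sup u) (dv_L2 v).
have pP : ip p p <= (2 * nrm v) ^+ 2 * nrm u ^+ 2.
  apply: le_trans (ip_bounded_mul (H1_measurable v) (H1_sup v) (dv_L2 u)) _.
  by rewrite ler_wpM2l ?sqr_ge0// sqr_sipn g0E lerDr ip_ge0.
have qP : ip q q <= (2 * nrm u) ^+ 2 * nrm v ^+ 2.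
  apply: le_trans (ip_bounded_mul (H1_measurable u) (H1_sup u) (dv_L2 v)) _.
  by rewrite ler_wpM2l ?sqr_ge0// sqr_sipn g0E lerDr ip_ge0.
have dE : ip (dv (hmul u v)) (dv (hmul u v)) = ip (fun x => p x + q x) (fun x => p x + q x).
  apply: ip_ae2; try exact: dv_L2; try exact: L2D; exact: dv_hmul.
have dS : ip (fun x => p x + q x) (fun x => p x + q x) +
          ip (fun x => p x - q x) (fun x => p x - q x) = 2 * ip p p + 2 * ip q q.
  have E (a : R) : ip (fun x => a * p x + q x) (fun x => a * p x + q x) =
      a ^+ 2 * ip p p + 2 * a * ip p q + ip q q.
    have La : L2 (fun x => a * p x + q x) by exact: L2_lin.
    by rewrite ip_linl// (ipC p) (ipC q) !ip_linl// (ipC q p); ring.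
  have -> : (fun x => p x + q x) = (fun x => 1 * p x + q x) by apply/funext => x; rewrite mul1r.
  have -> : ip (fun x => p x - q x) (fun x => p x - q x) =
      ip (fun x => - 1 * p x + q x) (fun x => - 1 * p x + q x).
    by apply: eq_Rintegral => x _; ring.
  by rewrite !E; ring.
have := ip_ge0 (fun x => p x - q x).
have : ip (hmul u v) (hmul u v) <= (2 * nrm u * nrm v) ^+ 2 by exact: h1.
rewrite g0E dE; have := sqr_ge0 (nrm u * nrm v).
move: dS pP qP; set A := ip (fun x => p x + q x) _; set B := ip (fun x => p x - q x) _.
move: (nrm u) (nrm v) (ip p p) (ip q q) A B (ip (hmul u v) (hmul u v)) => a b c e A B D.
lra.
Qed.

End H1Theory.

(** * The energy space of the equation *)

Section Pairs.
Context {R : realType} {V : lmodType R}.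

Lemma sip_pair_lin (b : sip V) (a : R) (u v w : V * V) :
  b (a *: u + v).1 w.1 + b (a *: u + v).2 w.2 =
  a * (b u.1 w.1 + b u.2 w.2) + (b v.1 w.1 + b v.2 w.2).
Proof. by rewrite /= !sip_linl; ring. Qed.

Lemma sip_pair_sym (b : sip V) (u v : V * V) :
  b u.1 v.1 + b u.2 v.2 = b v.1 u.1 + b v.2 u.2.
Proof. by rewrite (sipC b u.1) (sipC b u.2). Qed.

Lemma sip_pair_ge0 (b : sip V) (u : V * V) : 0 <= b u.1 u.1 + b u.2 u.2.
Proof. by rewrite addr_ge0 ?sip_ge0. Qed.

(** For pairs read as complex functions this is the real part of the Hermitian product. *)
Definition sip_pair (b : sip V) : sip (V * V)%type :=
  Sip (sip_pair_lin b) (sip_pair_sym b) (sip_pair_ge0 b).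

Lemma sip_pair_fst (b : sip V) u : sipn b u.1 <= sipn (sip_pair b) u.
Proof. by rewrite /sipn; apply: ler_wsqrtr; rewrite /= lerDl sip_ge0. Qed.

Lemma sip_pair_snd (b : sip V) u : sipn b u.2 <= sipn (sip_pair b) u.
Proof. by rewrite /sipn; apply: ler_wsqrtr; rewrite /= lerDr sip_ge0. Qed.

Lemma sip_pair_le (b : sip V) u : sipn (sip_pair b) u <= sipn b u.1 + sipn b u.2.
Proof.
apply: sipn_le; first by rewrite addr_ge0 ?sipn_ge0.
rewrite /= -!sqr_sipn; have := sipn_ge0 b u.1; have := sipn_ge0 b u.2; nra.
Qed.

Lemma sip_pair_add (h d : sip V) (c : R) (c0 : 0 <= c) u :
  sipn (sip_add (sip_pair h) (sip_pair d) c0) u = sipn (sip_pair (sip_add h d c0)) u.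
Proof. by rewrite /sipn /=; congr Num.sqrt; ring. Qed.

Lemma sip_pair_complete (b : sip V) : complete b -> complete (sip_pair b).
Proof.
move=> cb x xC.
have [|l1 H1] := cb (fun n => (x n).1).
  move=> e /xC[N HN]; exists N => m n Nm Nn.
  by apply: le_lt_trans (HN m n Nm Nn); exact: (sip_pair_fst b (x m - x n)).
have [|l2 H2] := cb (fun n => (x n).2).
  move=> e /xC[N HN]; exists N => m n Nm Nn.
  by apply: le_lt_trans (HN m n Nm Nn); exact: (sip_pair_snd b (x m - x n)).
exists (l1, l2) => e e0.
have [N1 HN1] := H1 (e / 2) ltac:(by rewrite divr_gt0).
have [N2 HN2] := H2 (e / 2) ltac:(by rewrite divr_gt0).
exists (maxn N1 N2) => n; rewrite geq_max => /andP[/HN1 h1 /HN2 h2].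
apply: le_lt_trans (sip_pair_le b _) _ => /=; move: h1 h2; lra.
Qed.

End Pairs.

Section NLSEnergySpace.
Context {R : realType}.
Variables (a1 a2 : R).
Local Notation V := (H1 R * H1 R)%type.
Local Notation h := (sip_pair (@h0 R)).
Local Notation d := (sip_pair (@d0 R)).
Local Notation g0 := (@g0 R).
Local Notation g := (sip_add h d ler01).
Implicit Types u v w x : V.

Lemma H1E_add (p q : H1 R) t : (p + q) t = p t + q t. Proof. by []. Qed.
Lemma H1E_opp (p : H1 R) t : (- p) t = - p t. Proof. by []. Qed.
Lemma H1E_scale c (p : H1 R) t : (c *: p) t = c * p t. Proof. by []. Qed.
Lemma H1E_zero t : (0 : H1 R) t = 0. Proof. by []. Qed.
Lemma pairD1 u v : (u + v).1 = u.1 + v.1. Proof. by []. Qed.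
Lemma pairD2 u v : (u + v).2 = u.2 + v.2. Proof. by []. Qed.
Lemma pairN1 u : (- u).1 = - u.1. Proof. by []. Qed.
Lemma pairN2 u : (- u).2 = - u.2. Proof. by []. Qed.
Lemma pairZ1 (c : R) u : (c *: u).1 = c *: u.1. Proof. by []. Qed.
Lemma pairZ2 (c : R) u : (c *: u).2 = c *: u.2. Proof. by []. Qed.
Definition pairE := (pairD1, pairD2, pairN1, pairN2, pairZ1, pairZ2).
Definition H1E := (H1E_add, H1E_opp, H1E_scale, @hmulE R, H1E_zero).

Definition nls_I u : V := (- u.2, u.1).

(* [|a + u|^2 - |a|^2] for [a = a1 + i a2] and [u = u.1 + i u.2] *)
Definition nls_s u : H1 R :=
  (2 * a1) *: u.1 + (2 * a2) *: u.2 + (hmul u.1 u.1 + hmul u.2 u.2).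

(** A nonzero constant is not in H^1, so the factor a + u is distributed: a scalar multiple of
    [nls_s u] and a product inside H^1. *)
Definition nls_N u : V :=
  (a1 *: nls_s u + hmul (nls_s u) u.1, a2 *: nls_s u + hmul (nls_s u) u.2).

Definition nls_P u : R := h0 (nls_s u) (nls_s u).

Let hE u v : h u v = h0 u.1 v.1 + h0 u.2 v.2. Proof. by []. Qed.
Let N1 u : (nls_N u).1 = a1 *: nls_s u + hmul (nls_s u) u.1. Proof. by []. Qed.
Let N2 u : (nls_N u).2 = a2 *: nls_s u + hmul (nls_s u) u.2. Proof. by []. Qed.
Let I1 u : (nls_I u).1 = - u.2. Proof. by []. Qed.
Let I2 u : (nls_I u).2 = u.1. Proof. by []. Qed.

Let S1 (M : R) := 2 * `|a1| + 2 * `|a2| + 20 * M.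
Let K1 (M : R) := (`|a1| + `|a2| + 5 * M) * S1 M + 5 * (S1 M * M).

(** The first summand is the Lipschitz constant of [nls_N], the second that of [nls_P]; a sum
    replaces their maximum, and [|M|] makes the value nonnegative for every [M]. *)
Definition nls_K (M : R) := 2 * K1 `|M| + 2 * S1 `|M| * (S1 `|M| * `|M|).

Let S1_ge0 M : 0 <= M -> 0 <= S1 M.
Proof. by move=> M0; rewrite /S1 !addr_ge0 ?mulr_ge0. Qed.

Let K1_ge0 M : 0 <= M -> 0 <= K1 M.
Proof.
by move=> M0; rewrite /K1; have := S1_ge0 M0 => s0; rewrite addr_ge0// mulr_ge0// ?mulr_ge0// !addr_ge0// mulr_ge0.
Qed.

Let gN u : sipn g u = sipn (sip_pair g0) u. Proof. exact: sip_pair_add. Qed.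

Let g1 u : sipn g0 u.1 <= sipn g u. Proof. by rewrite gN sip_pair_fst. Qed.
Let g2 u : sipn g0 u.2 <= sipn g u. Proof. by rewrite gN sip_pair_snd. Qed.

Let hg (p : H1 R) : sipn (@h0 R) p <= sipn g0 p.
Proof. by rewrite /sipn; apply: ler_wsqrtr; rewrite g0E lerDl ip_ge0. Qed.

Section Lipschitz.
Variable b : sip (H1 R).
Hypothesis bmul : forall p q, sipn b (hmul p q) <= 5 * sipn g0 p * sipn b q.

(** Differences of squares factor as [(u + v) (u - v)], each costing [5 * (2 * M)]. The hypothesis
    [bmul] holds for [h0] and for [g0], so that one computation gives the L^2 and the H^1
    estimate. *)
Lemma nls_s_lip M u v : sipn g u <= M -> sipn g v <= M ->
  sipn b (nls_s u - nls_s v) <= S1 M * sipn (sip_pair b) (u - v).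
Proof.
move=> uM vM.
have -> : nls_s u - nls_s v = ((2 * a1) *: (u - v).1 + (2 * a2) *: (u - v).2) +
    (hmul (u.1 + v.1) (u - v).1 + hmul (u.2 + v.2) (u - v).2).
  by apply: H1_eq => t; rewrite /nls_s ?pairE !H1E; ring.
set z := u - v; set n := sipn (sip_pair b) z.
have z1 : sipn b z.1 <= n by exact: sip_pair_fst.
have z2 : sipn b z.2 <= n by exact: sip_pair_snd.
have n0 : 0 <= n by exact: sipn_ge0.
have m1 : sipn g0 (u.1 + v.1) <= 2 * M.
  by apply: le_trans (sipn_triangle _ _ _) _; have := g1 u; have := g1 v; lra.
have m2 : sipn g0 (u.2 + v.2) <= 2 * M.
  by apply: le_trans (sipn_triangle _ _ _) _; have := g2 u; have := g2 v; lra.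
have h1 : sipn b (hmul (u.1 + v.1) z.1) <= 5 * (2 * M) * n.
  by apply: le_trans (bmul _ _) _; apply: ler_pM; rewrite ?mulr_ge0 ?sipn_ge0// ler_wpM2l.
have h2 : sipn b (hmul (u.2 + v.2) z.2) <= 5 * (2 * M) * n.
  by apply: le_trans (bmul _ _) _; apply: ler_pM; rewrite ?mulr_ge0 ?sipn_ge0// ler_wpM2l.
have h3 : sipn b ((2 * a1) *: z.1) <= 2 * `|a1| * n.
  by rewrite sipnZ normrM (@ger0_norm _ 2)// ler_wpM2l// mulr_ge0.
have h4 : sipn b ((2 * a2) *: z.2) <= 2 * `|a2| * n.
  by rewrite sipnZ normrM (@ger0_norm _ 2)// ler_wpM2l// mulr_ge0.
apply: le_trans (sipn_triangle _ _ _) _.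
apply: le_trans (lerD (sipn_triangle _ _ _) (sipn_triangle _ _ _)) _.
have -> : S1 M * n = 2 * `|a1| * n + 2 * `|a2| * n + (5 * (2 * M) * n + 5 * (2 * M) * n).
  by rewrite /S1; ring.
exact: lerD (lerD h3 h4) (lerD h1 h2).
Qed.

End Lipschitz.

Let bmul_g p q : sipn g0 (hmul p q) <= 5 * sipn g0 p * sipn g0 q.
Proof. exact: hmul_g0. Qed.

Let bmul_h p q : sipn (@h0 R) (hmul p q) <= 5 * sipn g0 p * sipn (@h0 R) q.
Proof.
apply: le_trans (hmul_h0 p q) _; rewrite ler_wpM2r ?sipn_ge0// ler_wpM2r ?sipn_ge0//.
by rewrite ler_nat.
Qed.

Lemma nls_s0 : nls_s 0 = 0.
Proof. by apply: H1_eq => t; rewrite /nls_s ?pairE !H1E; ring. Qed.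

Lemma nls_s_le M u : sipn g u <= M -> sipn g0 (nls_s u) <= S1 M * M.
Proof.
move=> uM; have M0 := le_trans (sipn_ge0 g u) uM.
have := @nls_s_lip _ bmul_g M u 0 uM; rewrite sipn0 => /(_ M0).
rewrite nls_s0 !subr0 -gN => /le_trans; apply.
by rewrite ler_wpM2l ?S1_ge0.
Qed.

Lemma nls_N_lip (b : sip (H1 R)) M u v :
  (forall p q, sipn b (hmul p q) <= 5 * sipn g0 p * sipn b q) ->
  sipn g u <= M -> sipn g v <= M ->
  sipn (sip_pair b) (nls_N u - nls_N v) <= 2 * K1 M * sipn (sip_pair b) (u - v).
Proof.
move=> bmul uM vM; have M0 := le_trans (sipn_ge0 g u) uM.
have sl := nls_s_lip bmul uM vM; have sv := nls_s_le vM.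
set n := sipn _ (u - v) in sl *; have n0 : 0 <= n by exact: sipn_ge0.
have S0 := S1_ge0 M0.
have key (c : R) (p q : H1 R) : `|c| <= `|a1| + `|a2| -> sipn g0 p <= M ->
   sipn b (p - q) <= n ->
   sipn b (c *: nls_s u + hmul (nls_s u) p - (c *: nls_s v + hmul (nls_s v) q)) <= K1 M * n.
  move=> ca pM pq.
  have -> : c *: nls_s u + hmul (nls_s u) p - (c *: nls_s v + hmul (nls_s v) q) =
     c *: (nls_s u - nls_s v) + (hmul p (nls_s u - nls_s v) + hmul (nls_s v) (p - q)).
    by apply: H1_eq => t; rewrite ?pairE !H1E; ring.
  apply: le_trans (sipn_triangle _ _ _) _.
  apply: le_trans (lerD (lexx _) (sipn_triangle _ _ _)) _.
  have k1 : sipn b (c *: (nls_s u - nls_s v)) <= (`|a1| + `|a2|) * (S1 M * n).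
    by rewrite sipnZ; apply: ler_pM; rewrite ?sipn_ge0.
  have k2 : sipn b (hmul p (nls_s u - nls_s v)) <= 5 * M * (S1 M * n).
    apply: le_trans (bmul _ _) _; apply: ler_pM; rewrite ?mulr_ge0 ?sipn_ge0//.
    by rewrite ler_wpM2l.
  have k3 : sipn b (hmul (nls_s v) (p - q)) <= 5 * (S1 M * M) * n.
    apply: le_trans (bmul _ _) _; apply: ler_pM; rewrite ?mulr_ge0 ?sipn_ge0//.
    by rewrite ler_wpM2l.
  by rewrite /K1; lra.
apply: le_trans (sip_pair_le b _) _.
have e1 := key a1 u.1 v.1 _ (le_trans (g1 u) uM) (sip_pair_fst b (u - v)).
have e2 := key a2 u.2 v.2 _ (le_trans (g2 u) uM) (sip_pair_snd b (u - v)).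
move: (e1 ltac:(by rewrite lerDl)) (e2 ltac:(by rewrite lerDr)) => /=.
set A := sipn b _; set B := sipn b _; lra.
Qed.

Let K_N M : 2 * K1 `|M| <= nls_K M.
Proof. by rewrite /nls_K lerDl !mulr_ge0 ?S1_ge0. Qed.

Lemma nls_N_liph M u v : sipn g u <= M -> sipn g v <= M ->
  sipn h (nls_N u - nls_N v) <= nls_K M * sipn h (u - v).
Proof.
move=> uM vM; have MM := ler_norm M.
apply: le_trans (nls_N_lip bmul_h (le_trans uM MM) (le_trans vM MM)) _.
by rewrite ler_wpM2r ?sipn_ge0.
Qed.

Lemma nls_N_lipg M u v : sipn g u <= M -> sipn g v <= M ->
  sipn g (nls_N u - nls_N v) <= nls_K M * sipn g (u - v).
Proof.
move=> uM vM; have MM := ler_norm M; rewrite (gN (_ - _)) (gN (u - v)).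
apply: le_trans (nls_N_lip bmul_g (le_trans uM MM) (le_trans vM MM)) _.
by rewrite ler_wpM2r ?sipn_ge0.
Qed.

Lemma nls_P_lip M u v : sipn g u <= M -> sipn g v <= M ->
  `|nls_P u - nls_P v| <= nls_K M * sipn h (u - v).
Proof.
move=> uM vM; have MM := ler_norm M.
have uM' := le_trans uM MM; have vM' := le_trans vM MM.
have -> : nls_P u - nls_P v = h0 (nls_s u - nls_s v) (nls_s u + nls_s v).
  rewrite /nls_P; move: (nls_s u) (nls_s v) => p q.
  by rewrite !sipE (sipC _ q p); ring.
apply: le_trans (sip_CS _ _ _) _.
have l1 := nls_s_lip bmul_h uM' vM'.
have l2 : sipn (@h0 R) (nls_s u + nls_s v) <= 2 * (S1 `|M| * `|M|).
  apply: le_trans (sipn_triangle _ _ _) _.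
  have := le_trans (hg _) (nls_s_le uM'); have := le_trans (hg _) (nls_s_le vM'); lra.
apply: (@le_trans _ _ (S1 `|M| * sipn h (u - v) * (2 * (S1 `|M| * `|M|)))).
  by apply: ler_pM; rewrite ?sipn_ge0.
rewrite [leLHS](_ : _ = (2 * S1 `|M| * (S1 `|M| * `|M|)) * sipn h (u - v)); last by ring.
rewrite ler_wpM2r ?sipn_ge0// /nls_K lerDr mulr_ge0// K1_ge0//.
Qed.

(** The increment of [nls_s] is exactly [2 L + Q] with [L] linear and [Q] quadratic in [x], and
    [h0 (nls_s u) L] equals [h (nls_N u) x]. What remains is [2 * h0 (nls_s u) Q + h0 D D]. *)
Lemma nls_P_diff u : exists C, forall x, sipn g x <= 1 ->
  `|nls_P (u + x) - nls_P u - 4 * h (nls_N u) x| <= C * sipn g x ^+ 2.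
Proof.
pose M := sipn g u + 1; pose S := sipn (@h0 R) (nls_s u).
exists (2 * S * 10 + S1 M ^+ 2) => x x1.
have M0 : 0 <= M by rewrite addr_ge0 ?sipn_ge0.
have uM : sipn g u <= M by rewrite lerDl.
have uxM : sipn g (u + x) <= M by apply: le_trans (sipn_triangle _ _ _) _; rewrite lerD2l.
pose D := nls_s (u + x) - nls_s u.
pose Q := hmul x.1 x.1 + hmul x.2 x.2.
pose L := a1 *: x.1 + a2 *: x.2 + (hmul u.1 x.1 + hmul u.2 x.2).
have DE : D = 2 *: L + Q.
  by apply: H1_eq => t; rewrite /D /Q /L /nls_s ?pairE !H1E; ring.
have D1 : sipn (@h0 R) D <= S1 M * sipn g x.
  apply: le_trans (hg _) _; apply: le_trans (nls_s_lip bmul_g uxM uM) _.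
  by rewrite -gN addrC addKr.
have Q1 : sipn (@h0 R) Q <= 10 * sipn g x ^+ 2.
  apply: le_trans (sipn_triangle _ _ _) _.
  have q1 p : sipn g0 p <= sipn g x -> sipn (@h0 R) (hmul p p) <= 5 * sipn g x ^+ 2.
    move=> px; apply: le_trans (hg _) _; apply: le_trans (hmul_g0 _ _) _.
    by rewrite -mulrA ler_wpM2l// -expr2 ler_sqr ?nnegrE ?sipn_ge0.
  by have := q1 _ (g1 x); have := q1 _ (g2 x); lra.
have -> : nls_P (u + x) - nls_P u - 4 * h (nls_N u) x = 2 * h0 (nls_s u) Q + h0 D D.
  have -> : h (nls_N u) x = h0 (nls_s u) L.
    rewrite /L hE N1 N2; move: (nls_s u) => s.
    by rewrite !sipE (h0_hmul s u.1) (h0_hmul s u.2); ring.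
  have sE : nls_s (u + x) = nls_s u + D by rewrite /D [RHS]addrC subrK.
  rewrite /nls_P sE DE; move: (nls_s u) L Q {DE D1 Q1} => s p q.
  by rewrite !sipE (sipC _ p s) (sipC _ q s) (sipC _ q p); ring.
apply: le_trans (ler_normD _ _) _; rewrite [leRHS]mulrDl; apply: lerD.
  rewrite normrM (@ger0_norm _ 2)// -!mulrA ler_wpM2l//.
  by apply: le_trans (sip_CS _ _ _) _; rewrite ler_wpM2l ?sipn_ge0.
rewrite ger0_norm ?sip_ge0// -exprMn; apply: le_sipn => //.
by rewrite mulr_ge0 ?sipn_ge0// S1_ge0.
Qed.

(** In s (a + u) only the part s a is seen by i u, since u and i u are orthogonal at each point. So
    [nls_s u] is paired with [r], linear in [u], and a weighted Young inequality separates them. *)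
Lemma nls_NI u (s : R) : 0 < s ->
  2 * `|h (nls_N u) (nls_I u)| * s <= nls_P u * s ^+ 2 + 2 * (a1 ^+ 2 + a2 ^+ 2) * h u u.
Proof.
move=> s0; pose r := a2 *: u.1 - a1 *: u.2.
have -> : h (nls_N u) (nls_I u) = h0 (nls_s u) r.
  rewrite /r hE N1 N2 I1 I2; move: (nls_s u) => p.
  by rewrite !sipE (h0_hmul p u.1) (h0_hmul p u.2) (hmulC u.1); ring.
have r1 : h0 r r <= 2 * (a1 ^+ 2 + a2 ^+ 2) * h u u.
  have := sip_ge0 (@h0 R) (a2 *: u.1 + a1 *: u.2).
  have k1 := mulr_ge0 (sqr_ge0 a1) (sip_ge0 (@h0 R) u.1).
  have k2 := mulr_ge0 (sqr_ge0 a2) (sip_ge0 (@h0 R) u.2).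
  have -> : h u u = h0 u.1 u.1 + h0 u.2 u.2 by [].
  rewrite /r !sipE (sipC _ u.2 u.1); move: k1 k2.
  move: (h0 u.1 u.1) (h0 u.2 u.2) (h0 u.1 u.2) => x y z; lra.
have := sip_CS (@h0 R) (nls_s u) r.
have -> : nls_P u = sipn (@h0 R) (nls_s u) ^+ 2 by rewrite sqr_sipn.
move: r1; rewrite -sqr_sipn.
set S := sipn _ (nls_s u); set T := sipn _ r => r1 ST.
have : 2 * `|h0 (nls_s u) r| * s <= 2 * (S * T) * s.
  by rewrite ler_wpM2r ?(ltW s0)// ler_wpM2l.
have := sqr_ge0 (S * s - T); lra.
Qed.

Lemma nls_complete : complete g.
Proof.
move=> x xC; have [|l lP] := @sip_pair_complete _ _ g0 H1_complete x.
  by move=> e /xC[N HN]; exists N => m n Nm Nn; rewrite -gN; exact: HN.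
by exists l => e /lP[N HN]; exists N => n Nn; rewrite gN; exact: HN.
Qed.

Lemma nls_h_def u : h u u = 0 -> u = 0.
Proof.
case: u => p q /= hu.
have := sip_ge0 (@h0 R) p; have := sip_ge0 (@h0 R) q => q0 p0.
have hp : h0 p p = 0 by move: hu p0 q0 => /=; lra.
have hq : h0 q q = 0 by move: hu p0 q0 => /=; lra.
by rewrite (h0_def hp) (h0_def hq).
Qed.

Lemma nls_I_lin (c : R) u v : nls_I (c *: u + v) = c *: nls_I u + nls_I v.
Proof.
rewrite [LHS]surjective_pairing [RHS]surjective_pairing.
by congr (_, _); apply: H1_eq => t; rewrite ?(I1, I2, pairE) !H1E; ring.
Qed.

Lemma nls_II u : nls_I (nls_I u) = - u.
Proof. by case: u. Qed.

Lemma nls_bI (b : sip (H1 R)) u v : sip_pair b (nls_I u) v = - sip_pair b u (nls_I v).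
Proof. by rewrite /nls_I /= sipNl sipNr; ring. Qed.

Lemma nls_N0 : nls_N 0 = 0.
Proof.
by rewrite /nls_N nls_s0; congr (_, _); apply: H1_eq => t; rewrite ?pairE !H1E; ring.
Qed.

Lemma nls_P0 : nls_P 0 = 0.
Proof. by rewrite /nls_P nls_s0 sip0l. Qed.

Lemma nls_K_ge0 M : 0 <= nls_K M.
Proof. by rewrite addr_ge0 ?mulr_ge0 ?K1_ge0 ?S1_ge0. Qed.

Definition nls_space : energy_space V := @EnergySpace R V h d nls_I nls_N nls_P nls_K
  (2 * (a1 ^+ 2 + a2 ^+ 2)) nls_complete nls_h_def nls_I_lin nls_II (nls_bI (@h0 R))
  (nls_bI (@d0 R)) nls_N0 nls_P0 (fun u => sip_ge0 (@h0 R) (nls_s u)) nls_K_ge0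
  (mulr_ge0 (ler0n R 2) (addr_ge0 (sqr_ge0 a1) (sqr_ge0 a2)))
  nls_N_liph nls_N_lipg nls_P_lip nls_P_diff nls_NI.

End NLSEnergySpace.

(** * Test functions and weak derivatives *)

Section Smooth.
Context {R : realType}.
Implicit Types f g : R -> R.

(** Differentiability to order n as a chain of derivatives, a form that sums, products and affine
    substitutions preserve by a direct induction. *)
Fixpoint Cn n f : Prop := if n is m.+1 then
  exists2 f' : R -> R, (forall x : R, is_derive x 1 f (f' x)) & Cn m f' else True.

Lemma is_derive_derive1 f (f' : R -> R) : (forall x : R, is_derive x 1 f (f' x)) ->
  derive1 f = f'.
Proof. by move=> df; apply/funext => x; rewrite derive1E; have [_] := df x. Qed.

Lemma derive1n_iterS n f : derive1n n.+1 f = derive1n n (derive1 f).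
Proof. by rewrite /derive1n iterSr. Qed.

Lemma Cn_derivable f : (forall n, Cn n f) -> forall n (x : R), derivable (derive1n n f) x 1.
Proof.
move=> Hf n; move: (Hf n.+1) => {Hf}; elim: n f => [|n IH] f.
  by case=> f' df _ x; have [] := df x.
by case=> f' /is_derive_derive1 E Cf' x; rewrite derive1n_iterS E; exact: IH.
Qed.

Lemma derivable_Cn f : (forall n (x : R), derivable (derive1n n f) x 1) -> forall n, Cn n f.
Proof.
move=> Hf n; elim: n f Hf => [//|n IH] f Hf; exists (derive1 f).
  move=> x; have := Hf 0%N x; rewrite derive1n0 => /derivableP.
  by rewrite -derive1E.
by apply: IH => m x; rewrite -derive1n_iterS; exact: Hf.
Qed.

Lemma CnS n f : Cn n.+1 f -> Cn n f.
Proof. by elim: n f => [//|n IH] f [f' df Cf']; exists f' => //; exact: IH. Qed.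

Lemma CnD n f g : Cn n f -> Cn n g -> Cn n (fun x => f x + g x).
Proof.
elim: n f g => [//|n IH] f g [f' df Cf'] [g' dg Cg'].
by exists (fun x => f' x + g' x) => [x|]; [exact: is_derive_addf|exact: IH].
Qed.

Lemma CnZ n (c : R) f : Cn n f -> Cn n (fun x => c * f x).
Proof.
elim: n f => [//|n IH] f [f' df Cf'].
by exists (fun x => c * f' x) => [x|]; [exact: is_derive_scalef|exact: IH].
Qed.

Lemma CnM n f g : Cn n f -> Cn n g -> Cn n (fun x => f x * g x).
Proof.
elim: n f g => [//|n IH] f g Cf Cg; have Cf0 := CnS Cf; have Cg0 := CnS Cg.
case: Cf Cg => [f' df Cf'] [g' dg Cg'].
exists (fun x => f' x * g x + f x * g' x) => [x|]; first exact: is_derive_mulf.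
by apply: CnD; exact: IH.
Qed.

Lemma is_derive_affine f (c b x l : R) : is_derive (c * x + b) 1 f l ->
  is_derive x 1 (fun y => f (c * y + b)) (c * l).
Proof.
move=> df; have d1 : is_derive x 1 (fun y => c * y + b) c.
  have := is_derive_addf (is_derive_scalef c (is_derive_id x 1)) (is_derive_cst b x 1).
  by rewrite mulr1 addr0.
by rewrite mulrC; exact: (@is_derive1_comp _ f (fun y => c * y + b) x _ _ df d1).
Qed.

Lemma Cn_affine n f (c b : R) : Cn n f -> Cn n (fun x => f (c * x + b)).
Proof.
elim: n f => [//|n IH] f [f' df Cf'].
exists (fun x => c * f' (c * x + b)) => [x|]; first exact: is_derive_affine.
by apply: CnZ; exact: IH.
Qed.

(** The functions x^-k exp(-1/x), extended by 0, form a family whose derivatives are combinations of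
    its members; smoothness follows by induction. *)
Definition bump k (x : R) : R := if 0 < x then x^-1 ^+ k * expR (- x^-1) else 0.

(** One term of the exponential series at 1/x suffices. The quadratic bound gives derivative 0 at
    the origin. *)
Lemma bump_le k (x : R) : 0 < x -> bump k x <= (k.+2)`!%:R * x ^+ 2.
Proof.
move=> x0; rewrite /bump x0 expRN; have xV : 0 <= x^-1 by rewrite invr_ge0 ltW.
have fact0 : 0 < (k.+2)`!%:R :> R by rewrite ltr0n fact_gt0.
have := expR_ge1Dxn k.+1 xV; set F := (k.+2)`!%:R in fact0 * => H.
have q0 : 0 < x^-1 ^+ k.+2 / F by rewrite divr_gt0// exprn_gt0// invr_gt0.
have -> : F * x ^+ 2 = x^-1 ^+ k * (x^-1 ^+ k.+2 / F)^-1.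
  have y0 : x^-1 ^+ k != 0 by rewrite expf_neq0// invr_eq0 gt_eqF.
  have -> : x^-1 ^+ k.+2 = x^-1 ^+ k * (x^-1 * x^-1) by rewrite !exprS; ring.
  move: (x^-1 ^+ k) y0 => y y0; field.
  by rewrite y0 !gt_eqF.
rewrite ler_wpM2l ?exprn_ge0// lef_pV2 ?posrE ?expR_gt0//.
by apply: le_trans H; rewrite lerDr.
Qed.

Lemma is_derive_invX k (x : R) : x != 0 ->
  is_derive x 1 (fun y => y^-1 ^+ k) (- (k%:R * x^-1 ^+ k.+1)).
Proof.
move=> x0; have d1 : is_derive x 1 (fun y : R => y^-1) (- x^-1 ^+ 2).
  have := is_derive_invf (c := 1) (oner_neq0 _) x0 => d.
  apply: (is_derive_eq (f' := - (1 * x ^+ 2)^-1)); last by rewrite mul1r exprVn.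
  by apply: is_derive_near_eq d; [exact: ltr01|move=> s _; rewrite mul1r].
elim: k => [|k IH].
  rewrite mul0r oppr0; apply: is_derive_near_eq (is_derive_cst (1 : R) x 1).
    exact: ltr01.
  by move=> s _; rewrite expr0.
have := is_derive_mulf d1 IH => d.
apply: (is_derive_eq (f' := - x^-1 ^+ 2 * x^-1 ^+ k + x^-1 * - (k%:R * x^-1 ^+ k.+1))).
  by apply: is_derive_near_eq d; [exact: ltr01|move=> s _; rewrite exprS].
by rewrite -natr1 !exprS; ring.
Qed.

Lemma is_derive_bump k (x : R) : is_derive x 1 (bump k) (bump k.+2 x - k%:R * bump k.+1 x).
Proof.
have [x0|x0|->] := ltgtP x 0.
- rewrite /bump !(lt_gtF x0) mulr0 subr0.
  apply: (@is_derive_near_eq _ (cst 0) _ _ _ (- x)) (is_derive_cst (0 : R) x 1).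
    by rewrite oppr_gt0.
  move=> s; rewrite ltr_norml => /andP[_ sx]; rewrite ifF//; apply/negbTE; rewrite -leNgt; lra.
- have xn : x != 0 by rewrite gt_eqF.
  have d1 := is_derive_invX k xn.
  have d2 : is_derive x 1 (fun y => expR (- y^-1)) (expR (- x^-1) * x^-1 ^+ 2).
    have := is_derive_scalef (-1) (is_derive_invX 1 xn) => d.
    have d' : is_derive x 1 (fun y : R => - y^-1) (x^-1 ^+ 2).
      apply: (is_derive_eq (f' := -1 * - (1%:R * x^-1 ^+ 2))); last by ring.
      by apply: is_derive_near_eq d; [exact: ltr01|move=> s _; rewrite expr1 mulN1r].
    exact: (@is_derive1_comp _ expR (fun y => - y^-1) x _ _ (is_derive_expR _) d').
  have := is_derive_mulf d1 d2 => d.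
  apply: (is_derive_eq (f' := - (k%:R * x^-1 ^+ k.+1) * expR (- x^-1) +
     x^-1 ^+ k * (expR (- x^-1) * x^-1 ^+ 2))).
    apply: is_derive_near_eq d; first exact: x0.
    move=> s; rewrite ltr_norml => /andP[sx _]; rewrite /bump ifT//; lra.
  by rewrite /bump x0 !exprS; ring.
- apply/is_deriveP => e e0.
  have b0 j : bump j 0 = 0 by rewrite /bump ltxx.
  rewrite !b0.
  have F0 : 0 < (k.+2)`!%:R :> R by rewrite ltr0n fact_gt0.
  exists (e / (k.+2)`!%:R); first by rewrite divr_gt0.
  move=> s; rewrite !(mulr0, subr0) => se.
  have [s0|s0] := ltP 0 s; last by rewrite /bump ltNge s0/= normr0 mulr_ge0// ltW.
  rewrite ger0_norm; last by rewrite /bump s0 mulr_ge0 ?expR_ge0// exprn_ge0// invr_ge0 ltW.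
  apply: le_trans (bump_le k s0) _; move: se; rewrite gtr0_norm// ltr_pdivlMr// => se.
  by rewrite expr2 mulrA ler_wpM2r ?(ltW s0)// mulrC ltW.
Qed.

Lemma bump_Cn n k : Cn n (bump k).
Proof.
elim: n k => [//|n IH] k; exists (fun x => bump k.+2 x - k%:R * bump k.+1 x).
  exact: is_derive_bump.
have := CnD (IH k.+2) (CnZ (- k%:R) (IH k.+1)); congr Cn.
by apply/funext => x; rewrite mulNr.
Qed.

(** Smooth approximations of the indicator of []a, b[] with values in [0, 1]; translating them
    amounts to translating [a] and [b]. *)
Definition plateau (n : nat) (a b x : R) : R :=
  bump 0 (n.+1%:R * (x - a)) * bump 0 (n.+1%:R * (b - x)).

Lemma bump0_itv (x : R) : 0 <= bump 0 x <= 1.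
Proof.
rewrite /bump; case: ifP => x0; last by rewrite lexx ler01.
by rewrite expr0 mul1r expR_ge0/= expR_le1 oppr_le0 invr_ge0 ltW.
Qed.

Lemma plateau_itv n a b x : 0 <= plateau n a b x <= 1.
Proof.
have /andP[p0 p1] := bump0_itv (n.+1%:R * (x - a)).
have /andP[q0 q1] := bump0_itv (n.+1%:R * (b - x)).
by rewrite mulr_ge0// mulr_ile1.
Qed.

Lemma plateau_out n a b x : ~~ (a < x < b) -> plateau n a b x = 0.
Proof.
rewrite negb_and -!leNgt => /orP[xa|bx]; rewrite /plateau /bump.
  by rewrite pmulr_rgt0// subr_gt0 ltNge xa/= mul0r.
by rewrite (pmulr_rgt0 (b - x))// subr_gt0 (ltNge x) bx/= mulr0.
Qed.

Lemma plateau_cvg a b x : a < x < b -> (fun n => plateau n a b x) @ \oo --> (1 : R).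
Proof.
move=> /andP[ax xb].
have H y : 0 < y -> (fun n => bump 0 (n.+1%:R * y)) @ \oo --> (1 : R).
  move=> y0; rewrite -[X in _ --> X](expR0 R).
  have -> : (fun n => bump 0 (n.+1%:R * y)) = (fun n => expR (- (y^-1 * n.+1%:R^-1))).
    by apply/funext => n; rewrite /bump pmulr_rgt0// y0 expr0 mul1r invfM mulrC.
  apply: continuous_cvg; first exact: continuous_expR.
  rewrite -[X in _ --> X]oppr0; apply: cvgN; rewrite -[X in _ --> X](mulr0 y^-1).
  by apply: cvgM; [exact: cvg_cst|exact: cvg_harmonic].
rewrite -[X in _ --> X](mulr1 1).
by apply: cvgM; apply: H; rewrite subr_gt0.
Qed.

Lemma plateau_Cn m n a b : Cn m (plateau n a b).
Proof.
apply: CnM.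
  have := Cn_affine (n.+1%:R) (- (n.+1%:R * a)) (bump_Cn m 0); congr Cn.
  by apply/funext => x; congr bump; ring.
have := Cn_affine (- n.+1%:R) (n.+1%:R * b) (bump_Cn m 0); congr Cn.
by apply/funext => x; congr bump; ring.
Qed.

Lemma plateau_shift n a b h x : plateau n a b (x - h) = plateau n (a + h) (b + h) x.
Proof. by rewrite /plateau; congr (bump _ (_ * _) * bump _ (_ * _)); ring. Qed.

End Smooth.

(** * Test functions as elements of H^1 *)

Section TestFunctions.
Context {R : realType}.
Local Notation mu := (@lebesgue_measure R).
Implicit Types phi f g : R -> R.

Lemma test_of_Cn (phi : R -> R) a b : (forall n, Cn n phi) ->
  (forall x, ~~ (a <= x <= b) -> phi x = 0) -> test_function phi.
Proof.
move=> Cphi supp; split; first by move=> n x; exact: Cn_derivable.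
apply: (subclosed_compact _ (@segment_compact _ a b)); first exact: closed_closure.
have clos : closed [set` `[a, b]] by exact: interval_closed.
rewrite (iffLR (closure_id _) clos); apply: closure_subset => x /= px.
rewrite in_itv/=; apply: contraT => /supp p0; by rewrite p0 eqxx in px.
Qed.

Lemma test_Cn phi : test_function phi -> forall n, Cn n phi.
Proof. by move=> [dphi _]; exact: derivable_Cn. Qed.

Lemma test_derive phi : test_function phi -> forall x : R, is_derive x 1 phi (derive1 phi x).
Proof. by move=> [dphi _] x; have := dphi 0%N x => /derivableP; rewrite -derive1E. Qed.

Lemma test_support phi : test_function phi ->
  exists2 A : R, 0 < A & forall x, A <= `|x| -> phi x = 0.
Proof.
move=> [_ cphi]; have [M [_ HM]] := compact_bounded cphi.
exists (`|M| + 2); first by rewrite ltr_wpDl.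
move=> x Mx; apply/eqP; apply: contraT => px.
have := HM (`|M| + 1); rewrite (le_lt_trans (ler_norm M)) ?ltrDl// => /(_ isT x).
rewrite /globally/= => /(_ (subset_closure _)) H; have := H px; lra.
Qed.

Lemma derive1_test phi : test_function phi -> test_function (derive1 phi).
Proof.
move=> tphi; have [A A0 HA] := test_support tphi.
apply: (@test_of_Cn _ (- A) A).
  move=> n; have := test_Cn tphi n.+1 => -[f' df Cf'].
  by rewrite (is_derive_derive1 df).
move=> x xA; have [_ <-] := test_derive tphi x.
have xA' : A < `|x| by rewrite ltNge ler_norml.
have d0 : is_derive x 1 phi 0.
  apply: (@is_derive_near_eq _ (cst 0) _ _ _ (`|x| - A)) (is_derive_cst (0 : R) x 1).
    by rewrite subr_gt0.
  move=> s sx; apply/esym/HA; have := ler_normD (x - s) s.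
  by rewrite subrK (distrC x s); lra.
by have [_ ->] := d0.
Qed.

Lemma continuous_compact_L2 f (A : R) : (forall x, {for x, continuous f}) ->
  (forall x, A <= `|x| -> f x = 0) -> L2 f.
Proof.
move=> cf fA; have mf : measurable_fun [set: R] f by exact: continuous_measurable_fun.
apply: L2_intro => //.
have c2 t : {for t, continuous (fun y => f y ^+ 2)} by exact: (continuousM (cf t) (cf t)).
have /integrableP[_] := @continuous_integrable_itv _ (fun y => f y ^+ 2) (- A) A (fun t _ => c2 t).
apply: le_lt_trans.
rewrite [leRHS]integral_mkcond le_eqVlt; apply/orP; left; apply/eqP.
apply: eq_integral => x _; rewrite patchE; case: ifPn => [_|].
  by rewrite /= ger0_norm ?sqr_ge0.
rewrite notin_setE/= in_itv/= => /negP xA; rewrite fA ?expr0n//.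
by move: xA; rewrite -ler_norml -ltNge => /ltW.
Qed.

Lemma test_L2 phi : test_function phi -> L2 phi.
Proof.
move=> tphi; have [A _ HA] := test_support tphi.
by apply: continuous_compact_L2 HA => x; exact: is_derive_continuous (test_derive tphi x).
Qed.

Lemma integral_derive f (f' : R -> R) : (forall x : R, is_derive x 1 f (f' x)) ->
  (forall x, {for x, continuous f'}) ->
  forall x y, x <= y -> f y - f x = \int[mu]_(t in `[x, y]) f' t.
Proof.
move=> df cf x y xy; pose F t := \int[mu]_(s in `[x - 1, t]) f' s.
have dF t : x <= t -> is_derive t 1 (fun t => F t - f t) (f' t - f' t).
  move=> xt; apply: is_derive_subf => //; apply: is_derive_primitive => //; lra.
have [c _] : exists2 c, c \in `[x, y] & (F y - f y) - (F x - f x) = (f' c - f' c) * (y - x).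
  apply: (@MVT_segment _ (fun t => F t - f t) (fun t => f' t - f' t)) => //.
    by move=> t; rewrite in_itv/= => /andP[xt _]; exact/dF/ltW.
  by apply: within_continuousT => t /=; rewrite in_itv/= => /andP[/dF/is_derive_continuous].
have x1 : x - 1 <= x by lra.
rewrite {1}/F (Rintegral_itv_split x1 xy); last exact: continuous_integrable_itv.
rewrite -/(F x); lra.
Qed.

Lemma test_prim phi : test_function phi -> prim phi (derive1 phi).
Proof.
move=> tphi; have td := derive1_test tphi; split; first exact: test_L2.
apply: integral_derive; first exact: test_derive.
by move=> x; exact: is_derive_continuous (test_derive td x).
Qed.

Lemma test_H1 phi : test_function phi -> exists2 w : H1 R, (forall x, w x = phi x) &
  {ae mu, forall x, dv w x = derive1 phi x}.
Proof.
move=> tphi; have [w wE] := H1_exists (test_L2 tphi) (test_prim tphi).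
exists w => //; exact: dv_ae (test_prim tphi) wE.
Qed.

Lemma test_lin (a : R) phi psi : test_function phi -> test_function psi ->
  test_function (fun x => a * phi x + psi x).
Proof.
move=> t1 t2; have [A A0 HA] := test_support t1; have [B B0 HB] := test_support t2.
apply: (@test_of_Cn _ (- (A + B)) (A + B)).
  by move=> n; apply: CnD; [apply: CnZ|]; exact: test_Cn.
move=> x; rewrite -ler_norml -ltNge => xAB.
by rewrite HA ?HB ?mulr0 ?addr0//; lra.
Qed.

Lemma plateau_test n a b : test_function (@plateau R n a b).
Proof.
apply: (@test_of_Cn _ a b); first by move=> m; exact: plateau_Cn.
move=> x xab; apply: plateau_out; apply: contra xab => /andP[ax xb].
by rewrite !ltW.
Qed.

(* [psi x = F x - F (x - h)] for a primitive [F] of [phi] *)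
Lemma test_difference phi h : test_function phi -> exists2 psi, test_function psi &
  forall x, derive1 psi x = phi x - phi (x - h).
Proof.
move=> tphi; have [A A0 HA] := test_support tphi.
have cphi x : {for x, continuous phi} by exact: is_derive_continuous (test_derive tphi x).
pose F x := \int[mu]_(s in `[- A - `|h| - 1, x]) phi s.
have F0 x : x <= - A -> F x = 0.
  move=> xA; rewrite /F (@eq_Rintegral _ _ _ mu _ (cst 0)); last first.
    move=> s; rewrite inE/= in_itv/= => /andP[_ sx]; rewrite HA//.
    by rewrite ler0_norm; lra.
  have [h1|h1] := leP (- A - `|h| - 1) x; first by rewrite Rintegral_itv_cst// mul0r.
  by rewrite set_itv_ge ?Rintegral_set0// bnd_simp -ltNge.
have dF (x : R) : is_derive x 1 F (phi x).
  have [xA|xA] := ltP x (- A).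
    have -> : phi x = 0 by apply: HA; rewrite ler0_norm; lra.
    apply: (@is_derive_near_eq _ (cst 0) _ _ _ (- A - x)) (is_derive_cst (0 : R) x 1).
      by rewrite subr_gt0.
    move=> s; rewrite ltr_norml => /andP[_ sx]; rewrite F0//; lra.
  by apply: is_derive_primitive => //; have := normr_ge0 h; lra.
have CF n : Cn n F.
  by case: n => // n; exists phi => //; exact: test_Cn.
pose psi x := F x - F (x - h).
have Cpsi n : Cn n psi.
  have := CnD (CF n) (CnZ (-1) (Cn_affine 1 (- h) (CF n))); congr Cn.
  by apply/funext => x; rewrite mulN1r mul1r.
have dpsi (x : R) : is_derive x 1 psi (phi x - phi (x - h)).
  apply: is_derive_subf => //.
  have d : is_derive (1 * x + - h) 1 F (phi (x - h)) by rewrite mul1r.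
  have := is_derive_affine d; rewrite mul1r => d'.
  by apply: is_derive_near_eq d'; [exact: ltr01|move=> s _; rewrite mul1r].
exists psi; last by move=> x; rewrite (is_derive_derive1 dpsi).
apply: (@test_of_Cn _ (- A - `|h| *+ 2) (A + `|h| *+ 2)) => //.
move=> x; rewrite negb_and -!ltNge => /orP[xA|xA].
  by rewrite /psi !F0 ?subrr//; have := ler_norm (- h); rewrite normrN; have := normr_ge0 h; lra.
have H : `|F x - F (x - h)| <= 0 * `|x - (x - h)|.
  apply: (@MVT_bound _ F phi) => // s.
  rewrite (_ : x - (x - h) = h); last by ring.
  rewrite ler_norml => /andP[s1 s2]; rewrite HA ?normr0//.
  by apply: le_trans (ler_norm s); have := ler_norm h; have := ler_norm (- h); rewrite normrN; lra.
by move: H; rewrite mul0r normr_le0 => /eqP.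
Qed.

End TestFunctions.

(** * Weak derivatives of square integrable functions, density of test functions *)

Section WeakDerivatives.
Context {R : realType}.
Local Notation mu := (@lebesgue_measure R).
Implicit Types (f g k phi : R -> R).

Lemma continuous_locally_integrable f : (forall x, {for x, continuous f}) ->
  locally_integrable [set: R] f.
Proof.
move=> cf; split; [exact: continuous_measurable_fun|exact: openT|].
move=> K _ cK; have /integrableP[_] := continuous_compact_integrable cK
  (within_continuousT (fun t _ => cf t)).
exact.
Qed.

Lemma locally_integrableB f g : locally_integrable [set: R] f ->
  locally_integrable [set: R] g -> locally_integrable [set: R] (fun x => f x - g x).
Proof.
move=> [mf _ fi] [mg _ gi]; split; [exact: measurable_funB|exact: openT|].
move=> K KT cK; have mK : measurable K by exact: compact_measurable.
have i1 : mu.-integrable K (EFin \o f).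
  by apply/integrableP; split; [by apply/measurable_EFinP; exact: measurable_funS mf|exact: fi].
have i2 : mu.-integrable K (EFin \o g).
  by apply/integrableP; split; [by apply/measurable_EFinP; exact: measurable_funS mg|exact: gi].
have /integrableP[_] : mu.-integrable K ((EFin \o f) \- (EFin \o g))%E by exact: integrableB.
exact.
Qed.

Lemma locally_integrable_itv f a b : locally_integrable [set: R] f ->
  mu.-integrable `[a, b] (EFin \o f).
Proof.
move=> [mf _ fi]; apply/integrableP; split.
  by apply/measurable_EFinP; exact: measurable_funS mf.
by apply: fi => //; exact: segment_compact.
Qed.

Lemma test_bound phi : test_function phi -> exists M, forall x, `|phi x| <= M.
Proof.
by move=> /test_H1[w wE _]; exists (2 * sipn (@g0 R) w) => x; rewrite -wE H1_sup.
Qed.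

Lemma test_measurable phi : test_function phi -> measurable_fun [set: R] phi.
Proof. by move=> /test_L2[]. Qed.

Lemma test_mul_integrable k phi : locally_integrable [set: R] k -> test_function phi ->
  mu.-integrable [set: R] (EFin \o (fun x => k x * phi x)).
Proof.
move=> lk tphi; have [mk _ _] := lk.
have [A A0 HA] := test_support tphi; have [M HM] := test_bound tphi.
have mphi := test_measurable tphi.
have ik := locally_integrable_itv (- A) A lk.
have i1 : mu.-integrable [set: R] ((EFin \o k) \_ `[- A, A]).
  by apply/(integrable_mkcond _ _).1 => //; exact: measurable_itv.
have := integrableZl measurableT M i1; apply: le_integrable => //.
  by apply/measurable_EFinP; exact: measurable_funM.
move=> x _; rewrite patchE; case: ifPn => [_|].
  rewrite /= lee_fin !normrM mulrC ler_wpM2r//.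
  by apply: le_trans (HM x) (ler_norm M).
rewrite notin_setE/= in_itv/= -ler_norml => /negP; rewrite -ltNge => xA.
by rewrite HA ?mulr0 ?normr0 ?lee_fin// ?(ltW xA)//= mule0 abse0.
Qed.

Lemma integral_plateau_cvg k a b : a <= b -> locally_integrable [set: R] k ->
  (fun n => \int[mu]_x (k x * plateau n a b x)) @ \oo --> \int[mu]_(x in `[a, b]) k x.
Proof.
move=> ab lk; have [mk _ _] := lk.
have ik := locally_integrable_itv a b lk.
have mI : measurable (`]a, b[%classic : set R) by exact: measurable_itv.
have iko : mu.-integrable `]a, b[ (EFin \o k).
  apply: integrableS ik => //.
  by move=> x /=; rewrite !in_itv/= => /andP[/ltW -> /ltW ->].
have ikc : mu.-integrable `]a, b] (EFin \o k).
  apply: integrableS ik => //.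
  by move=> x /=; rewrite !in_itv/= => /andP[/ltW -> ->].
have -> : \int[mu]_(x in `[a, b]) k x = \int[mu]_(x in `]a, b[) k x.
  by rewrite Rintegral_itv_bndo_bndc// Rintegral_itv_obnd_cbnd.
have -> : (fun n => \int[mu]_x (k x * plateau n a b x)) =
    (fun n => \int[mu]_(x in `]a, b[) (k x * plateau n a b x)).
  apply/funext => n; rewrite [RHS]Rintegral_mkcond; apply: eq_Rintegral => x _.
  rewrite patchE; case: ifPn => //.
  by rewrite notin_setE/= in_itv/= => /negP xab; rewrite plateau_out ?mulr0.
have mpl n : measurable_fun [set: R] (plateau n a b).
  exact: test_measurable (plateau_test n a b).
have := @dominated_convergence _ _ _ mu `]a, b[%classic mI
  (fun n x => (k x * plateau n a b x)%:E) (EFin \o k) (EFin \o (fun x => `|k x|)).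
case.
- move=> n; apply/measurable_EFinP; apply: measurable_funS (measurable_funM mk (mpl n)) => //.
- by apply/measurable_EFinP; exact: measurable_funS mk.
- apply: aeW => x /=; rewrite in_itv/= => xab; apply: cvg_EFin; first exact: nearW.
  rewrite -[X in _ --> X]mulr1; apply: cvgM; first exact: cvg_cst.
  exact: plateau_cvg.
- exact: integrable_norm iko.
- apply: aeW => x n _; rewrite lee_fin normrM ler_piMr//.
  by have /andP[p0 p1] := plateau_itv n a b x; rewrite ger0_norm.
move=> _ _ H; apply: fine_cvg; rewrite fineK; first exact: H.
exact: integrable_fin_num iko.
Qed.

Lemma test_pairing_eq0 k : locally_integrable [set: R] k ->
  (forall phi, test_function phi -> \int[mu]_x (k x * phi x) = 0) ->
  {ae mu, forall x, k x = 0}.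
Proof.
move=> lk k0; apply: primitive0_ae => // a b ab.
have := integral_plateau_cvg ab lk.
have -> : (fun n => \int[mu]_x (k x * plateau n a b x)) = (fun=> 0).
  by apply/funext => n; apply: k0; exact: plateau_test.
by move=> H; have := cvg_unique _ (cvg_cst (0 : R)) H; move=> <-.
Qed.

(** A plateau minus its translate is the derivative of a test function, so the integral of [k] over
    an interval depends on its length only. At almost every [x], [k x] is then the limit of
    [K r / r], the same number for all [x]. *)
Lemma du_bois_reymond k : locally_integrable [set: R] k ->
  (forall phi, test_function phi -> \int[mu]_x (k x * derive1 phi x) = 0) ->
  exists c, {ae mu, forall x, k x = c}.
Proof.
move=> lk k0.
have shift a b h : a <= b ->
    \int[mu]_(x in `[a, b]) k x = \int[mu]_(x in `[(a + h), (b + h)]) k x.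
  move=> ab; have abh : a + h <= b + h by rewrite lerD2r.
  have H1 := integral_plateau_cvg ab lk; have H2 := integral_plateau_cvg abh lk.
  suff E : (fun n => \int[mu]_x (k x * plateau n a b x)) =
           (fun n => \int[mu]_x (k x * plateau n (a + h) (b + h) x)).
    by move: H1; rewrite E => H1; exact: (cvg_unique _ H1 H2).
  apply/funext => n; apply/eqP; rewrite -subr_eq0 -RintegralB//; last 2 first.
  - exact: test_mul_integrable lk (plateau_test n a b).
  - exact: test_mul_integrable lk (plateau_test n (a + h) (b + h)).
  have [psi tpsi psiE] := test_difference h (plateau_test n a b).
  rewrite -(k0 _ tpsi); apply/eqP; apply: eq_Rintegral => x _.
  by rewrite psiE plateau_shift; ring.
pose K (r : R) := \int[mu]_(x in `[0, r]) k x.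
have KE x r : 0 <= r -> \int[mu]_(y in `[x, x + r]) k y = K r.
  by move=> r0; rewrite /K (shift 0 r x r0) add0r addrC.
have H (n : nat) : {ae mu, forall x : R, - n%:R < x -> is_derive x 1
    (fun y : R => \int[mu]_(t in `[- n%:R, y]) k t) (k x)}.
  have H0 := @FTC1 _ k (BLeft (- n%:R)) (fun y => locally_integrable_itv _ y lk) lk.
  apply: (aeS H0) => x /= H nx; have [] := H _; first by rewrite lte_fin.
  by move=> d1 d2; split; [exact: d1|rewrite -derive1E; exact: d2].
exists (lim (K r / r @[r --> 0^'+])).
apply: (aeS (ae_foralln H)) => x Hx; apply/esym/cvg_lim => //.
pose n := (Num.trunc `|x|).+1.
have nx : - n%:R < x.
  rewrite ltrNl; apply: le_lt_trans (ler_norm _) _; rewrite normrN.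
  exact: truncnS_gt.
have /is_deriveP dK := Hx n nx.
apply/cvgrPdist_le => e e0; have [d d0 Hd] := dK e e0.
near=> r.
have r0 : 0 < r by near: r; exact: nbhs_right_gt.
have := Hd (x + r); rewrite (addrC x r) addrK gtr0_norm//.
have rd : r < d by near: r; exact: nbhs_right_lt.
move=> /(_ rd); rewrite (addrC r x).
have xr : x <= x + r by rewrite lerDl ltW.
rewrite (Rintegral_itv_split (ltW nx) xr); last exact: locally_integrable_itv.
rewrite [X in X - r * _]addrAC subrr add0r (KE x r (ltW r0)) => HK.
have -> : k x - K r / r = - ((K r - r * k x) / r) by field; rewrite gt_eqF.
by rewrite normrN normrM normfV (gtr0_norm r0) ler_pdivrMr.
Unshelve. all: by end_near. Qed.

Lemma primitive_of_L2 g : L2 g -> exists G, prim G g.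
Proof.
move=> Lg; have ig a b := L2_integrable_itv a b Lg.
exists (fun x => if 0 <= x then \int[mu]_(t in `[0, x]) g t
                 else - \int[mu]_(t in `[x, 0]) g t).
split => // x y xy; case: (leP 0 x) => x0; case: (leP 0 y) => y0.
- by rewrite (Rintegral_itv_split x0 xy)// addrAC subrr add0r.
- by have := le_lt_trans x0 (le_lt_trans xy y0); rewrite ltxx.
- by rewrite opprK (Rintegral_itv_split (ltW x0) y0)// addrC.
- by rewrite (Rintegral_itv_split xy (ltW y0))//; ring.
Qed.

Lemma prim_test_parts G g phi : prim G g -> test_function phi ->
  \int[mu]_x (G x * derive1 phi x) = - \int[mu]_x (g x * phi x).
Proof.
move=> pG tphi; have [Lg _] := pG; have tdphi := derive1_test tphi.
have [A A0 HA] := test_support tphi; have [B B0 HB] := test_support tdphi.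
pose C := Num.max A B.
have cG x : {for x, continuous G} by exact: prim_continuous pG x.
have cdphi x : {for x, continuous (derive1 phi)}.
  exact: is_derive_continuous (test_derive tdphi x).
have [M HM] := test_bound tphi.
have Lpg : L2 (fun x => phi x * g x).
  exact: L2_bounded_mul (test_measurable tphi) HM Lg.
have LGp : L2 (fun x => G x * derive1 phi x).
  apply: (@continuous_compact_L2 _ _ B) => x; first exact: (continuousM (@cG x) (@cdphi x)).
  by move=> /HB ->; rewrite mulr0.
have pW := prim_mul pG (test_prim tphi) Lpg LGp.
have i1 : mu.-integrable [set: R] (EFin \o (fun x => phi x * g x)).
  have := L2_mul (test_L2 tphi) Lg; exact.
have i2 : mu.-integrable [set: R] (EFin \o (fun x => G x * derive1 phi x)).
  exact: test_mul_integrable (continuous_locally_integrable cG) tdphi.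
have : \int[mu]_x (phi x * g x + G x * derive1 phi x) = 0.
  have CA : A <= C by rewrite le_max lexx.
  have CB : B <= C by rewrite le_max lexx orbT.
  have [_ /(_ (- C) C)] := pW.
  have C0 : 0 < C by exact: lt_le_trans CA.
  rewrite !HA ?normrN ?(gtr0_norm C0)// !mulr0 subrr => /(_ _)/esym H.
  rewrite -[RHS]H; last by lra.
  rewrite [RHS]Rintegral_mkcond; apply: eq_Rintegral => x _; rewrite patchE.
  case: ifPn => //; rewrite notin_setE/= in_itv/= -ler_norml => /negP; rewrite -ltNge => xC.
  by rewrite HA ?HB ?mulr0 ?mul0r ?addr0// ltW// (le_lt_trans _ xC).
rewrite RintegralD// => H.
have -> : \int[mu]_x (g x * phi x) = \int[mu]_x (phi x * g x).
  by apply: eq_Rintegral => x _; rewrite mulrC.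
by move: H; lra.
Qed.

(** [f] minus a primitive of [g] is orthogonal to all derivatives of test functions, hence almost
    everywhere constant; the constant is added to the primitive. *)
Lemma weak_derivative_prim f g : L2 f -> L2 g ->
  (forall phi, test_function phi ->
     \int[mu]_x (f x * derive1 phi x) = - \int[mu]_x (g x * phi x)) ->
  exists2 F, prim F g & {ae mu, forall x, f x = F x}.
Proof.
move=> Lf Lg fg; have [G pG] := primitive_of_L2 Lg.
have cG x : {for x, continuous G} by exact: prim_continuous pG x.
have lG := continuous_locally_integrable cG.
have lf := L2_locally_integrable Lf.
have [|c Hc] := du_bois_reymond (locally_integrableB lf lG).
  move=> phi tphi; have tdphi := derive1_test tphi.
  have -> : \int[mu]_x ((f x - G x) * derive1 phi x) =
      \int[mu]_x (f x * derive1 phi x - G x * derive1 phi x).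
    by apply: eq_Rintegral => x _; rewrite mulrBl.
  rewrite RintegralB//; last 2 first.
  - exact: test_mul_integrable.
  - exact: test_mul_integrable.
  by rewrite fg// (prim_test_parts pG tphi) subrr.
exists (fun x => G x + c).
  by split => // x y xy; rewrite -(pG.2 x y xy); ring.
by apply: (aeS Hc) => x <-; rewrite addrC subrK.
Qed.

(* If [k] is orthogonal to all test functions then [k'' = k], so [k * k'] is
   nondecreasing; being square integrable it vanishes. *)
Lemma test_orthogonal (k : H1 R) : (forall (w : H1 R) phi, test_function phi ->
    (forall x, w x = phi x) -> g0 k w = 0) -> k = 0.
Proof.
move=> k0.
(* Orthogonality in H^1 says that [dv k] has weak derivative [k]. So [dv k] has a continuous
   representative, the function [m] below, again in H^1. *)
have [|F pF kF] := @weak_derivative_prim (dv k) k (dv_L2 k) (H1_L2 k).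
  move=> phi tphi; have [w wE dw] := test_H1 tphi.
  have := k0 w phi tphi wE; rewrite g0E.
  have -> : ip k w = \int[mu]_x (k x * phi x).
    by apply: eq_Rintegral => x _; rewrite wE.
  have -> : ip (dv k) (dv w) = \int[mu]_x (dv k x * derive1 phi x).
    apply: ip_ae2 => //; try exact: dv_L2; last exact: aeW.
    exact/test_L2/derive1_test.
  by lra.
have LF : L2 F by exact: L2_ae (prim_measurable pF) (dv_L2 k) kF.
have [m mE] := H1_exists LF pF.
have pW := H1_prim_mul k m.
pose W x := k x * m x.
have cW := prim_continuous pW.
have LW : L2 W by exact: H1_mul_L2 (H1_L2 m).
have dWE : {ae mu, forall x, m x * dv k x + k x * dv m x = m x ^+ 2 + k x ^+ 2}.
  have dm := dv_ae pF mE; apply: (aeS (aeI kF dm)) => x [-> ->].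
  by rewrite mE; ring.
have Wincr x y : x <= y -> W y - W x = \int[mu]_(t in `[x, y]) (m t ^+ 2 + k t ^+ 2).
  move=> xy; rewrite (pW.2 x y xy); congr fine; apply: ae_eq_integral.
  - exact: measurable_itv.
  - by apply/measurable_EFinP; apply: measurable_funS (proj1 (proj1 pW)).
  - apply/measurable_EFinP; apply: measurable_funS (measurable_funD
      (measurable_sqr (H1_measurable m)) (measurable_sqr (H1_measurable k))) => //.
  - by apply: (aeS dWE) => t /= -> _.
have Wmono x y : x <= y -> W x <= W y.
  move=> xy; rewrite -subr_ge0 Wincr//; apply: Rintegral_ge0 => t _.
  by rewrite addr_ge0 ?sqr_ge0.
have W0 x : W x = 0.
  apply/eqP; apply: contraT => Wx.
  have c0 : 0 < W x ^+ 2 by rewrite lt_neqAle eq_sym sqrf_eq0 Wx sqr_ge0.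
  (* Length of an interval on which [W] stays at least as large in modulus as at [x]: there the
     integral of [W ^+ 2] would be at least [ip W W + W x ^+ 2]. *)
  pose L := ip W W / W x ^+ 2 + 1.
  have L0 : 0 <= L by rewrite addr_ge0// divr_ge0 ?ip_ge0// ltW.
  have key a b : a <= b -> b - a = L -> (forall t, a <= t <= b -> W x ^+ 2 <= W t ^+ 2) -> False.
    move=> ab abL Wt.
    have : \int[mu]_(t in `[a, b]) (cst (W x ^+ 2) t) <= \int[mu]_(t in `[a, b]) (W t ^+ 2).
      apply: le_Rintegral; [exact: measurable_itv|..|by move=> t /=; rewrite in_itv/=; exact: Wt].
        by apply: continuous_integrable_itv => t _; exact: cst_continuous.
      exact: L2_sqr_itv.
    rewrite Rintegral_itv_cst// abL; have := sqr_itv_le a b LW.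
    have : W x ^+ 2 * L = ip W W + W x ^+ 2 by rewrite /L; field; rewrite Wx.
    by lra.
  have [Wp|Wn] := leP 0 (W x).
    exfalso; apply: (key x (x + L)); [by rewrite lerDl|ring|].
    move=> t /andP[xt _]; have xWt := Wmono _ _ xt.
    by rewrite ler_sqr ?nnegrE// (le_trans Wp).
  exfalso; apply: (key (x - L) x); [by rewrite gerBl|ring|].
  move=> t /andP[_ tx]; have tWx := Wmono _ _ tx.
  by rewrite -(sqrrN (W x)) -(sqrrN (W t)) ler_sqr ?nnegrE; lra.
apply: h0_def; have : {ae mu, forall x, k x = 0}.
  apply: primitive0_ae.
    exact/L2_locally_integrable/H1_L2.
  move=> a b ab; apply/eqP; rewrite -sqrf_eq0 eq_le sqr_ge0 andbT.
  apply: le_trans (integral_sqr_le ab (H1_L2 k)) _.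
  have := Wincr a b ab; rewrite !W0 subrr => H.
  rewrite mulr_ge0_le0 ?subr_ge0// H; apply: le_Rintegral => //.
  - exact: L2_sqr_itv (H1_L2 k).
  - apply: (integrable_itvD (f := fun t => m t ^+ 2) (g := fun t => k t ^+ 2)).
      exact: L2_sqr_itv (H1_L2 m).
    exact: L2_sqr_itv (H1_L2 k).
  - by move=> t _; rewrite lerDr sqr_ge0.
move=> kz; have Lk := H1_L2 k.
transitivity (ip (fun=> 0) (fun=> 0) : R).
  by apply: ip_ae2 => //; exact: L2_0.
rewrite /ip (@eq_Rintegral _ _ _ mu _ (cst 0)) ?Rintegral_cst ?mul0r//.
Qed.

End WeakDerivatives.

(** * Representation of complex functions *)

Section Representation.
Context {R : realType}.
Local Notation mu := (@lebesgue_measure R).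
Local Notation V := (H1 R * H1 R)%type.
Local Notation Re := complex.Re.
Local Notation Im := complex.Im.
Implicit Types (f g : R -> R[i]) (k phi : R -> R) (U : V) (c : R[i]).

Lemma locally_integrable_ae (k1 k2 : R -> R) : measurable_fun [set: R] k1 ->
  {ae mu, forall x, k1 x = k2 x} -> locally_integrable [set: R] k2 ->
  locally_integrable [set: R] k1.
Proof.
move=> m1 k12 [m2 _ i2]; split => //; first exact: openT.
move=> K KT cK.
have -> : (\int[mu]_(x in K) `|k1 x|%:E = \int[mu]_(x in K) `|k2 x|%:E)%E.
  apply: ae_eq_integral; last by apply: (aeS k12) => x -> _.
  - exact: compact_measurable.
  - by apply/measurable_EFinP; apply: measurable_funS (measurableT_comp _ m1).
  - by apply/measurable_EFinP; apply: measurable_funS (measurableT_comp _ m2).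
exact: i2.
Qed.

Lemma pairingE f phi : pairing f phi =
  Complex (\int[mu]_x (Re (f x) * phi x)) (\int[mu]_x (Im (f x) * phi x)).
Proof.
by rewrite /pairing /cintegral; congr Complex; apply: eq_Rintegral => x _;
   case: (f x) => p q; rewrite /= ?mulr0 ?subr0 ?add0r.
Qed.

Lemma sqL2_ip f : L2 (fun x => Re (f x)) -> L2 (fun x => Im (f x)) ->
  sqL2 f = (ip (fun x => Re (f x)) (fun x => Re (f x)) + ip (fun x => Im (f x)) (fun x => Im (f x)))%:E.
Proof.
move=> L1 L2f; rewrite EFinD -!ipE// -ge0_integralD//.
- by move=> x _; rewrite lee_fin sqr_ge0.
- by apply/measurable_EFinP; exact: measurable_sqr (proj1 L1).
- by move=> x _; rewrite lee_fin sqr_ge0.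
- by apply/measurable_EFinP; exact: measurable_sqr (proj1 L2f).
Qed.

Lemma inL2P f : inL2 f <-> L2 (fun x => Re (f x)) /\ L2 (fun x => Im (f x)).
Proof.
split=> [[[m1 m2] H]|[L1 L2f]]; last first.
  by split; [split; [case: L1|case: L2f]|rewrite sqL2_ip// ltry].
have ms : measurable_fun [set: R] (fun x => (sqmod (f x))%:E).
  by apply/measurable_EFinP; apply: measurable_funD; exact: measurable_sqr.
split; apply: L2_intro => //; apply: le_lt_trans H; apply: ge0_le_integral => //.
- by move=> x _; rewrite lee_fin sqr_ge0.
- by apply/measurable_EFinP; exact: measurable_sqr.
- by move=> x _; rewrite lee_fin /sqmod lerDl sqr_ge0.
- by move=> x _; rewrite lee_fin sqr_ge0.
- by apply/measurable_EFinP; exact: measurable_sqr.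
- by move=> x _; rewrite lee_fin /sqmod lerDr sqr_ge0.
Qed.

(** Identifies the derivative picked by [wderiv] with the one built from [dv], up to a null set. *)
Lemma weak_derivative_unique f g1 g2 : is_weak_derivative f g1 -> is_weak_derivative f g2 ->
  {ae mu, forall x, g1 x = g2 x}.
Proof.
move=> [_ [l1 l1'] H1] [_ [l2 l2'] H2].
have H (p q : R -> R) : locally_integrable [set: R] p -> locally_integrable [set: R] q ->
    (forall phi, test_function phi -> \int[mu]_x (p x * phi x) = \int[mu]_x (q x * phi x)) ->
    {ae mu, forall x, p x = q x}.
  move=> lp lq pq; apply: (@aeS _ (fun x => p x - q x = 0)); last first.
    by move=> x /eqP; rewrite subr_eq0 => /eqP.
  apply: test_pairing_eq0 => [|phi tphi]; first exact: locally_integrableB.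
  under eq_Rintegral do rewrite mulrBl.
  by rewrite RintegralB ?pq ?subrr//; exact: test_mul_integrable.
have E phi : test_function phi -> pairing g1 phi = pairing g2 phi.
  by move=> tphi; apply: oppr_inj; rewrite -H1// H2.
have r1 := H _ _ l1 l2 _; have r2 := H _ _ l1' l2' _.
apply: (aeS (aeI (r1 _) (r2 _))) => [phi /E|phi /E|x []].
- by rewrite !pairingE => -[].
- by rewrite !pairingE => -[].
- by case: (g1 x) (g2 x) => p q [p' q'] /= -> ->.
Qed.

(* [f] is the sum of the constant [c] and of the element [U.1 + i U.2] of H^1 *)
Definition represents c f U := cmeasurable f /\
  {ae mu, forall x, Re (f x) = Re c + U.1 x /\ Im (f x) = Im c + U.2 x}.

Lemma affine_prim (c : R) (u : H1 R) : prim (fun x => c + u x) (dv u).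
Proof. by have [L P] := dvP u; split => // x y /P <-; ring. Qed.

Lemma affine_measurable (c : R) (u : H1 R) : measurable_fun [set: R] (fun x => c + u x).
Proof. by apply: measurable_funD => //; exact: H1_measurable. Qed.

Lemma affine_locally_integrable (c : R) (u : H1 R) :
  locally_integrable [set: R] (fun x => c + u x).
Proof.
by apply: continuous_locally_integrable => x; exact: prim_continuous (affine_prim c u) x.
Qed.

Lemma affine_test_parts (c : R) (u : H1 R) k phi : measurable_fun [set: R] k ->
  {ae mu, forall x, k x = c + u x} -> test_function phi ->
  \int[mu]_x (k x * derive1 phi x) = - \int[mu]_x (dv u x * phi x).
Proof.
move=> mk kE tphi; rewrite -(prim_test_parts (affine_prim c u) tphi).
apply: ip_ae => //; first exact: affine_measurable.
exact: test_measurable (derive1_test tphi).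
Qed.

Definition dpair U x : R[i] := Complex (dv U.1 x) (dv U.2 x).

Section Represents.
Variables (c : R[i]) (f : R -> R[i]) (U : V) (rf : represents c f U).

Let m1 : measurable_fun [set: R] (fun x => Re (f x)). Proof. by case: rf => -[]. Qed.
Let m2 : measurable_fun [set: R] (fun x => Im (f x)). Proof. by case: rf => -[]. Qed.

Let e1 : {ae mu, forall x, Re (f x) = Re c + U.1 x}.
Proof. by case: rf => _ /aeS; apply => x []. Qed.
Let e2 : {ae mu, forall x, Im (f x) = Im c + U.2 x}.
Proof. by case: rf => _ /aeS; apply => x []. Qed.

Lemma represents_weak_derivative : is_weak_derivative f (dpair U).
Proof.
split.
- by split; [apply: locally_integrable_ae m1 e1 _|apply: locally_integrable_ae m2 e2 _];
     exact: affine_locally_integrable.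
- by split; apply/L2_locally_integrable/dv_L2.
- move=> phi tphi; rewrite !pairingE (affine_test_parts m1 e1 tphi).
  by rewrite (affine_test_parts m2 e2 tphi).
Qed.

Lemma sqL2_wderiv : sqL2 (wderiv f) = (sip_pair (@d0 R) U U)%:E.
Proof.
(* A weak derivative exists, hence [xget] returns one and not its default value 0. *)
have wf : is_weak_derivative f (wderiv f).
  by rewrite /wderiv; exact: (xgetPex (fun=> 0) (ex_intro _ _ represents_weak_derivative)).
have E := weak_derivative_unique wf represents_weak_derivative.
have [_ [[mw1 _ _] [mw2 _ _]] _] := wf.
have <- : sqL2 (dpair U) = (sip_pair (@d0 R) U U)%:E.
  by rewrite sqL2_ip//; exact: dv_L2.
have Ld1 := dv_L2 U.1; have Ld2 := dv_L2 U.2.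
apply: ae_eq_integral => //.
- by apply/measurable_EFinP; apply: measurable_funD; exact: measurable_sqr.
- apply/measurable_EFinP; apply: measurable_funD; apply: measurable_sqr.
    by case: Ld1.
  by case: Ld2.
- by apply: (aeS E) => x -> _.
Qed.

Lemma pairing_derive2 phi (w : H1 R) : test_function phi -> (forall x, w x = phi x) ->
  pairing f (derive1n 2 phi) = - Complex (d0 U.1 w) (d0 U.2 w).
Proof.
move=> tphi wE; have tdphi := derive1_test tphi.
have dw := dv_ae (test_prim tphi) wE.
have H (u : H1 R) : \int[mu]_x (dv u x * derive1 phi x) = d0 u w.
  apply/esym/ip_ae2; [exact: dv_L2|exact: dv_L2|exact: dv_L2|exact: test_L2|exact: aeW|exact: dw].
have -> : derive1n 2 phi = derive1 (derive1 phi) by [].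
by rewrite pairingE (affine_test_parts m1 e1)// (affine_test_parts m2 e2)// !H.
Qed.

(** The constant part contributes [c] times the integral of [phi], which does not depend on time and
    disappears in the time derivative. *)
Lemma pairing_represents phi (w : H1 R) : test_function phi -> (forall x, w x = phi x) ->
  pairing f phi = Complex (Re c * \int[mu]_x phi x + h0 U.1 w) (Im c * \int[mu]_x phi x + h0 U.2 w).
Proof.
move=> tphi wE.
have H k (b : R) (u : H1 R) : measurable_fun [set: R] k ->
    {ae mu, forall x, k x = b + u x} ->
    \int[mu]_x (k x * phi x) = b * \int[mu]_x phi x + h0 u w.
  move=> mk kE; have mphi := test_measurable tphi.
  have lc (z : R) : locally_integrable [set: R] (fun=> z).
    by apply: continuous_locally_integrable => x; exact: cst_continuous.
  have -> : \int[mu]_x (k x * phi x) = \int[mu]_x ((b + u x) * phi x).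
    by apply: ip_ae => //; exact: affine_measurable.
  under eq_Rintegral do rewrite mulrDl.
  rewrite RintegralD//; last 2 first.
  - exact: test_mul_integrable (lc b) tphi.
  - exact: test_mul_integrable (L2_locally_integrable (H1_L2 u)) tphi.
  congr (_ + _); last by apply: eq_Rintegral => x _; rewrite wE.
  rewrite RintegralZl//; have := test_mul_integrable (lc 1) tphi; congr integrable.
  by apply/funext => x /=; rewrite mul1r.
by rewrite pairingE (H _ _ _ m1 e1) (H _ _ _ m2 e2).
Qed.

Local Notation N := (nls_N (Re c) (Im c)).

Lemma potential_represents : potential c f = (nls_P (Re c) (Im c) U)%:E.
Proof.
rewrite -[nls_P _ _ U]/(ip (nls_s _ _ U) (nls_s _ _ U)) -(ipE (H1_L2 _)).
apply: ae_eq_integral => //.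
- apply/measurable_EFinP; apply: measurable_sqr; apply: measurable_funB => //.
  by apply: measurable_funD; exact: measurable_sqr.
- by apply/measurable_EFinP; apply: measurable_sqr; exact: H1_measurable.
- apply: (aeS (aeI e1 e2)) => x [E1 E2] _; rewrite /sqmod E1 E2 /nls_s !H1E.
  by congr ((_ ^+ 2)%:E); ring.
Qed.

Lemma pairing_nonlinearity phi (w : H1 R) : test_function phi -> (forall x, w x = phi x) ->
  pairing (nonlinearity c f) phi = Complex (h0 (N U).1 w) (h0 (N U).2 w).
Proof.
move=> tphi wE; have mphi := test_measurable tphi.
have ms : measurable_fun [set: R] (fun x => sqmod (f x) - sqmod c).
  by apply: measurable_funB => //; apply: measurable_funD; exact: measurable_sqr.
have RE x : Re (nonlinearity c f x) = (sqmod (f x) - sqmod c) * Re (f x).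
  by rewrite /nonlinearity; case: (f x) => p q /=; rewrite mul0r subr0.
have IE x : Im (nonlinearity c f x) = (sqmod (f x) - sqmod c) * Im (f x).
  by rewrite /nonlinearity; case: (f x) => p q /=; rewrite mul0r addr0.
have E : {ae mu, forall x, (sqmod (f x) - sqmod c) * Re (f x) = (N U).1 x /\
    (sqmod (f x) - sqmod c) * Im (f x) = (N U).2 x}.
  apply: (aeS (aeI e1 e2)) => x [E1 E2]; rewrite /sqmod E1 E2 /nls_N /nls_s !H1E.
  by split; ring.
rewrite pairingE; congr Complex.
  transitivity (ip (N U).1 phi); last by apply: eq_Rintegral => x _; rewrite wE.
  under eq_Rintegral do rewrite RE.
  apply: ip_ae => //; [exact: measurable_funM|exact: H1_measurable|].
  by apply: (aeS E) => x [].
transitivity (ip (N U).2 phi); last by apply: eq_Rintegral => x _; rewrite wE.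
under eq_Rintegral do rewrite IE.
apply: ip_ae => //; [exact: measurable_funM|exact: H1_measurable|].
by apply: (aeS E) => x [].
Qed.

End Represents.

Lemma represents_L2 f U : represents 0 f U -> L2 (fun x => Re (f x)) /\ L2 (fun x => Im (f x)).
Proof.
move=> [[m1 m2] E]; split.
  apply: L2_ae (H1_L2 U.1) _ => //; apply: (aeS E) => x /= [-> _].
  by rewrite add0r.
apply: L2_ae (H1_L2 U.2) _ => //; apply: (aeS E) => x /= [_ ->].
by rewrite add0r.
Qed.

Lemma represents_inH1 f U : represents 0 f U -> inH1 f.
Proof.
move=> rf; split; first exact/inL2P/represents_L2/rf.
exists (dpair U); first exact: represents_weak_derivative rf.
by apply/inL2P; split; exact: dv_L2.
Qed.

Lemma inH1_represents f : inH1 f -> exists U, represents 0 f U.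
Proof.
move=> [fL2 [g [_ _ fg] gL2]]; have [mf _] := fL2.
have [L1 L1'] := (inL2P _).1 fL2; have [L2g L2g'] := (inL2P _).1 gL2.
have [|F1 p1 E1] := weak_derivative_prim L1 L2g.
  by move=> phi /fg; rewrite !pairingE => -[].
have [|F2 p2 E2] := weak_derivative_prim L1' L2g'.
  by move=> phi /fg; rewrite !pairingE => -[].
have [u1 u1E] := H1_exists (L2_ae (prim_measurable p1) L1 E1) p1.
have [u2 u2E] := H1_exists (L2_ae (prim_measurable p2) L1' E2) p2.
exists (u1, u2); split => //; apply: (aeS (aeI E1 E2)) => x /= [-> ->].
by rewrite !add0r u1E u2E.
Qed.

Lemma H1norm_represents f U : represents 0 f U ->
  H1norm f = (sipn (sip_add (sip_pair (@h0 R)) (sip_pair (@d0 R)) ler01) U)%:E.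
Proof.
move=> rf; have [L1 L2f] := represents_L2 rf; have [[m1 m2] E] := rf.
rewrite /H1norm (sqL2_wderiv rf) sqL2_ip//.
have -> : ip (fun x => Re (f x)) (fun x => Re (f x)) = ip U.1 U.1.
  by apply: ip_ae2 => //; [exact: H1_L2|exact: H1_L2|..]; apply: (aeS E) => x /= [-> _];
     rewrite add0r.
have -> : ip (fun x => Im (f x)) (fun x => Im (f x)) = ip U.2 U.2.
  by apply: ip_ae2 => //; [exact: H1_L2|exact: H1_L2|..]; apply: (aeS E) => x /= [_ ->];
     rewrite add0r.
rewrite -EFinD poweR_EFin; congr (_%:E).
by rewrite powR12_sqrt ?addr_ge0 ?ip_ge0 ?sip_ge0// /sipn /= mul1r.
Qed.

Definition test_pair U := exists phi psi, [/\ test_function phi, test_function psi,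
  forall x, U.1 x = phi x & forall x, U.2 x = psi x].

Lemma test_pair_subspace : subspace test_pair.
Proof.
have t0 : test_function (fun=> 0 : R).
  apply: (@test_of_Cn _ _ 0 0) => // n; elim: n => // n IH.
  by exists (fun=> 0 : R) => // x; exact: is_derive_cst.
split; first by exists (fun=> 0 : R), (fun=> 0 : R).
move=> b u v [p [q [tp tq Ep Eq]]] [p' [q' [tp' tq' Ep' Eq']]].
exists (fun x => b * p x + p' x), (fun x => b * q x + q' x); split.
- exact: test_lin.
- exact: test_lin.
- by move=> x; rewrite !pairE !H1E Ep Ep'.
- by move=> x; rewrite !pairE !H1E Eq Eq'.
Qed.

Lemma test_pair_dense (g := sip_add (sip_pair (@h0 R)) (sip_pair (@d0 R)) ler01) U (e : R) :
  0 < e -> exists2 w, test_pair w & sipn g (w - U) < e.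
Proof.
apply: dense_of_orthogonal; [exact: nls_complete|exact: test_pair_subspace|].
move=> k k0; have t0 := test_pair_subspace.1.
have kz (u : H1 R) : (forall (w : H1 R) phi, test_function phi ->
    (forall x, w x = phi x) -> g0 u w = 0) -> u = 0 by exact: test_orthogonal.
have [z [_ [tz _ zE _]]] := t0.
have E w1 w2 : g k (w1, w2) = g0 k.1 w1 + g0 k.2 w2.
  rewrite -[LHS]/(h0 k.1 w1 + h0 k.2 w2 + 1 * (d0 k.1 w1 + d0 k.2 w2)).
  rewrite -[g0 k.1 w1]/(h0 k.1 w1 + 1 * d0 k.1 w1) -[g0 k.2 w2]/(h0 k.2 w2 + 1 * d0 k.2 w2).
  by ring.
have k1 : k.1 = 0.
  apply: kz => w phi tphi wE; have := k0 (w, 0); rewrite E sip0r addr0.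
  by apply; exists phi, z.
have k2 : k.2 = 0.
  apply: kz => w phi tphi wE; have := k0 (0, w); rewrite E sip0r add0r.
  by apply; exists z, phi.
by rewrite [k]surjective_pairing k1 k2 -[(0, 0)]/(0 : V) sip0l.
Qed.

End Representation.

(** * The equation, the dissipation and the theorem *)

Section Dissipation.
Context {R : realType}.
Local Notation mu := (@lebesgue_measure R).
Variables (p : R -> R) (T0 : R) (T00 : 0 < T0).
Hypothesis p_ge0 : forall t, 0 <= p t.
Hypothesis p_cont : forall t, {for t, continuous p}.

Let q t := (4 * t ^+ 2)^-1 * p t.

Let q_ge0 t : 0 <= q t.
Proof. by rewrite mulr_ge0// invr_ge0 mulr_ge0 ?sqr_ge0. Qed.

Let q_cont t : T0 <= t -> {for t, continuous q}.
Proof.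
move=> Tt; have t0 := lt_le_trans T00 Tt.
have c1 : {for t, continuous (fun t : R => (4 * t ^+ 2)^-1)}.
  apply: continuousV; first by rewrite mulf_neq0 ?expf_neq0 ?gt_eqF.
  by apply: continuousM; [exact: cst_continuous|exact: exprn_continuous].
exact: (continuousM c1 (@p_cont t)).
Qed.

(** The function [G] to be used in [es_solution], with [p t] the potential at time [t]. *)
Definition dissipated t := \int[mu]_(s in `[T0, t]) q s.

Lemma dissipated_ge0 t : 0 <= dissipated t.
Proof. by apply: Rintegral_ge0 => s _. Qed.

Lemma is_derive_dissipated t : T0 < t -> is_derive t 1 dissipated (q t).
Proof. exact: is_derive_primitive q_cont t. Qed.

Lemma dissipated_small e : 0 < e ->
  exists2 r, 0 < r & forall s, T0 < s -> s - T0 < r -> dissipated s < e.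
Proof.
move=> e0; have [||M HM] := @compact_bound _ q T0 (T0 + 1); first by rewrite lerDl.
  by move=> t /andP[Tt _]; exact: q_cont.
have M0 : 0 <= M by have := HM T0; rewrite lexx lerDl ler01 => /(_ isT); exact: le_trans.
exists (Num.min 1 (e / (M + 1))); first by rewrite lt_min ltr01 divr_gt0// ltr_wpDl.
move=> s Ts; rewrite lt_min => /andP[s1 se].
have : dissipated s <= \int[mu]_(t in `[T0, s]) M.
  apply: le_Rintegral; first exact: measurable_itv.
  - by apply: continuous_integrable_itv => t /andP[Tt _]; exact: q_cont.
  - by apply: continuous_integrable_itv => t _; exact: cst_continuous.
  - by move=> t /=; rewrite in_itv/= => /andP[Tt ts]; apply: HM; lra.
rewrite (Rintegral_itv_cst _ (ltW Ts)) => /le_lt_trans; apply.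
move: se; rewrite ltr_pdivlMr; last by rewrite ltr_wpDl.
have : 0 < s - T0 by rewrite subr_gt0.
nra.
Qed.

Section Bounded.
Variables (B : R) (HB : forall t, T0 < t -> dissipated t <= B).

(** Monotone convergence along [[T0, T0 + n + 1]]; the factor 4 is the one in [q = p / (4 t^2)]. *)
Lemma dissipation_integral :
  (\int[mu]_(t in `[T0, +oo[) ((p t)%:E * (t ^- 2)%:E) <= (4 * B)%:E)%E.
Proof.
pose F n : set R := `[T0, T0 + n.+1%:R]%classic.
have qE t : (p t * t ^- 2) = 4 * q t.
  by rewrite /q (invfM 4) -[_ / _ * p t]mulrA mulVKf ?pnatr_eq0// mulrC.
have FT n t : F n t -> T0 <= t by rewrite /F/= in_itv/= => /andP[].
have FE : `[T0, +oo[%classic = \bigcup_i F i.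
  apply/seteqP; split=> t /=; last by move=> [n _ /FT]; rewrite in_itv/= andbT.
  rewrite in_itv/= andbT => Tt; exists (Num.trunc (t - T0)) => //.
  by rewrite /F/= in_itv/= Tt/= -lerBlDl ltW// truncnS_gt.
have mq n : mu.-integrable (F n) (EFin \o q).
  by apply: continuous_integrable_itv => t /andP[Tt _]; exact: q_cont.
rewrite FE.
have -> : (\int[mu]_(t in \bigcup_i F i) ((p t)%:E * (t ^- 2)%:E) =
    \int[mu]_(t in \bigcup_i F i) (4 * q t)%:E)%E.
  by apply: eq_integral => t _; rewrite -EFinM qE.
have H : ((fun i => \int[mu]_(x in F i) (4 * q x)%:E) @ \oo -->
    \int[mu]_(x in \bigcup_i F i) (4 * q x)%:E)%E.
  apply: ge0_nondecreasing_set_cvg_integral.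
  - move=> n m nm; apply/subsetPset => t; rewrite /F/= !in_itv/= => /andP[-> tn]/=.
    by apply: le_trans tn _; rewrite lerD2l ler_nat.
  - by move=> n; exact: measurable_itv.
  - move=> n; have /integrableP[/measurable_EFinP mqn _] := mq n.
    by apply/measurable_EFinP; exact: measurable_funM.
  - by move=> n t _; rewrite lee_fin mulr_ge0.
rewrite -(cvg_lim _ H)//; apply: lime_le; first by apply/cvg_ex; eexists; exact: H.
apply: nearW => n.
have i4 : mu.-integrable (F n) (EFin \o (fun x => 4 * q x)) by exact: integrable_itvZ (mq n).
rewrite -[leLHS]fineK; last by apply: (integrable_fin_num _ i4); exact: measurable_itv.
rewrite lee_fin -/(Rintegral _ _ _) (RintegralZl _ _ (mq n)); last exact: measurable_itv.
by rewrite ler_pM2l// HB// ltrDl.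
Qed.

(** If [p t / t] were at least [c > 0] for large [t], then [q t >= c / (4 t)] and the dissipated
    amount would grow like [c / 4 * ln t], beyond the bound [B]. *)
Lemma dissipation_liminf : limf_einf (fun t : R => (t^-1)%:E * (p t)%:E)%E +oo = 0%E.
Proof.
rewrite limf_einfE; apply/eqP; rewrite eq_le; apply/andP; split; last first.
  apply: le_ereal_sup_tmp; exists (ereal_inf ((fun t => (t^-1)%:E * (p t)%:E)%E @` `]0, +oo[%classic)).
    by exists `]0, +oo[%classic => //; exists 0; split => // x /= x0; rewrite in_itv/= x0.
  apply: le_ereal_inf_tmp => _ [t /= + <-]; rewrite in_itv/= andbT => t0.
  by rewrite -EFinM lee_fin mulr_ge0// invr_ge0 ltW.
apply: ge_ereal_sup => _ [A [M [_ HM]] <-]; rewrite leNgt; apply/negP => A0.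
(* The infimum may be infinite; any positive real then serves as [c]. *)
have [c c0 cA] : exists2 c : R, 0 < c &
    (c%:E <= ereal_inf ((fun t => (t^-1)%:E * (p t)%:E)%E @` A))%E.
  case: ereal_inf A0 => [r|_|//]; first by rewrite lte_fin => r0; exists r.
  by exists 1; rewrite ?leey.
pose a := Num.max M T0 + 1.
have aM : M < a by rewrite ltr_pwDr// le_max lexx.
have aT : T0 < a by rewrite ltr_pwDr// le_max lexx orbT.
have a0 := lt_trans T00 aT.
have cp t : a <= t -> c <= t^-1 * p t.
  move=> at_; rewrite -lee_fin; apply: le_trans cA _; apply: ereal_inf_lbound.
  by exists t; [apply: HM; exact: lt_le_trans at_|rewrite EFinM].
(* From [a] to [expR K * a] the logarithm grows by [K], so the dissipation grows by at least
   [c / 4 * K = B + 1]. *)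
pose K := 4 * (B + 1) / c.
have B0 : 0 <= B := le_trans (dissipated_ge0 _) (HB aT).
have K0 : 0 <= K by rewrite divr_ge0 ?mulr_ge0 ?addr_ge0// ltW.
pose b := expR K * a.
have ab : a <= b by rewrite ler_peMl ?(ltW a0)// -[leLHS]expR0 ler_expR.
have := @le_derive_nincr _ (fun t => c / 4 * ln t - dissipated t)
  (fun t => c / 4 * t^-1 - q t) a b ab.
have lnb : ln b = K + ln a by rewrite lnM ?posrE ?expR_gt0// expRK.
rewrite lnb; have Tb := lt_le_trans aT ab; have := HB Tb; have := dissipated_ge0 a.
have cK : c / 4 * K = B + 1 by rewrite /K; field; rewrite gt_eqF.
move=> da db H.
suff : c / 4 * (K + ln a) - dissipated b <= c / 4 * ln a - dissipated a by lra.
apply: H => t /andP[at_ tb]; have Tt := lt_le_trans aT at_; have t0 := lt_trans T00 Tt.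
  apply: is_derive_subf; last exact: is_derive_dissipated.
  by apply: is_derive_scalef; exact: is_derive1_ln.
have := cp t at_; rewrite /q subr_le0 => H1.
have -> : (4 * t ^+ 2)^-1 * p t = 4^-1 * t^-1 * (t^-1 * p t).
  by field; rewrite gt_eqF.
have -> : c / 4 * t^-1 = 4^-1 * t^-1 * c by ring.
by rewrite ler_wpM2l// mulr_ge0 ?invr_ge0// ltW.
Qed.

End Bounded.
End Dissipation.

(** * Translation between curves in the energy space and solutions of the equation *)

Section WeakEquation.
Context {R : realType}.
Local Notation mu := (@lebesgue_measure R).
Local Notation V := (H1 R * H1 R)%type.
Local Notation Re := complex.Re.
Local Notation Im := complex.Im.
Variable a : R[i].
Local Notation X := (nls_space (Re a) (Im a)).
Local Notation h := (es_h X).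
Local Notation d := (es_d X).
Local Notation N := (nls_N (Re a) (Im a)).
Local Notation g := (es_g X).
Implicit Types (v : R -> R -> R[i]) (W : R -> V) (U : V) (phi : V).

Lemma weak_rhs_pair t U phi : weak_rhs X t U phi =
  (d0 U.1 phi.2 + t^-1 * h0 (N U).1 phi.2) - (d0 U.2 phi.1 + t^-1 * h0 (N U).2 phi.1).
Proof.
rewrite -[LHS]/(- (d0 U.1 (- phi.2) + d0 U.2 phi.1 +
  t^-1 * (h0 (N U).1 (- phi.2) + h0 (N U).2 phi.1))).
by move: (N U) => [n1 n2]; rewrite !sipNr; ring.
Qed.

Lemma schrodinger_parts (r d1 d2 x1 x2 n1 n2 : R) :
  - ('i%C * Complex d1 d2) + - Complex x1 x2 - r%:C%C * Complex n1 n2 =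
  Complex (d2 - (x1 + r * n1)) (- d1 - (x2 + r * n2)).
Proof. by congr Complex; rewrite /=; ring. Qed.

Let complex_eq0 (x y : R) : Complex x y = 0 -> x = 0 /\ y = 0.
Proof. by case. Qed.

Lemma energy_represents v t U : represents a (v t) U -> energy a v t = (es_energy X t U)%:E.
Proof.
by move=> rv; rewrite /energy (sqL2_wderiv rv) (potential_represents rv) -!EFinM -EFinD.
Qed.

Lemma represents_shift c f U : represents c f U <-> represents 0 (fun x => f x - c) U.
Proof.
have RE x : Re (f x - c) = Re (f x) - Re c by case: (f x); case: (c).
have IE x : Im (f x - c) = Im (f x) - Im c by case: (f x); case: (c).
split=> [[[m1 m2] E]|[[m1 m2] E]]; split.
- split.
    by under eq_fun do rewrite RE; exact: measurable_funB.
  by under eq_fun do rewrite IE; exact: measurable_funB.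
- by apply: (aeS E) => x [E1 E2]; rewrite RE IE E1 E2 /=; split; ring.
- have HR : (fun x => Re (f x)) = (fun x => Re (f x - c) + Re c).
    by apply/funext => x; rewrite RE subrK.
  have HI : (fun x => Im (f x)) = (fun x => Im (f x - c) + Im c).
    by apply/funext => x; rewrite IE subrK.
  by rewrite /cmeasurable HR HI; split; exact: measurable_funD.
- apply: (aeS E) => x; rewrite RE IE /= => -[E1 E2].
  by split; [rewrite -[LHS](subrK (Re c)) E1|rewrite -[LHS](subrK (Im c)) E2]; ring.
Qed.

Lemma represents_sub f1 f2 U1 U2 : represents 0 f1 U1 -> represents 0 f2 U2 ->
  represents 0 (fun x => f1 x - f2 x) (U1 - U2).
Proof.
move=> [[m1 m1'] E1] [[m2 m2'] E2].
have RE x : Re (f1 x - f2 x) = Re (f1 x) - Re (f2 x) by case: (f1 x) (f2 x) => ? ? [].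
have IE x : Im (f1 x - f2 x) = Im (f1 x) - Im (f2 x) by case: (f1 x) (f2 x) => ? ? [].
split; [split|].
- by under eq_fun do rewrite RE; exact: measurable_funB.
- by under eq_fun do rewrite IE; exact: measurable_funB.
- apply: (aeS (aeI E1 E2)) => x [[A1 B1] [A2 B2]]; rewrite RE IE A1 A2 B1 B2 !pairE !H1E /=.
  by split; ring.
Qed.

Section Path.
Variables (v : R -> R -> R[i]) (W : R -> V) (T0 : R).
Hypothesis rv : forall s, T0 <= s -> represents a (v s) (W s).

(** A real test function has a complex pairing: the test vectors [(w, 0)] and [(0, w)] give its real
    and its imaginary part. *)
Lemma weak_equation t : T0 < t ->
  (forall phi, is_derive t 1 (fun s => h (W s) phi) (weak_rhs X t (W t) phi)) ->
  equation_at a v t.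
Proof.
move=> Tt dW phi tphi; have [w wE _] := test_H1 tphi; have r0 := ltW Tt.
have rr : 0 < t - T0 by rewrite subr_gt0.
exists (Complex (weak_rhs X t (W t) (w, 0)) (weak_rhs X t (W t) (0, w))).
  have near s : `|s - t| < t - T0 -> T0 <= s by rewrite ltr_norml => /andP[]; lra.
  split.
    apply: (@is_derive_near_eq _ (fun s => Re a * (\int[mu]_x phi x) + h (W s) (w, 0)) _ _ _ _ rr).
      move=> s /near Ts; rewrite (pairing_represents (rv Ts) tphi wE).
      by rewrite -[h _ _]/(h0 (W s).1 w + h0 (W s).2 0) sip0r addr0.
    have := is_derive_addf (is_derive_cst (Re a * (\int[mu]_x phi x)) t 1) (dW (w, 0)).
    by rewrite add0r; apply.
  apply: (@is_derive_near_eq _ (fun s => Im a * (\int[mu]_x phi x) + h (W s) (0, w)) _ _ _ _ rr).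
    move=> s /near Ts; rewrite (pairing_represents (rv Ts) tphi wE).
    by rewrite -[h _ _]/(h0 (W s).1 0 + h0 (W s).2 w) sip0r add0r.
  have := is_derive_addf (is_derive_cst (Im a * (\int[mu]_x phi x)) t 1) (dW (0, w)).
  by rewrite add0r; apply.
rewrite (pairing_derive2 (rv r0) tphi wE) (pairing_nonlinearity (rv r0) tphi wE).
rewrite schrodinger_parts !weak_rhs_pair !sip0r.
by congr Complex; rewrite -?[(0 : R[i])]/(Complex 0 0); ring.
Qed.

(** Up to constants in time, [h (W s) phi] is the real part of the pairing with [p] plus the
    imaginary part of the pairing with [q]. Each of the two complex equations supplies the one
    derivative that is used. *)
Lemma equation_weak t phi : T0 < t -> equation_at a v t -> test_pair phi ->
  is_derive t 1 (fun s => h (W s) phi) (weak_rhs X t (W t) phi).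
Proof.
move=> Tt eqv [p [q [tp tq pE qE]]]; have r0 := ltW Tt.
have rr : 0 < t - T0 by rewrite subr_gt0.
have near s : `|s - t| < t - T0 -> T0 <= s by rewrite ltr_norml => /andP[]; lra.
have [[d1 d2] [D1 _]] := eqv p tp.
rewrite (pairing_derive2 (rv r0) tp pE) (pairing_nonlinearity (rv r0) tp pE).
rewrite schrodinger_parts => /complex_eq0[_ E1].
have [[e1 e2] [_ D2]] := eqv q tq.
rewrite (pairing_derive2 (rv r0) tq qE) (pairing_nonlinearity (rv r0) tq qE).
rewrite schrodinger_parts => /complex_eq0[E2 _].
have -> : weak_rhs X t (W t) phi = e2 + d1.
  by rewrite weak_rhs_pair; move: E1 E2; lra.
apply: (@is_derive_near_eq _ (fun s => (Im (pairing (v s) q) - Im a * \int[mu]_x q x) +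
  (Re (pairing (v s) p) - Re a * \int[mu]_x p x)) _ _ _ _ rr).
  move=> s /near Ts.
  have -> : Re (pairing (v s) p) = Re a * (\int[mu]_x p x) + h0 (W s).1 phi.1.
    by rewrite (pairing_represents (rv Ts) tp pE).
  have -> : Im (pairing (v s) q) = Im a * (\int[mu]_x q x) + h0 (W s).2 phi.2.
    by rewrite (pairing_represents (rv Ts) tq qE).
  by rewrite -[h _ _]/(h0 (W s).1 phi.1 + h0 (W s).2 phi.2); ring.
apply: is_derive_addf; rewrite -[X in is_derive _ _ _ X]subr0.
  by apply: is_derive_subf => //; exact: is_derive_cst.
by apply: is_derive_subf => //; exact: is_derive_cst.
Qed.

(** Continuity relative to the half line becomes continuity on R once time is frozen before [T0], as
    the maximum with [T0] does not increase distances. *)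
Lemma continuous_H1_vcont : continuous_H1 `[T0, +oo[ (fun t x => v t x - a) ->
  forall t, vcont g (fun s => W (Num.max s T0)) t.
Proof.
move=> [_ cv] t e e0; have Tm : T0 <= Num.max t T0 by rewrite le_max lexx orbT.
have := cv (Num.max t T0); rewrite /= in_itv/= andbT => /(_ Tm) H.
have /H : nbhs 0%E [set y : \bar R | (y < e%:E)%E] by apply: open_ereal_lt'; rewrite lte_fin.
move=> /nbhs_ballP[r /= r0 Hr]; exists r => // s st.
have Ts : T0 <= Num.max s T0 by rewrite le_max lexx orbT.
have := Hr (Num.max s T0); rewrite /= in_itv/= andbT.
rewrite (H1norm_represents (represents_sub ((represents_shift _ _ _).1 (rv Ts))
  ((represents_shift _ _ _).1 (rv Tm)))) lte_fin; apply => //.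
apply: le_lt_trans st; rewrite distrC.
by rewrite /Num.max; case: (ltP s T0) => s1; case: (ltP t T0) => t1;
   rewrite ?subrr ?normr0 ?normr_ge0//; rewrite ler_norml; apply/andP; split;
   have := ler_norm (s - t); have := ler_norm (t - s); rewrite (distrC t s); lra.
Qed.

End Path.

Lemma vcont_continuous_H1 v W (I : set R) : (forall s, represents a (v s) (W s)) ->
  (forall t, vcont g W t) -> continuous_H1 I (fun t x => v t x - a).
Proof.
move=> rv cW; split => t _; first exact: represents_inH1 ((represents_shift _ _ _).1 (rv t)).
apply: cvg_within_filter.
have -> : (fun s => H1norm (fun x => v s x - a - (v t x - a))) =
    EFin \o (fun s => sipn g (W s - W t)).
  apply/funext => s; rewrite (H1norm_represents (represents_sub
    ((represents_shift _ _ _).1 (rv s)) ((represents_shift _ _ _).1 (rv t)))).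
  by [].
apply: cvg_EFin; first exact: nearW.
apply/cvgrPdist_lt => e e0; have [r r0 Hr] := cW t e e0.
apply/nbhs_ballP; exists r => //= s; rewrite /ball/= distrC => /Hr.
by rewrite sub0r normrN ger0_norm ?sipn_ge0.
Qed.

End WeakEquation.

Lemma represents_unique {R : realType} (c : R[i]) f1 f2 U : represents c f1 U ->
  represents c f2 U -> {ae @lebesgue_measure R, forall x, f1 x = f2 x}.
Proof.
move=> [_ E1] [_ E2]; apply: (aeS (aeI E1 E2)) => x.
by case: (f1 x) (f2 x) => ? ? [? ?] /= [[-> ->] [-> ->]].
Qed.

Lemma represents_inj {R : realType} (c : R[i]) f1 f2 U1 U2 : represents c f1 U1 ->
  represents c f2 U2 -> {ae @lebesgue_measure R, forall x, f1 x = f2 x} -> U1 = U2.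
Proof.
move=> [_ E1] [_ E2] E12.
have H : {ae @lebesgue_measure R, forall x, (U1 - U2).1 x = 0 /\ (U1 - U2).2 x = 0}.
  apply: (aeS (aeI E12 (aeI E1 E2))) => x [-> [[-> ->] [/addrI A1 /addrI A2]]].
  by rewrite !pairE !H1E A1 A2 !subrr.
have Z (u : H1 R) : {ae @lebesgue_measure R, forall x, u x = 0} -> u = 0.
  move=> u0; apply: h0_def; transitivity (ip (fun=> 0 : R) (fun=> 0 : R)).
    by apply: ip_ae2 => //; first [exact: H1_L2|exact: L2_0].
  by rewrite /ip (@eq_Rintegral _ _ _ _ _ (cst 0)) ?Rintegral_cst ?mul0r//.
have Z1 : (U1 - U2).1 = 0 by apply: Z; apply: (aeS H) => x [].
have Z2 : (U1 - U2).2 = 0 by apply: Z; apply: (aeS H) => x [].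
by apply/eqP; rewrite -subr_eq0 [U1 - U2]surjective_pairing Z1 Z2.
Qed.

Lemma vcont_P {R : realType} {V : lmodType R} (X : energy_space V) (v : R -> V) t :
  (forall t, vcont (es_g X) v t) -> {for t, continuous (fun s => es_P X (v s))}.
Proof.
move=> cv; apply/continuous_epsP => e e0.
have [M M0 HM] := @vcont_bounded _ _ X v (t - 1) (t + 1) ltac:(lra) cv.
have K0 : 0 < es_K X M + 1 by rewrite ltr_wpDl ?es_K_ge0.
have [r r0 Hr] := cv t (e / (es_K X M + 1)) ltac:(by rewrite divr_gt0).
exists (Num.min r 1); first by rewrite lt_min r0 ltr01.
move=> s; rewrite lt_min => /andP[/Hr + s1]; rewrite ltr_pdivlMr// => Hs.
have vs : sipn (es_g X) (v s) <= M by apply: HM; move: s1; rewrite ltr_norml; lra.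
have vt : sipn (es_g X) (v t) <= M by apply: HM; lra.
apply: le_lt_trans (es_P_lip vs vt) _; apply: le_lt_trans Hs.
have := sipn_h_le X (v s - v t); have := es_K_ge0 X M; have := sipn_ge0 (es_h X) (v s - v t).
by nra.
Qed.

Theorem theorem1p3 (R : realType) (a : R[i]) (t0 : R) (t0_gt0 : 0 < t0)
    (eps0 : R -> R[i]) (eps0_H1 : inH1 eps0) :
  exists v : R -> R -> R[i],
    [/\ is_solution a t0 eps0 v,
        forall w, is_solution a t0 eps0 w ->
          forall t, t0^-1 <= t ->
            {ae @lebesgue_measure R, forall x, w t x = v t x},
        forall t, t0^-1 <= t ->
          (sqL2 (wderiv (v t)) <= 2%:E * energy a v (t0^-1)%R)%E,
        (\int[@lebesgue_measure R]_(t in `[(t0^-1)%R, +oo[)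
            (potential a (v t) * (t ^- 2)%:E)
          <= 4%:E * energy a v (t0^-1)%R)%E
      & limf_einf (fun t : R => (t^-1)%:E * potential a (v t))%E +oo = 0%E].
Proof.
have T00 : 0 < t0^-1 by rewrite invr_gt0.
pose X := nls_space (complex.Re a) (complex.Im a).
have [u0 ru0] := inH1_represents eps0_H1.
have [W [W0 cW dW eW]] := es_solution X T00 u0.
pose v s x := Complex (complex.Re a + (W s).1 x) (complex.Im a + (W s).2 x).
have rv s : represents a (v s) (W s).
  by split; [split; exact: affine_measurable|exact: aeW].
have ri : represents a (fun x => a + eps0 x) u0.
  apply/represents_shift; move: ru0; congr represents.
  by apply/funext => x; rewrite addrC addKr.
pose p t := es_P X (W t).
have p0 t : 0 <= p t := es_P_ge0 X _.
have cp t : {for t, continuous p} := vcont_P (t := t) cW.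
(* The balance with [G] the dissipated amount. Discarding [G] leaves the bound on v_x, discarding
   the energy at time [t] leaves the bound on the dissipation. *)
have eD := eW _ (dissipated_small T00 p0 cp) (is_derive_dissipated T00 cp).
have pot t : potential a (v t) = (p t)%:E := potential_represents (rv t).
have en : energy a v t0^-1 = (es_energy X t0^-1 u0)%:E.
  by rewrite (energy_represents (rv _)) W0.
have P0 u := es_P_ge0 X u.
have eD0 t : t0^-1 < t -> dissipated p t0^-1 t <= es_energy X t0^-1 u0.
  move=> Tt; apply: le_trans (eD t Tt); rewrite lerDr addr_ge0 ?mulr_ge0 ?sip_ge0//.
  by rewrite invr_ge0 mulr_ge0// ltW// (lt_trans T00).
have half u t : t0^-1 <= t -> 2^-1 * es_d X u u <= es_energy X t u.
  move=> Tt; rewrite lerDl mulr_ge0// invr_ge0 mulr_ge0// ltW//; exact: lt_le_trans Tt.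
exists v; split.
- split; first exact: vcont_continuous_H1 rv cW.
    by move=> t Tt; apply: (weak_equation (fun s (_ : t0^-1 <= s) => rv s) Tt) => phi; exact: dW.
  by apply: represents_unique (rv _) _; rewrite W0.
- move=> w [cw eqw iw] t Tt.
  (* A competing solution is constrained only from [t0^-1] on; the value 0 before that time is
     arbitrary. *)
  have /boolp.choice[W' rW'] : forall s, exists U : H1 R * H1 R,
      t0^-1 <= s -> represents a (w s) U.
    move=> s; have [Ts|sT] := leP t0^-1 s; last by exists 0.
    have [|U rU] := @inH1_represents _ (fun x => w s x - a).
      by apply: cw.1; rewrite /= in_itv/= andbT.
    by exists U => _; exact/represents_shift.
  have W'0 : W' t0^-1 = u0 by exact: represents_inj (rW' _ (lexx _)) ri iw.
  suff E : W' t = W t by apply: represents_unique (rW' t Tt) _; rewrite E.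
  move: Tt; rewrite le_eqVlt => /predU1P[<-|Tt]; first by rewrite W'0 W0.
  have maxE s : t0^-1 <= s -> Num.max s t0^-1 = s by move=> Ts; exact/max_idPl.
  have Dd u e : 0 < e -> exists2 w, test_pair w & sipn (es_g X) (w - u) < e.
    exact: test_pair_dense.
  (* Freezing the curve before [t0^-1] gives one that is continuous on all of R, as [es_unique]
     expects, and removes the arbitrary values. *)
  pose w' s := W' (Num.max s t0^-1).
  have c1 s : vcont (es_g X) w' s := continuous_H1_vcont rW' cw s.
  have d1 phi s : test_pair phi -> t0^-1 < s ->
      is_derive s 1 (fun r => es_h X (w' r) phi) (weak_rhs X s (w' s) phi).
    move=> tphi Ts; rewrite {2}/w' (maxE _ (ltW Ts)).
    have sT : 0 < s - t0^-1 by rewrite subr_gt0.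
    apply: (is_derive_near_eq sT _ (equation_weak rW' Ts (eqw s Ts) tphi)) => r.
    by rewrite ltr_norml /w' => /andP[rT _]; rewrite maxE//; lra.
  have d2 phi s : test_pair phi -> t0^-1 < s ->
      is_derive s 1 (fun r => es_h X (W r) phi) (weak_rhs X s (W s) phi).
    by move=> _; exact: dW.
  have i0 : w' t0^-1 = W t0^-1 by rewrite /w' maxE// W'0 W0.
  by have := es_unique T00 Dd c1 cW d1 d2 i0 Tt; rewrite /w' maxE// ltW.
- move=> t Tt; rewrite (sqL2_wderiv (rv t)) en -EFinM lee_fin.
  have {}half := half (W t) t Tt.
  suff : es_energy X t (W t) <= es_energy X t0^-1 u0.
    by rewrite -[sip_pair d0 (W t) (W t)]/(es_d X (W t) (W t)); lra.
  move: Tt; rewrite le_eqVlt => /predU1P[<-|Tt]; first by rewrite W0.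
  by apply: le_trans (eD t Tt); rewrite lerDl dissipated_ge0.
- rewrite en -EFinM; apply: le_trans (dissipation_integral T00 p0 cp eD0).
  by rewrite le_eqVlt; apply/predU1P; left; apply: eq_integral => t _; rewrite pot.
- rewrite -(dissipation_liminf T00 p0 cp eD0); congr (limf_einf _ _).
  by apply/funext => t; rewrite pot.
Qed.
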